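(* Let $X$ be a Noetherian $\mathbb{F}_1$-scheme, and for each $p\in X$ write $\mathcal{O}_{X,p}^{\times}=\mathbb{Z}^{n(p)}\times\prod_j\mathbb{Z}/m_j(p)\mathbb{Z}$ (a finite product of finite cyclic groups in the second factor). Then there are entire functions $h_1(s)$, $h_2(s)$ such that the (generalized) Soulé zeta function $\zeta_X(s)$ and the modified zeta function $\zeta_X^{\mathrm{disc}}(s)$ satisfy $$\zeta_X(s)=e^{h_1(s)}\,\zeta^{\mathrm{disc}}_X(s)=e^{h_2(s)}\prod_{p\in X}\left(\prod_{j=0}^{n(p)}(s-j)^{-\binom{n(p)}{j}(-1)^{n(p)-j}}\right)^{\mu\left(\prod_j\mathbb{Z}/m_j(p)\mathbb{Z}\right)},$$ where, for a finite abelian group $A=\prod_{j=1}^k\mathbb{Z}/n_j\mathbb{Z}$, with $|a|$ denoting the order of $a\in A$, $$\mu(A):=\sum_{a\in A}\frac1{|a|}=\frac{1}{\operatorname{lcm}(n_1,\ldots,n_k)}\sum_{l=1}^{\operatorname{lcm}(n_1,\ldots,n_k)}\gcd(l,n_1)\gcd(l,n_2)\cdots\gcd(l,n_k).$$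
   Context: A Noetherian $\mathbb{F}_1$-scheme is taken in the sense of Connes-Consani: its underlying space is a topological space with a sheaf of commutative monoids with absorbing zero, admitting a finite open cover by prime spectra of finitely generated such monoids. The only facts about $X$ that matter here are that $X$ has finitely many points, that for every $p\in X$ the unit group $\mathcal{O}_{X,p}^{\times}$ of the stalk at $p$ is a finitely generated abelian group, and that for $m\ge 1$ $$\#X(\mathbb{F}_{1^m})=\sum_{p\in X}\bigl|\operatorname{Hom}(\mathcal{O}_{X,p}^{\times},\mathbb{Z}/m\mathbb{Z})\bigr|,$$ where $X(\mathbb{F}_{1^m})=\operatorname{Hom}(\operatorname{Spec}\mathbb{F}_{1^m},X)$ and $\operatorname{Hom}$ on the right is homomorphisms of abelian groups. Counting function. For integers $n\ge 2$, $N_X(n)=\#X(\mathbb{F}_{1^{n-1}})$. It is extended to real $u\in[1,\infty)$ as follows. Write $\mathcal{O}_{X,p}^\times=\mathbb{Z}^{n(p)}\times\Gamma_p$ with $\Gamma_p$ finite, let $l=l(p)$ be the exponent of $\Gamma_p$, and $G_p(m)=|\operatorname{Hom}(\Gamma_p,\mathbb{Z}/m\mathbb{Z})|$, which is periodic in $m$ with period $l$. Let $c_p(k)=\frac1l\sum_{m=1}^{l}G_p(m)e^{-2\pi i km/l}$ and $$T_p(z)=\sum_{k\in\mathbb{Z},\,|k|<l/2}c_p(k)e^{2\pi i kz/l}+\varepsilon_l\,c_p(l/2)\cos(\pi z),$$ where $\varepsilon_l=1$ if $l$ is even, and the last term is absent if $l$ is odd. Thus $T_p(m)=G_p(m)$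 for all integers $m\ge1$. Then $$N_X(u)=\sum_{p\in X}(u-1)^{n(p)}\,T_p(u-1)\qquad(u\ge 1),$$ with $0^0=1$. The number $\chi(X):=N_X(1)$ is called the Euler characteristic of $X$. Zeta functions. On the half-plane $H=\{\Re(s)>\max_{p\in X}n(p)\}$, $\zeta_X(s)$ and $\zeta_X^{\mathrm{disc}}(s)$ are nowhere vanishing holomorphic functions (defined up to a nonzero multiplicative constant) characterized by $$\frac{\partial_s\zeta_X(s)}{\zeta_X(s)}=-\int_1^\infty N_X(u)\,u^{-s-1}\,du,\qquad \frac{\partial_s\zeta_X^{\mathrm{disc}}(s)}{\zeta_X^{\mathrm{disc}}(s)}=-\sum_{n\ge1}N_X(n)\,n^{-s-1}=-\chi(X)-\sum_{m=1}^\infty\#X(\mathbb{F}_{1^m})(m+1)^{-s-1}.$$ The exponents in the product are rational numbers in general. The identities are read on $H$ with $(s-j)^c=\exp(c\operatorname{Log}(s-j))$, principal branch (note $\Re(s-j)>0$ on $H$ for all $j$ that occur), and elsewhere by analytic continuation. *)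

(* Defs.v *)
From HB Require Import structures.
From mathcomp Require Import all_boot all_algebra all_fingroup all_solvable.
From mathcomp Require Import finmap boolp classical_sets functions cardinality.
From mathcomp Require Import topology.
From Stdlib Require Import Reals.
From Coquelicot Require Import Coquelicot.

Set Implicit Arguments.
Unset Strict Implicit.
Unset Printing Implicit Defensive.

(** * Commutative monoids with absorbing zero *)

(* [zero = one] is allowed: it holds in the monoid of sections over the empty
   set. *)
Record monoid0 := Monoid0 {
  carrier0 :> Type;
  mul0 : carrier0 -> carrier0 -> carrier0;
  one0 : carrier0;
  zero0 : carrier0;
  mul0A : associative mul0;
  mul0C : commutative mul0;
  mul01 : left_id one0 mul0;
  mul00 : left_zero zero0 mul0
}.

Arguments one0 {m}.
Arguments zero0 {m}.

Definition is_hom0 (M N : monoid0) (f : M -> N) : Prop :=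
  [/\ f one0 = one0, f zero0 = zero0 &
      forall x y, f (mul0 x y) = mul0 (f x) (f y)].

Definition unit0 (M : monoid0) (x : M) : Prop := exists y, mul0 x y = one0.

Definition pow0 (M : monoid0) (x : M) (k : nat) : M := iter k (mul0 x) one0.

Definition fin_gen0 (M : monoid0) : Prop :=
  exists (k : nat) (g : 'I_k -> M),
    forall x, exists t : seq 'I_k, x = \big[@mul0 M/one0]_(i <- t) g i.

Definition prime_ideal0 (M : monoid0) (P : set M) : Prop :=
  [/\ P zero0, ~ P one0,
      forall x y, P y -> P (mul0 x y) &
      forall x y, P (mul0 x y) -> P x \/ P y].

(** * Noetherian F_1-schemes *)

(* A sheaf of monoids on X.  The families [sec] and [res] are total, but only
   their values on open sets matter. *)
Record monoidal_space := MonoidalSpace {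
  space :> topologicalType;
  sec : set space -> monoid0;
  res : forall U V : set space, sec U -> sec V;
  res_hom : forall U V, topology_structure.open U ->
    topology_structure.open V -> (V `<=` U)%classic -> is_hom0 (@res U V);
  res_id : forall U (s : sec U), topology_structure.open U -> res U s = s;
  res_comp : forall U V W (s : sec U), topology_structure.open U ->
    topology_structure.open V -> topology_structure.open W ->
    (V `<=` U)%classic -> (W `<=` V)%classic ->
    res W (res V s) = res W s;
  res_glue : forall (I : Type) (U : I -> set space) (s : forall i, sec (U i)),
    (forall i, topology_structure.open (U i)) ->
    (forall i j, res (U i `&` U j)%classic (s i) =
                 res (U i `&` U j)%classic (s j)) ->
    exists! t : sec (\bigcup_i U i)%classic, forall i, res (U i) t = s i
}.

Arguments res {m U} V s.

Section AffineChart.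
Variables (X : monoidal_space) (M : monoid0) (U : set X).
Variables (phi : M -> sec U) (e : X -> set M).

Definition chart_basic (f : M) : set X :=
  [set p | U p /\ ~ e p f]%classic.

(* [e] and [phi] identify (U, O_X|U) with Spec M: [e] is a homeomorphism from U
   onto the set of prime ideals of M, whose topology has the sets
   D(f) = {P | f \notin P} as a basis, and the structure sheaf of Spec M is the
   one whose value on D(f) is the localization of M at the powers of f. *)
Record is_affine_chart : Prop := IsAffineChart {
  chart_open : topology_structure.open U;
  chart_prime : forall p, U p -> prime_ideal0 (e p);
  chart_inj : forall p q, U p -> U q -> e p = e q -> p = q;
  chart_surj : forall P : set M, prime_ideal0 P -> exists2 p, U p & e p = P;
  chart_top : forall V : set X, (V `<=` U)%classic ->
    topology_structure.open V <->
    (forall p, V p -> exists2 f, chart_basic f p & (chart_basic f `<=` V)%classic);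
  chart_hom : is_hom0 phi;
  chart_unit : forall f, unit0 (res (chart_basic f) (phi f));
  chart_frac : forall f (t : sec (chart_basic f)), exists (a : M) (k : nat),
    mul0 t (res (chart_basic f) (phi (pow0 f k))) = res (chart_basic f) (phi a);
  chart_eq : forall f (a b : M),
    res (chart_basic f) (phi a) = res (chart_basic f) (phi b) <->
    exists k, mul0 (pow0 f k) a = mul0 (pow0 f k) b
}.

End AffineChart.

Definition noetherian_F1_scheme (X : monoidal_space) : Prop :=
  exists (k : nat) (U : 'I_k -> set X),
    (forall p : X, exists i, U i p) /\
    forall i, exists (M : monoid0) (phi : M -> sec (U i)) (e : X -> set M),
      fin_gen0 M /\ is_affine_chart phi e.

(* The stalk of O_X at p, as a filtered colimit of the O_X(U), p \in U.  It is
   determined by (X, p) up to unique isomorphism. *)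
Record stalk (X : monoidal_space) (p : X) := Stalk {
  stalk_monoid :> monoid0;
  germ : forall U : set X, sec U -> stalk_monoid;
  germ_hom : forall U, topology_structure.open U -> U p -> is_hom0 (@germ U);
  germ_res : forall U V (s : sec U), topology_structure.open U ->
    topology_structure.open V -> (V `<=` U)%classic -> V p ->
    germ (res V s) = germ s;
  germ_surj : forall x : stalk_monoid, exists (U : set X) (s : sec U),
    [/\ topology_structure.open U, U p & germ s = x];
  germ_eq : forall U (s t : sec U), topology_structure.open U -> U p ->
    germ s = germ t ->
    exists V, [/\ topology_structure.open V, V p, (V `<=` U)%classic &
                  res V s = res V t]
}.

(** * Finite abelian groups, and points over F_{1^m} *)

(* Z/nZ for n >= 1; ['I_n.+1] carries the group law of addition mod n.+1 (the
   type 'Z_n is not used since 'Z_1 is Z/2). *)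
Definition cyc (n : nat) : finGroupType := 'I_n.-1.+1.

Fixpoint cyc_prod (ns : seq nat) : finGroupType :=
  if ns is n :: ns' then (cyc n * cyc_prod ns')%type else 'I_1.

(* |Hom(A, B)| *)
Definition nhom (A B : finGroupType) : nat :=
  #|[set f : {ffun A -> B} |
      [forall x, forall y, f (x * y)%g == (f x * f y)%g]]|%SET.

(* The unit group of M is isomorphic to Z^n x \prod_j Z/m_jZ. *)
Definition units_decomp (M : monoid0) (n : nat) (ms : seq nat) : Prop :=
  all (leq 1) ms /\
  exists theta : 'rV[int]_n -> cyc_prod ms -> M,
    [/\ forall u v g h, theta (GRing.add u v) (g * h)%g = mul0 (theta u g) (theta v h),
        forall u v g h, theta u g = theta v h -> u = v /\ g = h &
        forall x, unit0 x <-> exists u g, theta u g = x].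

(* F_{1^m} = (Z/mZ) \cup {0}, with [None] as zero. *)
Section F1m.
Variable m : nat.

Definition F1m_mul (x y : option (cyc m)) : option (cyc m) :=
  if x is Some a then if y is Some b then Some (a * b)%g else None else None.

Lemma F1m_mulA : associative F1m_mul.
Proof. by move=> [a|] [b|] [c|] //=; rewrite mulgA. Qed.

Lemma F1m_mulC : commutative F1m_mul.
Proof. by move=> [a|] [b|] //=; congr Some; apply: Zp_mulgC. Qed.

Lemma F1m_mul1 : left_id (Some 1%g) F1m_mul.
Proof. by move=> [a|] //=; rewrite mul1g. Qed.

Lemma F1m_mul0 : left_zero None F1m_mul.
Proof. by []. Qed.

Definition F1m : monoid0 := Monoid0 F1m_mulA F1m_mulC F1m_mul1 F1m_mul0.

End F1m.

(* The number of elements of a finite set (0 if the set is infinite). *)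
Definition ncard (T : Type) (A : set T) : nat :=
  xget 0%nat [set k | (A #= `I_k)%card]%classic.

(* Spec F_{1^m} is a one-point space with sections F_{1^m}, so a morphism
   Spec F_{1^m} -> X is a point p of X with a local morphism of monoids
   O_{X,p} -> F_{1^m}. *)
Definition F1m_points (X : monoidal_space) (O : forall p : X, stalk p) (m : nat) :
    set {p : X & O p -> F1m m} :=
  [set x | let f : O (projT1 x) -> F1m m := projT2 x in
           is_hom0 f /\ forall a, unit0 (f a) -> unit0 a]%classic.

Arguments F1m_points {X} O m _.

Definition num_points (X : monoidal_space) (O : forall p : X, stalk p) (m : nat) :
  nat := ncard (F1m_points O m).

(** * Complex analysis *)

Open Scope C_scope.

Definition Cexp (z : C) : C :=
  (Rmult (exp (Re z)) (cos (Im z)), Rmult (exp (Re z)) (sin (Im z))).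

(* Principal argument, in ]-PI, PI]. *)
Definition Carg (z : C) : R :=
  let t := acos (Rdiv (Re z) (Cmod z)) in
  if Rle_dec (IZR 0) (Im z) then t else Ropp t.

Definition Clog (z : C) : C := (ln (Cmod z), Carg z).

Definition Cpower (z c : C) : C := Cexp (c * Clog z).

Definition is_Cderive (f : C -> C) (z d : C) : Prop :=
  @is_derive C_AbsRing C_NormedModule f z d.

Definition entire (f : C -> C) : Prop := forall z, exists d, is_Cderive f z d.

(** * The counting function *)

Section Trig.
Variable A : finGroupType.

Let l : nat := exponent [set: A]%g.

Definition fourier_coef (k : Z) : C :=
  / INR l * \big[Cplus/RtoC 0]_(1 <= m < l.+1)
    (INR (nhom A (cyc m)) * Cexp (- (2 * PI * Ci * IZR k * INR m / INR l))).

(* The index i stands for k = i - l, so that k runs over all integers with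
   |k| <= l before the condition |k| < l/2 is imposed. *)
Definition trig_ext (z : R) : C :=
  \big[Cplus/RtoC 0]_(i < l.*2.+1 |
      Z.ltb (Z.mul 2 (Z.abs (Z.sub (Z.of_nat i) (Z.of_nat l)))) (Z.of_nat l))
    (let k := Z.sub (Z.of_nat i) (Z.of_nat l) in
     fourier_coef k * Cexp (2 * PI * Ci * IZR k * z / INR l))
  + (if odd l then RtoC 0
     else fourier_coef (Z.of_nat l./2) * cos (Rmult PI z)).

End Trig.

Section Zeta.
Variables (X : monoidal_space) (O : forall p : X, stalk p).
Variables (n : X -> nat) (ms : X -> seq nat).

Definition points : {fset X} := fset_set [set: X]%classic.

(* N_X(u) for real u >= 1; note that [pow 0 0 = 1]. *)
Definition count_ext (u : R) : C :=
  \big[Cplus/RtoC 0]_(p <- points)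
    (pow (Rminus u 1) (n p) * trig_ext (cyc_prod (ms p)) (Rminus u 1)).

Definition euler_char : C := count_ext 1.

(* N_X(k) for integers k >= 1. *)
Definition count_int (k : nat) : C :=
  if k == 1%nat then euler_char else INR (num_points O k.-1).

Definition half_plane (s : C) : Prop :=
  Rlt (INR (\max_(p <- points) n p)) (Re s).

(* [zeta] is a nowhere vanishing holomorphic function on the half-plane, with
   zeta'/zeta = - L. *)
Definition log_deriv_on (zeta : C -> C) (L : C -> C -> Prop) : Prop :=
  forall s, half_plane s ->
    zeta s <> RtoC 0 /\
    exists d v, [/\ is_Cderive zeta s d, L s v & d / zeta s = - v].

Definition is_soule_zeta (zeta : C -> C) : Prop :=
  log_deriv_on zeta (fun s v =>
    @is_RInt_gen C_R_NormedModule
      (fun u : R => count_ext u * Cpower u (- s - 1))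
      (at_point (IZR 1)) (Rbar_locally p_infty) v).

Definition is_disc_zeta (zeta : C -> C) : Prop :=
  log_deriv_on zeta (fun s v =>
    @is_series C_AbsRing C_NormedModule
      (fun i : nat => count_int i.+1 * Cpower (INR i.+1) (- s - 1)) v).

End Zeta.

(** * The invariant mu and the product *)

Definition mu (A : finGroupType) : R :=
  \big[Rplus/IZR 0]_(a : A) Rinv (INR #[a]%g).

Definition mu_gcd (ns : seq nat) : R :=
  let L := \big[lcmn/1%nat]_(k <- ns) k in
  Rmult (Rinv (INR L)) (INR (\sum_(1 <= l < L.+1) \prod_(k <- ns) gcdn l k)).

Definition zeta_exponent (n j : nat) : R :=
  Ropp (Rmult (INR 'C(n, j)) (pow (IZR (-1)) (n - j))).

(* The factors are multiplied with (s - j)^c = exp (c Log (s - j)), where c is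
   the total exponent of (s - j) for the point p. *)
Definition zeta_product (X : monoidal_space) (n : X -> nat) (ms : X -> seq nat)
    (s : C) : C :=
  \big[Cmult/RtoC 1]_(p <- points X)
    \big[Cmult/RtoC 1]_(j < (n p).+1)
      Cpower (s - INR j)
             (Rmult (zeta_exponent (n p) j) (mu (cyc_prod (ms p)))).

(* Main.v *)
Require Import Defs.
From HB Require Import structures.
From mathcomp Require Import all_boot all_algebra all_fingroup all_solvable.
From mathcomp Require Import finmap boolp classical_sets cardinality.
From mathcomp Require Import topology zify.
From Stdlib Require Import Reals Lra Lia.
From Coquelicot Require Import Coquelicot.

(** The summand of the counting function at a point is (u - 1)^n T(u - 1).  At
    integers m >= 1, T(m) = |Hom(Gamma, Z/mZ)|, so the discrete sum runs over the
    same function as the integral, and the mean of T over a period is mu(Gamma),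
    whether it is taken over integers or over reals.  After expanding (u - 1)^n,
    both logarithmic derivatives are combinations of
      sum_(k >= 1) c(k) k^(-w)   and   int_(1 <= u) f(u) u^(-w) du,   w = s - j + 1,
    with c and f periodic of mean mu.  Each of these is mu / (w - 1) plus an
    entire function: when f has mean zero, integration by parts gives
    -F(1) + w int_(1 <= u) F(u) u^(-w-1) du, where F is the primitive of mean
    zero, again periodic, and this can be iterated; the sums reduce to integrals
    of piecewise linear functions.  Hence the two logarithmic derivatives differ
    from that of the product by entire functions, which have entire primitives,
    and a nonvanishing function on a half-plane is determined up to a constant
    factor by its logarithmic derivative. *)

Set Implicit Arguments.
Unset Strict Implicit.
Unset Printing Implicit Defensive.

(** * Complex-valued functions of a real variable *)

Section RealVariable.
Local Open Scope R_scope.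

(** The analysis avoids Cauchy's theory. Next to differentiability, continuity of the derivative is
    carried along ([C1at]): it is what makes the radial primitive of [C1_primitive] differentiable.
    In place of an identity theorem, the continuations obtained from different numbers of
    integrations by parts are unfolded in parallel until both are the sum of one convergent series.
    Integrals over [1, oo[ are cut into pieces over [n + 1, n + 2]. Then only continuous integrands
    on [0, 1] occur, jumps at the integers are harmless, and integrals and series are both instances
    of [Csum]. Differentiation under the sum is an explicit estimate on Re w >= 7, far to the right
    of the abscissa of convergence, where powers of u can be wasted to absorb logarithms; repeated
    integration by parts moves any w there. The hypotheses on the zeta functions provide values of
    the integral and of the series, so uniqueness of limits identifies them. The term n = 1 of the
    discrete sum, which counts no points, fits in because it involves the value at 0 of the same
    trigonometric interpolation. *)

Lemma C_ext (x y : C) : Re x = Re y -> Im x = Im y -> x = y.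
Proof. by case: x y => [a b] [c d] /= -> ->. Qed.

Lemma Im_le_Cmod (z : C) : Rabs (Im z) <= Cmod z.
Proof.
case: z => a b; have := Rmax_Cmod (a, b) => /= H.
exact: (Rle_trans _ _ _ (Rmax_r _ _) H).
Qed.

Lemma Re_le_Cmod (z : C) : Re z <= Cmod z.
Proof. by apply: (Rle_trans _ _ _ (Rle_abs _)); exact: re_le_Cmod. Qed.

Lemma Cmod_le_Re_Im (z : C) : Cmod z <= Rabs (Re z) + Rabs (Im z).
Proof.
have -> : z = (RtoC (Re z) + Ci * RtoC (Im z))%C.
  by apply: C_ext; rewrite /Re /Im /=; ring.
apply: (Rle_trans _ _ _ (Cmod_triangle _ _)).
rewrite Cmod_mult Cmod_Ci !Cmod_R re_plus re_mult im_plus im_mult !re_RtoC !im_RtoC.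
rewrite /Ci /=; apply: Req_le; rewrite !(Rmult_0_l, Rmult_1_l, Rmult_0_r, Rplus_0_r, Rplus_0_l).
by rewrite !Rminus_0_r Rplus_0_r.
Qed.

Lemma Cmod_sq_Re (u : C) : Re (Cconj u * u)%C = Cmod u * Cmod u.
Proof.
have := Cmod2_alt u; rewrite re_mult re_conj im_conj => H.
have -> : Cmod u * Cmod u = Cmod u ^ 2 by ring.
by rewrite H; ring.
Qed.

(** Componentwise, so that real calculus applies to [Re] and [Im] separately; [Rcont] and [Cint]
    follow the same pattern. *)
Definition Rder (g : R -> C) (t : R) (d : C) : Prop :=
  is_derive (fun t => Re (g t)) t (Re d) /\ is_derive (fun t => Im (g t)) t (Im d).

Definition Rcont (g : R -> C) (t : R) : Prop :=
  continuous (fun t => Re (g t)) t /\ continuous (fun t => Im (g t)) t.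

Lemma Rder_eq g t d d' : Rder g t d -> d = d' -> Rder g t d'.
Proof. by move=> H <-. Qed.

Lemma Rder_ext f g t d : (forall x, f x = g x) -> Rder f t d -> Rder g t d.
Proof.
move=> E [H1 H2]; split.
- by apply: (is_derive_ext _ _ _ _ _ H1) => x; rewrite E.
- by apply: (is_derive_ext _ _ _ _ _ H2) => x; rewrite E.
Qed.

Lemma Rder_cont g t d : Rder g t d -> Rcont g t.
Proof.
move=> [H1 H2]; split; apply: (ex_derive_continuous (V := R_NormedModule)).
- by exists (Re d).
- by exists (Im d).
Qed.

Lemma Rder_const (c : C) t : Rder (fun _ => c) t 0.
Proof. by split; apply: is_derive_const. Qed.

Lemma Rder_real (g : R -> R) t (d : R) :
  is_derive g t d -> Rder (fun t => RtoC (g t)) t (RtoC d).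
Proof. by move=> H; split => //; apply: is_derive_const. Qed.

Lemma Rder_plus f g t df dg :
  Rder f t df -> Rder g t dg -> Rder (fun t => f t + g t)%C t (df + dg)%C.
Proof.
by move=> [f1 f2] [g1 g2]; split; [apply: (is_derive_plus _ _ _ _ _ f1 g1)
  | apply: (is_derive_plus _ _ _ _ _ f2 g2)].
Qed.

Lemma is_deriveR_mult (f g : R -> R) t df dg : is_derive f t df -> is_derive g t dg ->
  is_derive (fun t => f t * g t) t (df * g t + f t * dg).
Proof. by move=> Hf Hg; apply: (is_derive_mult f g t df dg Hf Hg); exact: Rmult_comm. Qed.

Lemma Rder_mult f g t df dg :
  Rder f t df -> Rder g t dg -> Rder (fun t => f t * g t)%C t (df * g t + f t * dg)%C.
Proof.
move=> [f1 f2] [g1 g2]; split.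
- have H := is_derive_minus _ _ _ _ _ (is_deriveR_mult f1 g1) (is_deriveR_mult f2 g2).
  apply: (@is_derive_ext _ _ _ _ _ _ (fun x => esym (re_mult (f x) (g x)))).
  have -> // : Re (df * g t + f t * dg)%C = minus (Re df * Re (g t) + Re (f t) * Re dg)
    (Im df * Im (g t) + Im (f t) * Im dg).
  by rewrite re_plus !re_mult /minus /plus /opp /=; ring.
- have H := is_derive_plus _ _ _ _ _ (is_deriveR_mult f1 g2) (is_deriveR_mult f2 g1).
  apply: (@is_derive_ext _ _ (fun x => plus (Re (f x) * Im (g x)) (Im (f x) * Re (g x)))).
    by move=> x; rewrite im_mult /plus /=.
  have -> // : Im (df * g t + f t * dg)%C = plus (Re df * Im (g t) + Re (f t) * Im dg)
    (Im df * Re (g t) + Im (f t) * Re dg).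
  by rewrite im_plus !im_mult /plus /=; ring.
Qed.

Lemma Rder_comp (f : R -> C) (g : R -> R) t df dg :
  Rder f (g t) df -> is_derive g t dg -> Rder (fun t => f (g t)) t (RtoC dg * df)%C.
Proof.
move=> [f1 f2] Hg; split.
- by rewrite re_mult re_RtoC im_RtoC Rmult_0_l Rminus_0_r; apply: (is_derive_comp _ _ _ _ _ f1 Hg).
- by rewrite im_mult re_RtoC im_RtoC Rmult_0_l Rplus_0_r; apply: (is_derive_comp _ _ _ _ _ f2 Hg).
Qed.

Lemma Rcont_const (c : C) t : Rcont (fun _ => c) t.
Proof. by split; apply: continuous_const. Qed.

Lemma Rcont_real (g : R -> R) t : continuous g t -> Rcont (fun t => RtoC (g t)) t.
Proof. by move=> H; split => //; apply: continuous_const. Qed.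

Lemma Rcont_ext f g t : (forall x, f x = g x) -> Rcont f t -> Rcont g t.
Proof.
move=> E [H1 H2]; split.
- by apply: (continuous_ext _ _ _ _ H1) => x; rewrite E.
- by apply: (continuous_ext _ _ _ _ H2) => x; rewrite E.
Qed.

Lemma Rcont_plus f g t : Rcont f t -> Rcont g t -> Rcont (fun t => f t + g t)%C t.
Proof.
by move=> [f1 f2] [g1 g2]; split; [apply: (continuous_plus _ _ _ f1 g1)
  | apply: (continuous_plus _ _ _ f2 g2)].
Qed.

Lemma Rcont_mult f g t : Rcont f t -> Rcont g t -> Rcont (fun t => f t * g t)%C t.
Proof.
move=> [f1 f2] [g1 g2]; split.
- apply: (continuous_ext _ _ _ (fun x => esym (re_mult (f x) (g x)))).
  by apply: (continuous_minus (V := R_NormedModule)); apply: (continuous_mult (K := R_AbsRing)).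
- apply: (continuous_ext _ _ _ (fun x => esym (im_mult (f x) (g x)))).
  by apply: (continuous_plus (V := R_NormedModule)); apply: (continuous_mult (K := R_AbsRing)).
Qed.

Lemma Rcont_comp (f : R -> C) (g : R -> R) t :
  Rcont f (g t) -> continuous g t -> Rcont (fun t => f (g t)) t.
Proof.
by move=> [f1 f2] Hg; split; [apply: (continuous_comp g (fun x => Re (f x)))
  | apply: (continuous_comp g (fun x => Im (f x)))].
Qed.

Lemma Rcont_sum (I : Type) (r : seq I) (P : pred I) (f : I -> R -> C) t :
  (forall i, Rcont (f i) t) ->
  Rcont (fun t => \big[Cplus/RtoC 0]_(i <- r | P i) f i t) t.
Proof.
move=> H; elim: r => [|i r IH].
  by apply: (Rcont_ext _ (Rcont_const 0 t)) => x; rewrite big_nil.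
case: (boolP (P i)) => Pi.
- by apply: (Rcont_ext _ (Rcont_plus (H i) IH)) => x; rewrite big_cons Pi.
- by apply: (Rcont_ext _ IH) => x; rewrite big_cons (negbTE Pi).
Qed.

(* The real mean value theorem applied to [Re (conj u * g)], [u = g b - g a]. *)
Lemma Rder_MVT (g dg : R -> C) (a b M : R) : a <= b ->
  (forall t, a <= t <= b -> Rder g t (dg t)) ->
  (forall t, a <= t <= b -> Cmod (dg t) <= M) ->
  Cmod (g b - g a)%C <= M * (b - a).
Proof.
move=> ab Hd HM; set u := (g b - g a)%C.
have [c [Hc E]] : exists c, a <= c <= b /\
    Re (Cconj u * g b)%C - Re (Cconj u * g a)%C = Re (Cconj u * dg c)%C * (b - a).
  have D t : a <= t <= b -> is_derive (fun t => Re (Cconj u * g t)%C) t (Re (Cconj u * dg t)%C).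
    move=> Ht; have := (Rder_mult (Rder_const (Cconj u) t) (Hd t Ht)).1.
    by rewrite Cmult_0_l Cplus_0_l.
  have := @MVT_gen (fun t => Re (Cconj u * g t)%C) a b (fun t => Re (Cconj u * dg t)%C).
  rewrite Rmin_left // Rmax_right //; apply.
  - by move=> x Hx; apply: D; lra.
  - move=> x Hx; apply/continuity_pt_filterlim.
    apply: (@ex_derive_continuous R_AbsRing R_NormedModule (fun t => Re (Cconj u * g t)%C) x).
    by eexists; apply: D; lra.
have E2 : Cmod u * Cmod u = Re (Cconj u * dg c)%C * (b - a).
  by rewrite -Cmod_sq_Re -E {2}/u !re_mult re_conj im_conj /u !re_plus !im_plus !re_opp !im_opp; ring.
have H3 : Re (Cconj u * dg c)%C <= Cmod u * M.
  apply: (Rle_trans _ _ _ (Re_le_Cmod _)); rewrite Cmod_mult Cmod_conj.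
  by apply: Rmult_le_compat_l; [exact: Cmod_ge_0 | apply: HM].
have H0 := Cmod_ge_0 u.
have M0 : 0 <= M by apply: (Rle_trans _ _ _ (Cmod_ge_0 (dg c))); apply: HM.
case: (Req_dec (Cmod u) 0) => [->|Hu]; first by apply: Rmult_le_pos; lra.
by apply: (Rmult_le_reg_l (Cmod u)); [lra | rewrite E2; nra].
Qed.

Definition Cint (f : R -> C) (a b : R) : C :=
  (RInt (fun t => Re (f t)) a b, RInt (fun t => Im (f t)) a b).

Lemma ex_RInt_cont (f : R -> R) a b : a <= b ->
  (forall t, a <= t <= b -> continuous f t) -> ex_RInt f a b.
Proof.
move=> ab H; apply: (ex_RInt_continuous (V := R_CompleteNormedModule)) => z.
by rewrite Rmin_left // Rmax_right //; exact: H.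
Qed.

Lemma Cint_ext f g a b : a <= b -> (forall t, a <= t <= b -> f t = g t) ->
  Cint f a b = Cint g a b.
Proof.
by move=> ab H; congr pair; apply: RInt_ext => x;
  rewrite Rmin_left // Rmax_right // => Hx; rewrite H //; lra.
Qed.

Lemma Cint_plus f g a b : a <= b -> (forall t, a <= t <= b -> Rcont f t) ->
  (forall t, a <= t <= b -> Rcont g t) ->
  Cint (fun t => f t + g t)%C a b = (Cint f a b + Cint g a b)%C.
Proof.
move=> ab Hf Hg; congr pair; apply: (RInt_plus (V := R_CompleteNormedModule));
  by apply: ex_RInt_cont => // t Ht; case: (Hf t Ht); case: (Hg t Ht).
Qed.

Lemma Cint_scal (c : C) f a b : a <= b -> (forall t, a <= t <= b -> Rcont f t) ->
  Cint (fun t => c * f t)%C a b = (c * Cint f a b)%C.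
Proof.
move=> ab Hf.
have E1 : ex_RInt (fun t => Re (f t)) a b by apply: ex_RInt_cont => // t /Hf [].
have E2 : ex_RInt (fun t => Im (f t)) a b by apply: ex_RInt_cont => // t /Hf [].
have ReC g : Re (Cint g a b) = RInt (fun t => Re (g t)) a b by [].
have ImC g : Im (Cint g a b) = RInt (fun t => Im (g t)) a b by [].
apply: C_ext.
- rewrite re_mult !ReC ImC.
  rewrite (RInt_ext _ (fun t => minus (scal (Re c) (Re (f t))) (scal (Im c) (Im (f t))))); last first.
    by move=> x _; rewrite re_mult.
  rewrite RInt_minus ?RInt_scal //; by apply: (ex_RInt_scal (V := R_NormedModule)).
- rewrite im_mult !ImC ReC.
  rewrite (RInt_ext _ (fun t => plus (scal (Re c) (Im (f t))) (scal (Im c) (Re (f t))))); last first.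
    by move=> x _; rewrite im_mult.
  rewrite RInt_plus ?RInt_scal //; by apply: (ex_RInt_scal (V := R_NormedModule)).
Qed.

(** Pairing with the conjugate of the value u of the integral gives |u|^2 as the integral of the
    real function Re (conj u * f), which is at most |u| M. Bounding the two components separately
    would lose a constant. *)
Lemma Cint_bound f a b M : a <= b -> (forall t, a <= t <= b -> Rcont f t) ->
  (forall t, a <= t <= b -> Cmod (f t) <= M) -> Cmod (Cint f a b) <= M * (b - a).
Proof.
move=> ab Hf HM; set u := Cint f a b.
have E : Cmod u * Cmod u = RInt (fun t => Re (Cconj u * f t)%C) a b.
  by rewrite -Cmod_sq_Re {2}/u -Cint_scal.
have H3 : RInt (fun t => Re (Cconj u * f t)%C) a b <= RInt (fun _ => Cmod u * M) a b.
  apply: RInt_le => //.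
  - apply: ex_RInt_cont => // t Ht.
    by case: (Rcont_mult (Rcont_const (Cconj u) t) (Hf t Ht)).
  - exact: ex_RInt_const.
  - move=> x Hx; apply: (Rle_trans _ _ _ (Re_le_Cmod _)); rewrite Cmod_mult Cmod_conj.
    by apply: Rmult_le_compat_l; [exact: Cmod_ge_0 | apply: HM; lra].
have E3 : RInt (fun _ : R => Cmod u * M) a b = (b - a) * (Cmod u * M) by rewrite RInt_const.
rewrite E3 in H3.
have H0 := Cmod_ge_0 u.
have M0 : 0 <= M by apply: (Rle_trans _ _ _ (Cmod_ge_0 (f a))); apply: HM; lra.
case: (Req_dec (Cmod u) 0) => [->|Hu]; first by apply: Rmult_le_pos; lra.
by apply: (Rmult_le_reg_l (Cmod u)); [lra | rewrite E; nra].
Qed.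

Lemma Cint_derive (F f : R -> C) a b : a <= b ->
  (forall t, a <= t <= b -> Rder F t (f t)) -> (forall t, a <= t <= b -> Rcont f t) ->
  Cint f a b = (F b - F a)%C.
Proof.
move=> ab HF Hf; congr pair; apply: is_RInt_unique;
  [ apply: (@is_RInt_derive R_CompleteNormedModule (fun t => Re (F t)) (fun t => Re (f t)) a b)
  | apply: (@is_RInt_derive R_CompleteNormedModule (fun t => Im (F t)) (fun t => Im (f t)) a b)] => x;
  by rewrite Rmin_left // Rmax_right // => Hx; case: (HF x Hx); case: (Hf x Hx).
Qed.

Lemma Rder_Cint (f : R -> C) a t : (forall x, Rcont f x) -> Rder (fun t => Cint f a t) t (f t).
Proof.
move=> Hf.
have D (g : R -> R) : (forall x, continuous g x) -> is_derive (fun t => RInt g a t) t (g t).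
  move=> Hg; apply: (@is_derive_RInt R_NormedModule g (fun t => RInt g a t) a t) => //.
  apply: filter_forall => x; apply: (RInt_correct (V := R_CompleteNormedModule)).
  exact: (ex_RInt_continuous (V := R_CompleteNormedModule)).
by split; apply: D => x; case: (Hf x).
Qed.

Lemma Cint_point f a : Cint f a a = 0.
Proof. by rewrite /Cint !RInt_point. Qed.

Lemma Cint_Chasles f a b c : a <= b -> b <= c -> (forall t, a <= t <= c -> Rcont f t) ->
  (Cint f a b + Cint f b c)%C = Cint f a c.
Proof.
move=> ab bc Hf; congr pair; apply: (RInt_Chasles (V := R_CompleteNormedModule));
  by apply: ex_RInt_cont => // t Ht; case: (Hf t) => //; lra.
Qed.

Lemma Cint_shift f a b k : a <= b -> (forall t, a <= t <= b -> Rcont f t) ->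
  Cint (fun t => f (t + k)) (a - k) (b - k) = Cint f a b.
Proof.
move=> ab Hf.
have E (g : R -> R) : ex_RInt g a b ->
    RInt (fun t => g (t + k)) (a - k) (b - k) = RInt g a b.
  move=> Hg; apply: is_RInt_unique.
  have := @is_RInt_comp_lin R_NormedModule g 1 k (a - k) (b - k) (RInt g a b).
  have -> : 1 * (a - k) + k = a by ring.
  have -> : 1 * (b - k) + k = b by ring.
  move=> /(_ (RInt_correct (V := R_CompleteNormedModule) _ _ _ Hg)).
  by apply: is_RInt_ext => x _; rewrite /scal /= /mult /= Rmult_1_l Rmult_1_l.
by congr pair; apply: E; apply: ex_RInt_cont => // t /Hf [].
Qed.

End RealVariable.

(** * Complex derivatives *)

Section ComplexDerivative.
Local Open Scope R_scope.

Lemma is_CderiveE (f : C -> C) z d : is_Cderive f z d <->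
  forall eps, 0 < eps -> exists delta, 0 < delta /\
    forall h, Cmod h < delta -> Cmod (f (z + h) - f z - h * d)%C <= eps * Cmod h.
Proof.
have E h : (z + h - z = h)%C by ring.
split.
- move=> [_ H] eps e0.
  have [|del Hd] := H z _ (mkposreal eps e0); first by move=> P.
  exists del; split; first exact: cond_pos.
  move=> h Hh; have := Hd (z + h)%C.
  change (minus (z + h)%C z) with (z + h - z)%C; rewrite E; apply.
  by change (Cmod (z + h - z)%C < del); rewrite E.
- move=> H; split; first exact: is_linear_scal_l.
  move=> x Hx; have <- : z = x by exact: (@is_filter_lim_locally_unique C_AbsRing (AbsRing_NormedModule C_AbsRing) z x Hx).
  move=> eps; have [del [d0 Hd]] := H eps (cond_pos eps).
  exists (mkposreal del d0) => y Hy.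
  have := Hd (y - z)%C Hy.
  by have -> : (z + (y - z))%C = y by ring.
Qed.

(* [C_NormedModule] and [C_AbsRing] carry different uniform structures, so that
   Coquelicot's rules for functions [K -> K] do not apply directly. *)
Lemma is_Cderive_AbsRing f z d :
  is_Cderive f z d <-> @is_derive C_AbsRing (AbsRing_NormedModule C_AbsRing) f z d.
Proof. by split; case=> _ H; (split; [exact: is_linear_scal_l | exact H]). Qed.

Lemma Cderive_eq f z d d' : is_Cderive f z d -> d = d' -> is_Cderive f z d'.
Proof. by move=> H <-. Qed.

Lemma Cderive_ext f g z d : (forall x, f x = g x) -> is_Cderive f z d -> is_Cderive g z d.
Proof. by move=> E; apply: is_derive_ext. Qed.

Lemma Cderive_ext_loc f g z d r : 0 < r -> (forall h, Cmod h < r -> f (z + h)%C = g (z + h)%C) ->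
  is_Cderive f z d -> is_Cderive g z d.
Proof.
move=> r0 E /is_CderiveE H; apply/is_CderiveE => eps /H [del [d0 Hd]].
exists (Rmin r del); split; first exact: Rmin_pos.
move=> h Hh; have h1 := Rlt_le_trans _ _ _ Hh (Rmin_l _ _).
have h2 := Rlt_le_trans _ _ _ Hh (Rmin_r _ _).
have := Hd h h2; rewrite E //.
by have := E 0; rewrite Cmod_0 Cplus_0_r => -> //.
Qed.

Lemma Cderive_const (c z : C) : is_Cderive (fun _ => c) z 0.
Proof. exact: is_derive_const. Qed.

Lemma Cderive_id z : is_Cderive (fun x => x) z 1.
Proof. by apply/is_Cderive_AbsRing; exact (@is_derive_id C_AbsRing z). Qed.

Lemma Cderive_plus f g z df dg : is_Cderive f z df -> is_Cderive g z dg ->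
  is_Cderive (fun x => f x + g x)%C z (df + dg)%C.
Proof. exact: is_derive_plus. Qed.

Lemma Cderive_mult f g z df dg : is_Cderive f z df -> is_Cderive g z dg ->
  is_Cderive (fun x => f x * g x)%C z (df * g z + f z * dg)%C.
Proof.
move=> /is_Cderive_AbsRing Hf /is_Cderive_AbsRing Hg; apply/is_Cderive_AbsRing.
exact (@is_derive_mult C_AbsRing f g z df dg Hf Hg Cmult_comm).
Qed.

Lemma Cderive_scal (c : C) f z df : is_Cderive f z df ->
  is_Cderive (fun x => c * f x)%C z (c * df)%C.
Proof.
by move=> H; apply: (Cderive_eq (Cderive_mult (Cderive_const c z) H)); ring.
Qed.

Lemma Cderive_opp f z df : is_Cderive f z df -> is_Cderive (fun x => - f x)%C z (- df)%C.
Proof. exact: is_derive_opp. Qed.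

Lemma Cderive_comp f g z df dg : is_Cderive f (g z) df -> is_Cderive g z dg ->
  is_Cderive (fun x => f (g x)) z (dg * df)%C.
Proof.
move=> Hf /is_Cderive_AbsRing Hg.
exact (@is_derive_comp C_AbsRing C_NormedModule f g z df dg Hf Hg).
Qed.

Lemma Cderive_shift f (c z : C) d : is_Cderive f (z + c)%C d -> is_Cderive (fun x => f (x + c)%C) z d.
Proof.
move=> H; apply: (Cderive_eq (Cderive_comp (g := fun x => (x + c)%C) H (Cderive_plus (Cderive_id z) (Cderive_const c z)))).
by ring.
Qed.

Definition Ccont (f : C -> C) (z : C) : Prop :=
  forall eps, 0 < eps -> exists delta, 0 < delta /\
    forall h, Cmod h < delta -> Cmod (f (z + h) - f z)%C <= eps.

Lemma Cderive_cont f z d : is_Cderive f z d -> Ccont f z.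
Proof.
move=> /is_CderiveE /(_ 1 Rlt_0_1) [del [d0 Hd]] eps e0.
have m0 := Cmod_ge_0 d.
have p0 : 0 < eps / (1 + Cmod d) by apply: Rdiv_lt_0_compat; lra.
exists (Rmin del (eps / (1 + Cmod d))); split; first exact: Rmin_pos.
move=> h Hh; have h1 := Rlt_le_trans _ _ _ Hh (Rmin_l _ _).
have h2 := Rlt_le_trans _ _ _ Hh (Rmin_r _ _).
have -> : (f (z + h) - f z = (f (z + h) - f z - h * d) + h * d)%C by ring.
apply: (Rle_trans _ _ _ (Cmod_triangle _ _)); rewrite Cmod_mult.
have H1 := Hd h h1.
have H2 : Cmod h * (1 + Cmod d) <= eps.
  have -> : eps = eps / (1 + Cmod d) * (1 + Cmod d) by field; lra.
  by apply: Rmult_le_compat_r; lra.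
by lra.
Qed.

Lemma Ccont_ext_loc f g z r : 0 < r -> (forall h, Cmod h < r -> f (z + h)%C = g (z + h)%C) ->
  Ccont f z -> Ccont g z.
Proof.
move=> r0 E H eps /H [del [d0 Hd]].
exists (Rmin r del); split; first exact: Rmin_pos.
move=> h Hh; have h1 := Rlt_le_trans _ _ _ Hh (Rmin_l _ _).
have h2 := Rlt_le_trans _ _ _ Hh (Rmin_r _ _).
have := Hd h h2; rewrite E //.
by have := E 0; rewrite Cmod_0 Cplus_0_r => -> //.
Qed.

Lemma Ccont_const (c z : C) : Ccont (fun _ => c) z.
Proof. exact: Cderive_cont (Cderive_const c z). Qed.

Lemma Ccont_plus f g z : Ccont f z -> Ccont g z -> Ccont (fun x => f x + g x)%C z.
Proof.
move=> Hf Hg eps e0.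
have [|d1 [p1 H1]] := Hf (eps / 2); first lra.
have [|d2 [p2 H2]] := Hg (eps / 2); first lra.
exists (Rmin d1 d2); split; first exact: Rmin_pos.
move=> h Hh; have {}H1 := H1 h (Rlt_le_trans _ _ _ Hh (Rmin_l _ _)).
have {}H2 := H2 h (Rlt_le_trans _ _ _ Hh (Rmin_r _ _)).
have -> : (f (z + h) + g (z + h) - (f z + g z) = (f (z + h) - f z) + (g (z + h) - g z))%C by ring.
by apply: (Rle_trans _ _ _ (Cmod_triangle _ _)); lra.
Qed.

Lemma Ccont_mult f g z : Ccont f z -> Ccont g z -> Ccont (fun x => f x * g x)%C z.
Proof.
move=> Hf Hg eps e0.
have F0 := Cmod_ge_0 (f z); have G0 := Cmod_ge_0 (g z).
set e := Rmin 1 (eps / (Cmod (f z) + Cmod (g z) + 1)).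
have ep : 0 < e by apply: Rmin_pos; [lra | apply: Rdiv_lt_0_compat; lra].
have e1 : e <= 1 by exact: Rmin_l.
have e2 : e * (Cmod (f z) + Cmod (g z) + 1) <= eps.
  have -> : eps = eps / (Cmod (f z) + Cmod (g z) + 1) * (Cmod (f z) + Cmod (g z) + 1).
    by field; lra.
  by apply: Rmult_le_compat_r; [lra | exact: Rmin_r].
have [d1 [p1 H1]] := Hf e ep.
have [d2 [p2 H2]] := Hg e ep.
exists (Rmin d1 d2); split; first exact: Rmin_pos.
move=> h Hh; have {}H1 := H1 h (Rlt_le_trans _ _ _ Hh (Rmin_l _ _)).
have {}H2 := H2 h (Rlt_le_trans _ _ _ Hh (Rmin_r _ _)).
have -> : (f (z + h) * g (z + h) - f z * g z =
  (f (z + h) - f z) * (g (z + h) - g z) + ((f (z + h) - f z) * g z + f z * (g (z + h) - g z)))%C by ring.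
apply: (Rle_trans _ _ _ (Cmod_triangle _ _)).
have := Cmod_triangle ((f (z + h) - f z) * g z)%C (f z * (g (z + h) - g z))%C.
rewrite !Cmod_mult.
have := Cmod_ge_0 (f (z + h) - f z)%C; have := Cmod_ge_0 (g (z + h) - g z)%C.
move: (Cmod (f (z + h) - f z)%C) (Cmod (g (z + h) - g z)%C) H1 H2 => x y; nra.
Qed.

Lemma Rder_line (f : C -> C) (z h : C) (t : R) d : is_Cderive f (z + t * h)%C d ->
  Rder (fun t : R => f (z + t * h)%C) t (h * d)%C.
Proof.
move=> /is_CderiveE H.
(* [L] stands for [Re] or [Im]: being real linear and 1-Lipschitz is all that the difference
   quotient asks of it. *)
have D (L : C -> R) : (forall u, Rabs (L u) <= Cmod u) -> (forall u v, L (u - v)%C = L u - L v) ->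
    (forall (r : R) u, L (r * u)%C = r * L u) ->
    is_derive (fun t : R => L (f (z + t * h)%C)) t (L (h * d)%C).
  move=> L1 L2 L3; apply/is_derive_Reals => eps e0.
  have m0 := Cmod_ge_0 h.
  (* The summand 1 covers the case h = 0, and the factor 2 makes the final inequality strict. *)
  have [|del [d0 Hd]] := H (eps / (2 * (1 + Cmod h))); first by apply: Rdiv_lt_0_compat; lra.
  have p0 : 0 < del / (1 + Cmod h) by apply: Rdiv_lt_0_compat; lra.
  exists (mkposreal _ p0) => k k0 Hk /=.
  have K0 : 0 < Rabs k by apply: Rabs_pos_lt.
  have -> : (L (f (z + RtoC (t + k) * h)%C) - L (f (z + t * h)%C)) / k - L (h * d)%C =
      L (f (z + t * h + k * h) - f (z + t * h) - (k * h) * d)%C / k.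
    rewrite !L2 -Cmult_assoc L3 RtoC_plus.
    have -> : (z + (t + k) * h = z + t * h + k * h)%C by ring.
    by field.
  rewrite Rabs_div //; apply: (Rmult_lt_reg_r (Rabs k)) => //.
  rewrite /Rdiv Rmult_assoc Rinv_l ?Rmult_1_r; last lra.
  apply: (Rle_lt_trans _ _ _ (L1 _)).
  have B : Cmod (k * h)%C = Rabs k * Cmod h by rewrite Cmod_mult Cmod_R.
  have B1 : Rabs k * (1 + Cmod h) < del.
    have -> : del = del / (1 + Cmod h) * (1 + Cmod h) by field; lra.
    by apply: Rmult_lt_compat_r; [lra | exact: Hk].
  apply: (Rle_lt_trans _ (eps / (2 * (1 + Cmod h)) * Cmod (k * h)%C)).
    by apply: Hd; rewrite B; nra.
  rewrite B.
  have -> : eps / (2 * (1 + Cmod h)) * (Rabs k * Cmod h) = (eps * Rabs k) * (Cmod h / (2 * (1 + Cmod h))).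
    by field; lra.
  have Q : Cmod h / (2 * (1 + Cmod h)) < 1.
    by apply: (Rmult_lt_reg_r (2 * (1 + Cmod h))); [lra | rewrite /Rdiv Rmult_assoc Rinv_l; lra].
  have : 0 < eps * Rabs k by apply: Rmult_lt_0_compat.
  by nra.
split; apply: D.
- exact: re_le_Cmod.
- by move=> u v; rewrite re_plus re_opp.
- exact: re_scal_l.
- exact: Im_le_Cmod.
- by move=> u v; rewrite im_plus im_opp.
- exact: im_scal_l.
Qed.

Lemma Cderive0_segment (f : C -> C) (z w : C) :
  (forall t : R, 0 <= t <= 1 -> is_Cderive f (z + t * (w - z))%C 0) -> f w = f z.
Proof.
move=> H.
have := @Rder_MVT (fun t : R => f (z + t * (w - z))%C) (fun _ => ((w - z) * 0)%C) 0 1 0.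
have -> : (z + 1 * (w - z) = w)%C by ring.
have -> : (z + 0 * (w - z) = z)%C by ring.
move=> E; have {}E : Cmod (f w - f z)%C <= 0 * (1 - 0).
  apply: E; first lra.
  - by move=> t Ht; apply: Rder_line; exact: H.
  - by move=> t _; rewrite Cmult_0_r Cmod_0; lra.
have E0 : Cmod (f w - f z)%C = 0 by have := Cmod_ge_0 (f w - f z)%C; lra.
have := Cmod_eq_0 _ E0 => E1.
have -> : f w = ((f w - f z) + f z)%C by ring.
by rewrite E1; ring.
Qed.

End ComplexDerivative.

(** * The complex exponential *)

Section ComplexExp.
Local Open Scope R_scope.

Lemma Cexp_add z w : Cexp (z + w)%C = (Cexp z * Cexp w)%C.
Proof.
by rewrite /Cexp re_plus im_plus exp_plus cos_plus sin_plus; apply: C_ext;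
  rewrite /Re /Im /=; ring.
Qed.

Lemma Cexp_0 : Cexp 0 = 1.
Proof. by rewrite /Cexp /= exp_0 cos_0 sin_0; congr pair; ring. Qed.

Lemma Cexp_real (x : R) : Cexp x = RtoC (exp x).
Proof. by rewrite /Cexp /= cos_0 sin_0; congr pair; ring. Qed.

Lemma Cmod_Cexp z : Cmod (Cexp z) = exp (Re z).
Proof.
rewrite /Cmod /Cexp /=.
set e := exp _; set c := cos _; set s := sin _.
have -> : e * c * (e * c * 1) + e * s * (e * s * 1) = e * e * (c * c + s * s) by ring.
have -> : c * c + s * s = 1 by have := sin2_cos2 (Im z); rewrite /Rsqr -/c -/s; lra.
by rewrite Rmult_1_r sqrt_square //; apply: Rlt_le; exact: exp_pos.
Qed.

Lemma Cexp_neq0 z : Cexp z <> 0.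
Proof. by apply/Cmod_gt_0; rewrite Cmod_Cexp; exact: exp_pos. Qed.

Lemma Cexp_opp z : Cexp (- z)%C = (/ Cexp z)%C.
Proof.
have H : (Cexp (- z) * Cexp z = 1)%C by rewrite -Cexp_add Cplus_comm Cplus_opp_r Cexp_0.
have N := @Cexp_neq0 z.
have -> : Cexp (- z)%C = (Cexp (- z) * Cexp z * / Cexp z)%C by field.
by rewrite H Cmult_1_l.
Qed.

Lemma Rder_Cexp (g : R -> C) t d : Rder g t d -> Rder (fun t => Cexp (g t)) t (d * Cexp (g t))%C.
Proof.
move=> [H1 H2].
have E : is_derive (fun t => exp (Re (g t))) t (Re d * exp (Re (g t))).
  by apply: (is_derive_comp (V := R_NormedModule) exp _ _ _ _ _ H1); exact: is_derive_exp.
have Cc : is_derive (fun t => cos (Im (g t))) t (Im d * - sin (Im (g t))).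
  by apply: (is_derive_comp (V := R_NormedModule) cos _ _ _ _ _ H2); exact: is_derive_cos.
have S : is_derive (fun t => sin (Im (g t))) t (Im d * cos (Im (g t))).
  by apply: (is_derive_comp (V := R_NormedModule) sin _ _ _ _ _ H2); exact: is_derive_sin.
split.
- have -> : Re (d * Cexp (g t))%C = Re d * exp (Re (g t)) * cos (Im (g t)) +
      exp (Re (g t)) * (Im d * - sin (Im (g t))).
    by rewrite re_mult /Cexp /=; ring.
  exact: (is_deriveR_mult E Cc).
- have -> : Im (d * Cexp (g t))%C = Re d * exp (Re (g t)) * sin (Im (g t)) +
      exp (Re (g t)) * (Im d * cos (Im (g t))).
    by rewrite im_mult /Cexp /=; ring.
  exact: (is_deriveR_mult E S).
Qed.

Lemma Rder_Cexp_scal (z : C) t : Rder (fun t : R => Cexp (t * z)%C) t (z * Cexp (t * z)%C)%C.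
Proof.
apply: Rder_Cexp; apply: (Rder_eq (Rder_mult (Rder_real (is_derive_id t)) (Rder_const z t))).
by rewrite /one /=; ring.
Qed.

Lemma Cmod_Cexp_scal_le (z : C) (t : R) : 0 <= t <= 1 -> Cmod (Cexp (t * z)%C) <= exp (Cmod z).
Proof.
move=> Ht; rewrite Cmod_Cexp re_scal_l.
have : t * Re z <= Cmod z by have := Re_le_Cmod z; have := Cmod_ge_0 z; nra.
by case=> [/exp_increasing|->]; lra.
Qed.

Lemma Cexp_bound1 z : Cmod (Cexp z - 1)%C <= Cmod z * exp (Cmod z).
Proof.
have := @Rder_MVT (fun t : R => Cexp (t * z)%C) (fun t => z * Cexp (t * z)%C)%C 0 1 (Cmod z * exp (Cmod z)).
rewrite Cmult_0_l Cmult_1_l Cexp_0 Rminus_0_r Rmult_1_r; apply; first lra.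
- by move=> t _; exact: Rder_Cexp_scal.
- move=> t Ht; rewrite Cmod_mult; apply: Rmult_le_compat_l; first exact: Cmod_ge_0.
  exact: Cmod_Cexp_scal_le.
Qed.

(** The mean value inequality for exp (t z) - t z on [0, 1]: its derivative z (exp (t z) - 1) is
    controlled by [Cexp_bound1]. *)
Lemma Cexp_bound2 z : Cmod (Cexp z - 1 - z)%C <= Cmod z * Cmod z * exp (Cmod z).
Proof.
have := @Rder_MVT (fun t : R => Cexp (t * z) - t * z)%C (fun t => z * Cexp (t * z) - z)%C
  0 1 (Cmod z * Cmod z * exp (Cmod z)).
rewrite !Cmult_0_l !Cmult_1_l Cexp_0 Rminus_0_r Rmult_1_r.
have -> : (Cexp z - z - (1 - 0) = Cexp z - 1 - z)%C by ring.
apply; first lra.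
- move=> t _; apply: Rder_plus; first exact: Rder_Cexp_scal.
  apply: (Rder_eq (Rder_ext (f := fun t : R => (t * - z)%C) _
    (Rder_mult (Rder_real (is_derive_id t)) (Rder_const (- z)%C t)))).
    by move=> x; ring.
  by rewrite /one /=; ring.
- move=> t Ht.
  have -> : (z * Cexp (t * z) - z = z * (Cexp (t * z) - 1))%C by ring.
  rewrite Cmod_mult Rmult_assoc; apply: Rmult_le_compat_l; first exact: Cmod_ge_0.
  apply: (Rle_trans _ _ _ (Cexp_bound1 _)).
  have M : Cmod (t * z)%C <= Cmod z.
    by rewrite Cmod_mult Cmod_R Rabs_pos_eq; [have := Cmod_ge_0 z; nra | lra].
  apply: Rmult_le_compat => //; [exact: Cmod_ge_0 | exact: Rlt_le (exp_pos _) |].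
  by case: M => [/exp_increasing|->]; lra.
Qed.

Lemma Cderive_Cexp z : is_Cderive Cexp z (Cexp z).
Proof.
apply/is_CderiveE => eps e0.
have N : 0 < Cmod (Cexp z) by rewrite Cmod_Cexp; exact: exp_pos.
set q := eps / (Cmod (Cexp z) * exp 1).
have q0 : 0 < q by apply: Rdiv_lt_0_compat => //; apply: Rmult_lt_0_compat => //; exact: exp_pos.
exists (Rmin 1 q); split; first by apply: Rmin_pos => //; lra.
move=> h Hh; have h1 := Rlt_le_trans _ _ _ Hh (Rmin_l _ _).
have h2 := Rlt_le_trans _ _ _ Hh (Rmin_r _ _).
have -> : (Cexp (z + h) - Cexp z - h * Cexp z = Cexp z * (Cexp h - 1 - h))%C by rewrite Cexp_add; ring.
rewrite Cmod_mult.
have E1 : exp (Cmod h) <= exp 1 by apply: Rlt_le; exact: exp_increasing.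
have H0 := Cmod_ge_0 h; have p1 := exp_pos 1; have ph := exp_pos (Cmod h).
have := Cexp_bound2 h => B.
have -> : eps = q * (Cmod (Cexp z) * exp 1) by rewrite /q; field; split; lra.
apply: (Rle_trans _ (Cmod (Cexp z) * (Cmod h * Cmod h * exp (Cmod h)))).
  by apply: Rmult_le_compat_l; lra.
have -> : q * (Cmod (Cexp z) * exp 1) * Cmod h = Cmod (Cexp z) * ((Cmod h * q) * exp 1) by ring.
apply: Rmult_le_compat_l; first lra.
by apply: Rmult_le_compat; [nra | lra | apply: Rmult_le_compat_l; lra | lra].
Qed.

End ComplexExp.

(** * Primitives of entire functions *)

Section Primitive.
Local Open Scope R_scope.

(** The derivative [f'] may depend on z and is required to be continuous only at z; this local form
    survives changes of formula from one region to another, as happens for the continuation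
    [chain]. *)
Definition C1at (f : C -> C) (z : C) : Prop :=
  exists (f' : C -> C) (r : R), [/\ 0 < r,
    forall h, Cmod h < r -> is_Cderive f (z + h)%C (f' (z + h)%C) & Ccont f' z].

Lemma C1at_plus f g z : C1at f z -> C1at g z -> C1at (fun x => f x + g x)%C z.
Proof.
move=> [f' [r [r0 Df Cf]]] [g' [r' [r'0 Dg Cg]]].
exists (fun x => f' x + g' x)%C, (Rmin r r'); split; first exact: Rmin_pos.
- move=> h Hh; apply: Cderive_plus.
  + by apply: Df; exact: (Rlt_le_trans _ _ _ Hh (Rmin_l _ _)).
  + by apply: Dg; exact: (Rlt_le_trans _ _ _ Hh (Rmin_r _ _)).
- exact: Ccont_plus.
Qed.

Lemma C1at_mult f g z : C1at f z -> C1at g z -> C1at (fun x => f x * g x)%C z.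
Proof.
move=> [f' [r [r0 Df Cf]]] [g' [r' [r'0 Dg Cg]]].
have Df0 := Df 0; have Dg0 := Dg 0; rewrite Cplus_0_r Cmod_0 in Df0 Dg0.
exists (fun x => f' x * g x + f x * g' x)%C, (Rmin r r'); split; first exact: Rmin_pos.
- move=> h Hh; apply: Cderive_mult.
  + by apply: Df; exact: (Rlt_le_trans _ _ _ Hh (Rmin_l _ _)).
  + by apply: Dg; exact: (Rlt_le_trans _ _ _ Hh (Rmin_r _ _)).
- by apply: Ccont_plus; apply: Ccont_mult => //;
    [exact: Cderive_cont (Dg0 r'0) | exact: Cderive_cont (Df0 r0)].
Qed.

Lemma C1at_const (c z : C) : C1at (fun _ => c) z.
Proof.
by exists (fun _ => 0), 1; split; [lra | move=> h _; exact: Cderive_const | exact: Ccont_const].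
Qed.

Lemma C1at_id z : C1at (fun x => x) z.
Proof.
by exists (fun _ => 1), 1; split; [lra | move=> h _; exact: Cderive_id | exact: Ccont_const].
Qed.

Lemma C1at_shift f (c z : C) : C1at f (z + c)%C -> C1at (fun x => f (x + c)%C) z.
Proof.
have E h : (z + h + c = z + c + h)%C by ring.
move=> [f' [r [r0 Df Cf]]]; exists (fun x => f' (x + c)%C), r; split => //.
- by move=> h Hh; apply: Cderive_shift; rewrite E; exact: Df.
- by move=> eps /Cf [del [d0 Hd]]; exists del; split => // h Hh; rewrite E; exact: Hd.
Qed.

Lemma C1at_ext_loc f g z r : 0 < r -> (forall h, Cmod h < r -> f (z + h)%C = g (z + h)%C) ->
  C1at f z -> C1at g z.
Proof.
move=> r0 E [f' [r' [r'0 Df Cf]]].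
(* A ball of radius r / 2 around a point at distance less than r / 2 from z stays where f and g
   agree, so derivatives transfer at every such point. *)
exists f', (Rmin (r / 2) r'); split => //; first by apply: Rmin_pos; lra.
move=> h Hh; apply: (Cderive_ext_loc (r := r / 2) (f := f)) => [|k Hk|].
- by lra.
- rewrite -Cplus_assoc; apply: E; apply: (Rle_lt_trans _ _ _ (Cmod_triangle _ _)).
  by have := Rlt_le_trans _ _ _ Hh (Rmin_l _ _); lra.
- by apply: Df; exact: (Rlt_le_trans _ _ _ Hh (Rmin_r _ _)).
Qed.

Lemma C1at_ext f g z : (forall x, f x = g x) -> C1at f z -> C1at g z.
Proof. by move=> E; apply: (C1at_ext_loc Rlt_0_1). Qed.

Lemma C1at_sum (I : Type) (r : seq I) (P : pred I) (f : I -> C -> C) z :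
  (forall i, P i -> C1at (f i) z) -> C1at (fun x => \big[Cplus/RtoC 0]_(i <- r | P i) f i x) z.
Proof.
move=> H; elim: r => [|i r IH].
  by apply: (C1at_ext _ (C1at_const 0 z)) => x; rewrite big_nil.
case: (boolP (P i)) => Pi.
- by apply: (C1at_ext _ (C1at_plus (H i Pi) IH)) => x; rewrite big_cons Pi.
- by apply: (C1at_ext _ IH) => x; rewrite big_cons (negbTE Pi).
Qed.

(** By uniqueness of derivatives the local choices of [f'] are all germs of the one global function
    [C_derive f]. *)
Lemma C1at_derive f z : C1at f z ->
  is_Cderive f z (C_derive f z) /\ Ccont (C_derive f) z.
Proof.
move=> [f' [r [r0 Df Cf]]].
have E h : Cmod h < r -> f' (z + h)%C = C_derive f (z + h)%C.
  by move=> /Df /is_C_derive_unique.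
split; last exact: (Ccont_ext_loc r0 E).
by have := Df 0; rewrite Cplus_0_r Cmod_0 => /(_ r0) D; rewrite (is_C_derive_unique _ _ _ D).
Qed.

Lemma Rcont_line (f : C -> C) (z h : C) (t : R) : Ccont f (z + t * h)%C ->
  Rcont (fun t : R => f (z + t * h)%C) t.
Proof.
move=> H.
have D (L : C -> R) : (forall u, Rabs (L u) <= Cmod u) -> (forall u v, L (u - v)%C = L u - L v) ->
    continuous (fun t : R => L (f (z + t * h)%C)) t.
  move=> L1 L2; apply/filterlim_locally => eps.
  have e0 := cond_pos eps; have m0 := Cmod_ge_0 h.
  have [|del [d0 Hd]] := H (eps / 2); first lra.
  have p0 : 0 < del / (1 + Cmod h) by apply: Rdiv_lt_0_compat; lra.
  exists (mkposreal _ p0) => x Hx; change (Rabs (x - t) < del / (1 + Cmod h)) in Hx.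
  change (Rabs (L (f (z + x * h)%C) - L (f (z + t * h)%C)) < eps).
  have -> : (z + x * h = z + t * h + RtoC (x - t) * h)%C by rewrite RtoC_minus; ring.
  rewrite -L2; apply: (Rle_lt_trans _ _ _ (L1 _)); apply: (Rle_lt_trans _ (eps / 2)); last lra.
  apply: Hd; rewrite Cmod_mult Cmod_R.
  have B1 : Rabs (x - t) * (1 + Cmod h) < del.
    have -> : del = del / (1 + Cmod h) * (1 + Cmod h) by field; lra.
    by apply: Rmult_lt_compat_r; [lra | exact: Hx].
  by have := Rabs_pos (x - t); nra.
split; apply: D.
- exact: re_le_Cmod.
- by move=> u v; rewrite re_plus re_opp.
- exact: Im_le_Cmod.
- by move=> u v; rewrite im_plus im_opp.
Qed.

Lemma Rcont_bounded (f : R -> C) (a b : R) : (forall t, a <= t <= b -> Rcont f t) ->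
  exists M, 0 < M /\ forall t, a <= t <= b -> Cmod (f t) <= M.
Proof.
move=> H.
have [M1 H1] := @bounded_continuity R_AbsRing R_NormedModule (fun t => Re (f t)) a b (fun t Ht => (H t Ht).1).
have [M2 H2] := @bounded_continuity R_AbsRing R_NormedModule (fun t => Im (f t)) a b (fun t Ht => (H t Ht).2).
exists (Rmax (M1 + M2) 1); split; first by apply: (Rlt_le_trans _ 1); [lra | exact: Rmax_r].
move=> t Ht; apply: (Rle_trans _ _ _ (Cmod_le_Re_Im _)).
have /= h1 : Rabs (Re (f t)) < M1 := H1 t Ht.
have /= h2 : Rabs (Im (f t)) < M2 := H2 t Ht.
by apply: (Rle_trans _ (M1 + M2)); [lra | exact: Rmax_l].
Qed.

(** Heine's argument on the segment from 0 to z, with a perturbation h that may leave the segment in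
    any direction. *)
Lemma Ccont_uniform_segment (f : C -> C) (z : C) : (forall t : R, Ccont f (t * z)%C) ->
  forall eps, 0 < eps -> exists delta, 0 < delta /\ forall (t : R) h, 0 <= t <= 1 ->
    Cmod h < delta -> Cmod (f (t * z + h) - f (t * z))%C <= eps.
Proof.
move=> H eps e0.
have /choice [g Hg] : forall t : R, exists d : posreal, forall h, Cmod h < d ->
    Cmod (f (t * z + h) - f (t * z))%C <= eps / 2.
  by move=> t; have [|d [d0 Hd]] := H t (eps / 2); [lra | exists (mkposreal d d0)].
have m0 := Cmod_ge_0 z.
(* With this gauge, x close to t puts x z within g t / 2 of t z, and a perturbation h below the
   gauge keeps x z + h within g t. *)
have p0 t : 0 < g t / (2 * (1 + Cmod z)) by apply: Rdiv_lt_0_compat; [exact: cond_pos | lra].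
have [d Hd] := compactness_value_1d 0 1 (fun t => mkposreal _ (p0 t)).
exists d; split; first exact: cond_pos.
(* The gauge point t comes from [compactness_value_1d] under a double negation, hence a proof by
   contradiction. *)
move=> x h Hx Hh; apply: Rnot_lt_le => Hlt.
apply: (Hd x Hx) => -[t [Ht [/= Hxt Hdt]]].
have q0 := cond_pos (g t).
have A : Rabs (x - t) * (2 * (1 + Cmod z)) < g t.
  have -> : pos (g t) = g t / (2 * (1 + Cmod z)) * (2 * (1 + Cmod z)) by field; lra.
  by apply: Rmult_lt_compat_r; [lra | exact: Hxt].
have B : g t / (2 * (1 + Cmod z)) <= g t / 2.
  apply: (Rmult_le_reg_r (2 * (1 + Cmod z))); first lra.
  by rewrite /Rdiv Rmult_assoc Rinv_l; nra.
have R0 := Rabs_pos (x - t).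
have E1 : (x * z = t * z + RtoC (x - t) * z)%C by rewrite RtoC_minus; ring.
have M1 : Cmod (RtoC (x - t) * z)%C < g t / 2 by rewrite Cmod_mult Cmod_R; nra.
have H1 : Cmod (f (x * z) - f (t * z))%C <= eps / 2 by rewrite E1; apply: Hg; lra.
have H2 : Cmod (f (x * z + h) - f (t * z))%C <= eps / 2.
  rewrite E1 -Cplus_assoc; apply: Hg.
  by apply: (Rle_lt_trans _ _ _ (Cmod_triangle _ _)); lra.
have E : (f (x * z + h) - f (x * z) = (f (x * z + h) - f (t * z)) + - (f (x * z) - f (t * z)))%C by ring.
have := Cmod_triangle (f (x * z + h) - f (t * z))%C (- (f (x * z) - f (t * z)))%C.
by rewrite -E Cmod_opp; lra.
Qed.

(** The mean value inequality for f (z + t h) - t h f' z on [0, 1]. *)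
Lemma Cderive_remainder (f f' : C -> C) (z h : C) eps :
  (forall t : R, 0 <= t <= 1 -> is_Cderive f (z + t * h)%C (f' (z + t * h)%C)) ->
  (forall t : R, 0 <= t <= 1 -> Cmod (f' (z + t * h) - f' z)%C <= eps) ->
  Cmod (f (z + h) - f z - h * f' z)%C <= eps * Cmod h.
Proof.
move=> D B.
have := @Rder_MVT (fun t : R => f (z + t * h) + t * - (h * f' z))%C
  (fun t : R => h * (f' (z + t * h) - f' z))%C 0 1 (eps * Cmod h).
rewrite !Cmult_0_l !Cmult_1_l !Cplus_0_r Rminus_0_r Rmult_1_r.
have -> : (f (z + h) + - (h * f' z) - f z = f (z + h) - f z - h * f' z)%C by ring.
apply; first lra.
- move=> t Ht; apply: (Rder_eq (Rder_plus (Rder_line (D t Ht))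
    (Rder_mult (Rder_real (is_derive_id t)) (Rder_const (- (h * f' z))%C t)))).
  by rewrite /one /=; ring.
- move=> t Ht; rewrite Cmod_mult Rmult_comm.
  by apply: Rmult_le_compat_r; [exact: Cmod_ge_0 | exact: B].
Qed.

(* The primitive [F z = z * \int_0^1 f (t * z) dt].  Since [f z] is the integral
   of the derivative of [t * f (t * z)], the difference [F (z + h) - F z - h f z]
   is the integral of
   [(z + h) (f (t z + t h) - f (t z) - t h f' (t z)) + t h^2 f' (t z)]. *)
Theorem C1_primitive (f : C -> C) : (forall z, C1at f z) ->
  exists F, forall z, is_Cderive F z (f z).
Proof.
move=> HC; set f' := C_derive f.
have D z : is_Cderive f z (f' z) by case: (C1at_derive (HC z)).
have Cf' z : Ccont f' z by case: (C1at_derive (HC z)).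
have Cf z : Ccont f z by exact: Cderive_cont (D z).
have S0 (g : C -> C) (z : C) (t : R) : Ccont g (t * z)%C -> Rcont (fun t : R => g (t * z)%C) t.
  move=> Hg; apply: (Rcont_ext (f := fun t : R => g (0 + t * z)%C)) => [x|].
    by rewrite Cplus_0_l.
  by apply: Rcont_line; rewrite Cplus_0_l.
have Rid t : Rcont (fun t : R => RtoC t) t by apply: Rcont_real; exact: continuous_id.
exists (fun z => z * Cint (fun t : R => f (t * z)%C) 0 1)%C => z.
apply/is_CderiveE => eps e0.
have [M [M0 HM]] := @Rcont_bounded (fun t : R => f' (t * z)%C) 0 1 (fun t _ => S0 _ _ _ (Cf' _)).
have m0 := Cmod_ge_0 z.
(* Each of the two terms of the integrand may cost eps / 2 * |h|. The first carries the factor |z +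
   h| <= 1 + |z|, the second the factor |h| M, which explains this constant and the bound eps / (2
   M) on |h|. *)
have [|d [d0 Hd]] := @Ccont_uniform_segment f' z (fun t => Cf' _) (eps / (2 * (1 + Cmod z))).
  by apply: Rdiv_lt_0_compat; lra.
have q0 : 0 < eps / (2 * M) by apply: Rdiv_lt_0_compat; lra.
exists (Rmin (Rmin 1 d) (eps / (2 * M))); split.
  by apply: Rmin_pos => //; apply: Rmin_pos => //; lra.
move=> h Hh; have h0 := Cmod_ge_0 h.
have h3 := Rlt_le_trans _ _ _ Hh (Rmin_r _ _).
have h12 := Rlt_le_trans _ _ _ Hh (Rmin_l _ _).
have h1 := Rlt_le_trans _ _ _ h12 (Rmin_l _ _).
have h2 := Rlt_le_trans _ _ _ h12 (Rmin_r _ _).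
have fz : f z = Cint (fun t : R => f (t * z) + t * z * f' (t * z))%C 0 1.
  have -> : f z = (1 * f (1 * z) - 0 * f (0 * z))%C.
    by rewrite !Cmult_1_l; ring.
  apply: esym; apply: (@Cint_derive (fun t : R => t * f (t * z))%C).
  - by lra.
  - move=> t _; apply: (Rder_eq (Rder_mult (Rder_real (is_derive_id t))
      (Rder_ext (f := fun t : R => f (0 + t * z)%C) _ (Rder_line (d := f' (t * z)%C) _)))).
    + by move=> x; rewrite Cplus_0_l.
    + by rewrite Cplus_0_l.
    + by rewrite /one /=; ring.
  - move=> t _; apply: Rcont_plus; first exact: S0.
    apply: Rcont_mult; last exact: S0.
    by apply: Rcont_mult => //; exact: Rcont_const.
have I01 : 0 <= 1 by lra.
have c1 t : Rcont (fun t : R => f (t * (z + h))%C) t by exact: S0.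
have c2 t : Rcont (fun t : R => f (t * z)%C) t by exact: S0.
have c3 t : Rcont (fun t : R => f (t * z) + t * z * f' (t * z))%C t.
  apply: Rcont_plus => //; apply: Rcont_mult; last exact: S0.
  by apply: Rcont_mult => //; exact: Rcont_const.
have E : ((z + h) * Cint (fun t : R => f (t * (z + h))) 0 1 - z * Cint (fun t : R => f (t * z)) 0 1 - h * f z)%C
   = Cint (fun t : R => (z + h) * f (t * (z + h)) + (- z * f (t * z) +
        - h * (f (t * z) + t * z * f' (t * z))))%C 0 1.
  rewrite Cint_plus // ?Cint_plus // ?Cint_scal //.
  - by rewrite -fz; ring.
  - by move=> t _; apply: Rcont_mult => //; exact: Rcont_const.
  - by move=> t _; apply: Rcont_mult => //; exact: Rcont_const.
  - by move=> t _; apply: Rcont_mult => //; exact: Rcont_const.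
  - by move=> t _; apply: Rcont_plus; apply: Rcont_mult => //; exact: Rcont_const.
rewrite E.
have B : Cmod (Cint (fun t : R => (z + h) * f (t * (z + h)) + (- z * f (t * z) +
        - h * (f (t * z) + t * z * f' (t * z))))%C 0 1) <= (eps * Cmod h) * (1 - 0).
  apply: Cint_bound => //.
    move=> t _; apply: Rcont_plus; first by apply: Rcont_mult => //; exact: Rcont_const.
    by apply: Rcont_plus; apply: Rcont_mult => //; exact: Rcont_const.
  move=> t Ht.
  have -> : ((z + h) * f (t * (z + h)) + (- z * f (t * z) + - h * (f (t * z) + t * z * f' (t * z)))
    = (z + h) * (f (t * z + t * h) - f (t * z) - t * h * f' (t * z)) + t * h * h * f' (t * z))%C.
    have -> : (t * (z + h) = t * z + t * h)%C by ring.
    by ring.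
  have T1 : Cmod (f (t * z + t * h) - f (t * z) - t * h * f' (t * z))%C <=
      eps / (2 * (1 + Cmod z)) * Cmod (t * h)%C.
    apply: Cderive_remainder => [r _|r Hr]; first exact: D.
    apply: Hd => //; rewrite !Cmod_mult !Cmod_R !Rabs_pos_eq; try lra.
    have t1 : 0 <= t * Cmod h <= Cmod h by split; nra.
    by nra.
  have th : Cmod (t * h)%C = t * Cmod h by rewrite Cmod_mult Cmod_R Rabs_pos_eq; lra.
  apply: (Rle_trans _ _ _ (Cmod_triangle _ _)); rewrite (Cmod_mult (z + h)%C) !(Cmod_mult _ (f' _)).
  rewrite (Cmod_mult (t * h)%C h) th.
  rewrite th in T1.
  have T2 := HM t Ht.
  have T3 := Cmod_triangle z h.
  have K1 : eps / (2 * (1 + Cmod z)) * (1 + Cmod z) = eps / 2 by field; lra.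
  have K2 : eps / (2 * M) * M = eps / 2 by field; lra.
  have k0 : 0 < eps / (2 * (1 + Cmod z)) by apply: Rdiv_lt_0_compat; lra.
  have P1 : Cmod (z + h)%C * Cmod (f (t * z + t * h) - f (t * z) - t * h * f' (t * z))%C <=
    (1 + Cmod z) * (eps / (2 * (1 + Cmod z)) * Cmod h).
    apply: Rmult_le_compat; [exact: Cmod_ge_0 | exact: Cmod_ge_0 | lra |].
    apply: (Rle_trans _ _ _ T1); apply: Rmult_le_compat_l; first lra.
    by nra.
  have P2 : t * Cmod h * Cmod h * Cmod (f' (t * z)%C) <= Cmod h * (eps / (2 * M)) * M.
    apply: Rmult_le_compat => //; last by apply: Rmult_le_compat; nra.
    - by apply: Rmult_le_pos => //; apply: Rmult_le_pos; lra.
    - exact: Cmod_ge_0.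
  have Q1 : (1 + Cmod z) * (eps / (2 * (1 + Cmod z)) * Cmod h) = eps / 2 * Cmod h by rewrite -K1; ring.
  have Q2 : Cmod h * (eps / (2 * M)) * M = eps / 2 * Cmod h by rewrite -K2; ring.
  by lra.
by lra.
Qed.

End Primitive.

(** * Logarithm and powers *)

Section Logarithm.
Local Open Scope R_scope.

Lemma Cmod_pos (z : C) : z <> 0 -> 0 < Cmod z.
Proof. exact: (proj1 (Cmod_gt_0 z)). Qed.

Lemma Re_div_Cmod_bound (z : C) : z <> 0 -> -1 <= Re z / Cmod z <= 1.
Proof.
move=> z0; have H := Cmod_pos z0; have := re_le_Cmod z => /Rabs_le_between B.
by split; apply: (Rmult_le_reg_r (Cmod z)) => //; rewrite /Rdiv Rmult_assoc Rinv_l; lra.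
Qed.

Lemma cos_Carg (z : C) : z <> 0 -> cos (Carg z) = Re z / Cmod z.
Proof.
move=> z0; have B := Re_div_Cmod_bound z0; rewrite /Carg; cbv zeta.
by case: (Rle_dec 0 (Im z)) => ?; rewrite ?cos_neg cos_acos.
Qed.

Lemma sin_Carg (z : C) : z <> 0 -> sin (Carg z) = Im z / Cmod z.
Proof.
move=> z0; have B := Re_div_Cmod_bound z0; rewrite /Carg; cbv zeta.
have M0 : 0 < Cmod z by exact: Cmod_pos.
have S : sin (acos (Re z / Cmod z)) = Rabs (Im z) / Cmod z.
  rewrite sin_acos //.
  have -> : 1 - (Re z / Cmod z)² = (Rabs (Im z) / Cmod z)².
    have := Cmod2_alt z; have := Rsqr_abs (Im z); rewrite /Rsqr => A E.
    have -> : Rabs (Im z) / Cmod z * (Rabs (Im z) / Cmod z) =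
      (Rabs (Im z) * Rabs (Im z)) / Cmod z ^ 2 by field; lra.
    rewrite -A.
    have -> : Im z * Im z = Cmod z ^ 2 - Re z ^ 2 by rewrite E; ring.
    by field; lra.
  apply: sqrt_Rsqr; apply: Rmult_le_pos; first exact: Rabs_pos.
  by apply: Rlt_le; exact: Rinv_0_lt_compat.
case: (Rle_dec 0 (Im z)) => H; rewrite ?sin_neg S.
- by rewrite Rabs_pos_eq.
- by rewrite Rabs_left; [field; lra | lra].
Qed.

Lemma Cexp_Clog (z : C) : z <> 0 -> Cexp (Clog z) = z.
Proof.
move=> z0; have M0 : 0 < Cmod z by exact: Cmod_pos.
rewrite /Cexp /Clog /= exp_ln // cos_Carg // sin_Carg //.
by apply: C_ext; rewrite /=; field; lra.
Qed.

(** The formula with [acos] degenerates on the positive real axis, where [acos] is taken at 1; the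
    one with [atan] is visibly continuous on the right half-plane. *)
Lemma Carg_atan (z : C) : 0 < Re z -> Carg z = atan (Im z / Re z).
Proof.
move=> x0; have z0 : z <> 0 by move=> E; rewrite E /= in x0; lra.
have M0 : 0 < Cmod z by exact: Cmod_pos.
have P := PI_RGT_0.
have q0 : 0 < Re z / Cmod z by apply: Rdiv_lt_0_compat.
have C0 := cos_acos _ (Re_div_Cmod_bound z0).
have A : 0 <= acos (Re z / Cmod z) < PI / 2.
  have [a0 a1] := acos_bound (Re z / Cmod z).
  split => //; apply: Rnot_le_lt => H.
  have := cos_le_0 _ H; rewrite C0 => Hc; have := Hc ltac:(lra); lra.
have B : - (PI / 2) < Carg z < PI / 2 by rewrite /Carg; cbv zeta; case: (Rle_dec 0 (Im z)) => ? /=; lra.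
rewrite -(atan_tan _ B) /tan cos_Carg // sin_Carg //; congr atan.
by field; lra.
Qed.

Lemma Ccont_real (g : R -> R) (u : C -> R) (z : C) :
  continuous g (u z) -> Ccont (fun x => RtoC (u x)) z -> Ccont (fun x => RtoC (g (u x))) z.
Proof.
move=> /filterlim_locally Hg Hu eps e0.
have [d Hd] := Hg (mkposreal eps e0).
have [|del [d0 H]] := Hu (d / 2); first by have := cond_pos d; lra.
exists del; split => // h Hh; rewrite -RtoC_minus Cmod_R; apply: Rlt_le.
apply: Hd; change (Rabs (u (z + h)%C - u z) < d).
by have := H h Hh; rewrite -RtoC_minus Cmod_R; have := cond_pos d; lra.
Qed.

Lemma Ccont_lip (u : C -> R) (z : C) : (forall x y, Rabs (u x - u y) <= Cmod (x - y)%C) ->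
  Ccont (fun x => RtoC (u x)) z.
Proof.
move=> H eps e0; exists eps; split => // h Hh; rewrite -RtoC_minus Cmod_R.
apply: (Rle_trans _ _ _ (H _ _)).
have -> : (z + h - z = h)%C by ring.
by lra.
Qed.

Lemma Ccont_Re z : Ccont (fun x => RtoC (Re x)) z.
Proof.
apply: Ccont_lip => x y.
have -> : Re x - Re y = Re (x - y)%C by rewrite re_plus re_opp.
exact: re_le_Cmod.
Qed.

Lemma Ccont_Im z : Ccont (fun x => RtoC (Im x)) z.
Proof.
apply: Ccont_lip => x y.
have -> : Im x - Im y = Im (x - y)%C by rewrite im_plus im_opp.
exact: Im_le_Cmod.
Qed.

Lemma Ccont_Cmod z : Ccont (fun x => RtoC (Cmod x)) z.
Proof.
apply: Ccont_lip => x y.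
have := Cmod_triangle (x - y)%C y; have := Cmod_triangle (y - x)%C x.
have -> : (x - y + y = x)%C by ring.
have -> : (y - x + x = y)%C by ring.
have -> : (y - x = - (x - y))%C by ring.
by rewrite Cmod_opp => H1 H2; apply: Rabs_le; lra.
Qed.

Lemma Ccont_Clog z : 0 < Re z -> Ccont Clog z.
Proof.
move=> x0; have M0 : 0 < Cmod z.
  by apply: Cmod_pos => E; rewrite E /= in x0; lra.
apply: (Ccont_ext_loc (r := Re z) (f := fun x => RtoC (ln (Cmod x)) + Ci * RtoC (atan (Im x * / Re x)))%C) => //.
  move=> h Hh; rewrite /Clog Carg_atan.
    have E (a b : R) : (RtoC a + Ci * RtoC b)%C = (a, b) by apply: C_ext; rewrite /Re /Im /=; ring.
    exact: E.
  by rewrite re_plus; have /Rabs_le_between := re_le_Cmod h; lra.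
apply: Ccont_plus.
  apply: (@Ccont_real ln Cmod); last exact: Ccont_Cmod.
  by apply: (ex_derive_continuous (V := R_NormedModule)); exists (/ Cmod z); exact: is_derive_ln.
apply: Ccont_mult; first exact: Ccont_const.
apply: (@Ccont_real atan (fun x => Im x * / Re x)).
  apply: (ex_derive_continuous (V := R_NormedModule)).
  by eexists; exact: is_derive_atan.
apply: (Ccont_ext_loc (r := 1) (f := fun x => RtoC (Im x) * RtoC (/ Re x))%C); first lra.
  by move=> h _; rewrite RtoC_mult.
apply: Ccont_mult; first exact: Ccont_Im.
apply: (@Ccont_real Rinv Re); last exact: Ccont_Re.
by apply: continuous_Rinv; lra.
Qed.

(* Inverse function rule for [Cexp], given the continuity of [Clog]. *)
Lemma Cderive_Clog z : 0 < Re z -> is_Cderive Clog z (/ z)%C.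
Proof.
move=> x0; have z0 : z <> 0 by move=> E; rewrite E /= in x0; lra.
have M0 : 0 < Cmod z by exact: Cmod_pos.
apply/is_CderiveE => eps e0.
(* Put k = Clog (z + h) - Clog z, so that |h - k z| <= e |k|. The bound e <= |z| / 2 yields |k| |z|
   <= 2 |h|, and then the second bound makes |k - h / z| at most eps |h|. *)
set e := Rmin (Cmod z / 2) (eps * Cmod z * Cmod z / 2).
have ep : 0 < e.
  apply: Rmin_pos; first lra.
  by apply: Rdiv_lt_0_compat; [do 2 apply: Rmult_lt_0_compat => // | lra].
have /is_CderiveE /(_ e ep) [d [d0 Hd]] := Cderive_Cexp (Clog z).
have [|d' [d'0 Hd']] := Ccont_Clog x0 (eps := d / 2); first lra.
exists (Rmin d' (Cmod z)); split; first exact: Rmin_pos.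
move=> h Hh.
have h1 := Rlt_le_trans _ _ _ Hh (Rmin_l _ _).
have h2 := Rlt_le_trans _ _ _ Hh (Rmin_r _ _).
have zh : (z + h)%C <> 0.
  move=> E; have E2 : (h = - z)%C by have -> : h = (z + h - z)%C; [ring | rewrite E; ring].
  by rewrite E2 Cmod_opp in h2; lra.
set k := (Clog (z + h) - Clog z)%C.
have Hk : Cmod k < d by have := Hd' h h1; rewrite -/k; lra.
have := Hd k Hk.
have -> : (Clog z + k)%C = Clog (z + h) by rewrite /k; ring.
rewrite !Cexp_Clog //.
have -> : (z + h - z - k * z = h - k * z)%C by ring.
move=> H.
have k0 := Cmod_ge_0 k; have h0 := Cmod_ge_0 h.
have e1 : e <= Cmod z / 2 by exact: Rmin_l.
have e2 : e <= eps * Cmod z * Cmod z / 2 by exact: Rmin_r.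
have K : Cmod k * Cmod z <= 2 * Cmod h.
  have := Cmod_triangle (- (h - k * z))%C h.
  have -> : (- (h - k * z) + h = k * z)%C by ring.
  by rewrite Cmod_opp Cmod_mult; nra.
have -> : (k - h * / z = - (h - k * z) * / z)%C by field.
rewrite Cmod_mult Cmod_opp Cmod_inv //.
apply: (Rmult_le_reg_r (Cmod z)) => //; rewrite Rmult_assoc Rinv_l; last lra.
rewrite Rmult_1_r; apply: (Rle_trans _ _ _ H).
apply: (Rle_trans _ (eps * Cmod z * Cmod z / 2 * Cmod k)); first exact: Rmult_le_compat_r.
by nra.
Qed.

Lemma Cderive_Cpower_shift (a c s : C) : 0 < Re (s - a)%C ->
  is_Cderive (fun s => Cpower (s - a) c) s (c / (s - a) * Cpower (s - a) c)%C.
Proof.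
move=> H; rewrite /Cpower.
have D := Cderive_comp (f := Cexp) (Cderive_Cexp _)
  (Cderive_scal c (Cderive_shift (f := Clog) (c := (- a)%C) (Cderive_Clog H))).
by apply: (Cderive_eq D); rewrite /Cdiv.
Qed.

(* [npow u w = u ^ (- w)] for [u > 0]. *)
Definition npow (u : R) (w : C) : C := Cexp (- (w * RtoC (ln u)))%C.

Lemma Cpower_npow (u : R) (s : C) : 0 < u -> Cpower u (- s - 1)%C = npow u (s + 1)%C.
Proof.
move=> u0; rewrite /Cpower /npow; congr Cexp.
have -> : Clog u = RtoC (ln u).
  rewrite /Clog Cmod_R Rabs_pos_eq; last lra.
  rewrite Carg_atan /=; last by [].
  by rewrite /Rdiv Rmult_0_l atan_0.
by ring.
Qed.

Lemma npow_add u w v : npow u (w + v)%C = (npow u w * npow u v)%C.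
Proof. by rewrite /npow -Cexp_add; congr Cexp; ring. Qed.

Lemma npow_INR (u : R) (k : nat) : 0 < u -> npow u (INR k) = RtoC (/ u ^ k).
Proof.
move=> u0; rewrite /npow -RtoC_mult -RtoC_opp Cexp_real exp_Ropp; congr (RtoC (/ _)).
by rewrite -ln_pow // exp_ln //; exact: pow_lt.
Qed.

Lemma npow_succ (u : R) w : 0 < u -> npow u w = (u * npow u (w + 1))%C.
Proof.
move=> u0; rewrite npow_add (_ : RtoC 1 = RtoC (INR 1)) // npow_INR // pow_1 RtoC_inv; last lra.
by field => E; have := RtoC_inj _ _ E; lra.
Qed.

Lemma Cmod_npow (u : R) w : 0 < u -> Cmod (npow u w) = exp (- (Re w * ln u)).
Proof. by move=> u0; rewrite /npow Cmod_Cexp re_opp re_scal_r. Qed.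

Lemma Cmod_npow_le (u : R) w (k : nat) : 1 <= u -> INR k <= Re w -> Cmod (npow u w) <= / u ^ k.
Proof.
move=> u1 Hk; rewrite Cmod_npow; last lra.
rewrite exp_Ropp; apply: Rinv_le_contravar; first by apply: pow_lt; lra.
have l0 : 0 <= ln u by rewrite -ln_1; apply: ln_le; lra.
rewrite -[u ^ k]exp_ln; last by apply: pow_lt; lra.
rewrite ln_pow; last lra.
have : INR k * ln u <= Re w * ln u by exact: Rmult_le_compat_r.
by case=> [/exp_increasing|->]; lra.
Qed.

Lemma Rder_npow (k t : R) w : 0 < t + k ->
  Rder (fun t => npow (t + k) w) t (- w * npow (t + k) (w + 1))%C.
Proof.
move=> p0.
have L : is_derive (fun t => ln (t + k)) t (/ (t + k)).
  have := @is_derive_comp R_AbsRing R_NormedModule ln (fun t => t + k) t (/ (t + k)) 1 (is_derive_ln _ p0).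
  rewrite /scal /= /mult /= Rmult_1_l; apply.
  have := @is_derive_plus R_AbsRing R_NormedModule (fun t => t) (fun _ => k) t 1 0 (is_derive_id t) (is_derive_const k t).
  by rewrite /plus /= Rplus_0_r.
apply: (Rder_eq (Rder_ext (f := fun t => Cexp (- w * RtoC (ln (t + k)))%C) _
  (Rder_Cexp (Rder_mult (Rder_const (- w)%C t) (Rder_real L))))).
  by move=> x; rewrite /npow; congr Cexp; ring.
have -> : Cexp (- w * RtoC (ln (t + k)))%C = npow (t + k) w by rewrite /npow; congr Cexp; ring.
rewrite (npow_succ w p0) RtoC_inv; last lra.
field => E; have := RtoC_inj _ _ E; lra.
Qed.

Lemma Rcont_npow (k t : R) w : 0 < t + k -> Rcont (fun t => npow (t + k) w) t.
Proof. by move=> p0; exact: Rder_cont (Rder_npow w p0). Qed.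

End Logarithm.

(** * Continuation of Dirichlet series and Mellin transforms of periodic functions *)

HB.instance Definition _ := Monoid.isComLaw.Build C (RtoC 0) Cplus
  Cplus_assoc Cplus_comm Cplus_0_l.

(** * Limits and sums of complex sequences *)

Section ComplexSeries.
Local Open Scope R_scope.

Definition Clim (u : nat -> C) (l : C) : Prop :=
  forall eps, 0 < eps -> exists N : nat, forall n, (N <= n)%nat -> Cmod (u n - l)%C <= eps.

Definition Csum (a : nat -> C) (l : C) : Prop :=
  Clim (fun N => \big[Cplus/RtoC 0]_(0 <= n < N) a n) l.

Lemma Clim_unique u l l' : Clim u l -> Clim u l' -> l = l'.
Proof.
move=> H H'; have Z : Cmod (l - l')%C = 0.
  apply: Rle_antisym; last exact: Cmod_ge_0.
  apply: Rnot_lt_le => P.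
  have [|N HN] := H (Cmod (l - l')%C / 3); first lra.
  have [|N' HN'] := H' (Cmod (l - l')%C / 3); first lra.
  have h := HN _ (leq_maxl N N'); have h' := HN' _ (leq_maxr N N').
  set x := u _ in h h'.
  have := Cmod_triangle (- (x - l))%C (x - l')%C.
  have -> : (- (x - l) + (x - l') = l - l')%C by ring.
  by rewrite Cmod_opp; lra.
have := Cmod_eq_0 _ Z => E.
have -> : l = (l - l' + l')%C by ring.
by rewrite E; ring.
Qed.

Lemma Clim_ext u v l : (forall n, u n = v n) -> Clim u l -> Clim v l.
Proof. by move=> E H eps /H [N HN]; exists N => n /HN; rewrite E. Qed.

Lemma Clim_const l : Clim (fun _ => l) l.
Proof.
move=> eps e0; exists 0%nat => n _; have -> : (l - l = 0)%C by ring.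
by rewrite Cmod_0; lra.
Qed.

Lemma Clim_plus u v l m : Clim u l -> Clim v m -> Clim (fun n => u n + v n)%C (l + m)%C.
Proof.
move=> Hu Hv eps e0.
have [|N HN] := Hu (eps / 2); first lra.
have [|N' HN'] := Hv (eps / 2); first lra.
exists (maxn N N') => n; rewrite geq_max => /andP [/HN h /HN' h'].
have -> : (u n + v n - (l + m) = (u n - l) + (v n - m))%C by ring.
by have := Cmod_triangle (u n - l)%C (v n - m)%C; lra.
Qed.

Lemma Clim_scal (c : C) u l : Clim u l -> Clim (fun n => c * u n)%C (c * l)%C.
Proof.
move=> Hu eps e0; have c0 := Cmod_ge_0 c.
have [|N HN] := Hu (eps / (1 + Cmod c)); first by apply: Rdiv_lt_0_compat; lra.
exists N => n /HN h; have -> : (c * u n - c * l = c * (u n - l))%C by ring.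
rewrite Cmod_mult; have E : (1 + Cmod c) * (eps / (1 + Cmod c)) = eps by field; lra.
have : Cmod c * Cmod (u n - l)%C <= (1 + Cmod c) * (eps / (1 + Cmod c)).
  by apply: Rmult_le_compat => //; [exact: Cmod_ge_0 | lra].
by lra.
Qed.

Lemma Clim_le u l M : (forall n, Cmod (u n) <= M) -> Clim u l -> Cmod l <= M.
Proof.
move=> H Hu; apply: Rnot_lt_le => P.
have [|N HN] := Hu ((Cmod l - M) / 2); first lra.
have := HN N (leqnn N); have := H N.
have := Cmod_triangle (- (u N - l))%C (u N).
have -> : (- (u N - l) + u N = l)%C by ring.
by rewrite Cmod_opp; lra.
Qed.

Lemma Csum_ext a b l : (forall n, a n = b n) -> Csum a l -> Csum b l.
Proof. by move=> E; apply: Clim_ext => n; apply: eq_bigr. Qed.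

Lemma Csum_plus a b l m : Csum a l -> Csum b m -> Csum (fun n => a n + b n)%C (l + m)%C.
Proof.
move=> Ha Hb; apply: (Clim_ext _ (Clim_plus Ha Hb)) => n.
by rewrite big_split.
Qed.

Lemma big_Cmult_r (I : Type) (r : seq I) (P : pred I) (c : C) (f : I -> C) :
  (c * \big[Cplus/RtoC 0]_(i <- r | P i) f i)%C = \big[Cplus/RtoC 0]_(i <- r | P i) (c * f i)%C.
Proof.
elim: r => [|i r IH]; first by rewrite !big_nil Cmult_0_r.
by rewrite !big_cons; case: (P i) => //; rewrite Cmult_plus_distr_l IH.
Qed.

Lemma Csum_scal (c : C) a l : Csum a l -> Csum (fun n => c * a n)%C (c * l)%C.
Proof.
move=> Ha; apply: (Clim_ext _ (Clim_scal c Ha)) => n.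
by rewrite big_Cmult_r.
Qed.

Lemma Csum_sum (I : Type) (r : seq I) (a : I -> nat -> C) (l : I -> C) :
  (forall i, Csum (a i) (l i)) ->
  Csum (fun n => \big[Cplus/RtoC 0]_(i <- r) a i n) (\big[Cplus/RtoC 0]_(i <- r) l i).
Proof.
move=> H; elim: r => [|i r IH].
  rewrite big_nil; apply: (Clim_ext (u := fun _ => RtoC 0)); last exact: Clim_const.
  by move=> n; rewrite big1 // => i _; rewrite big_nil.
rewrite big_cons; apply: (Csum_ext _ (Csum_plus (H i) IH)) => n.
by rewrite big_cons.
Qed.

Lemma Csum_recr (a : nat -> C) N :
  \big[Cplus/RtoC 0]_(0 <= n < N.+1) a n = (\big[Cplus/RtoC 0]_(0 <= n < N) a n + a N)%C.
Proof. by rewrite big_nat_recr. Qed.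

Lemma Csum_is_series (a : nat -> C) (l : C) : @is_series C_AbsRing C_NormedModule a l -> Csum a l.
Proof.
move=> H eps e0.
have E N : sum_n (G := C_NormedModule) a N = \big[Cplus/RtoC 0]_(0 <= n < N.+1) a n.
  elim: N => [|N IH]; first by rewrite sum_O big_nat1.
  by rewrite sum_Sn IH [RHS]Csum_recr.
have /filterlim_locally_ball_norm /(_ (mkposreal eps e0)) [N HN] := H.
exists N.+1 => -[|n] // /leP Hn; apply: Rlt_le.
have := HN n; rewrite E; apply; lia.
Qed.

(** Since n + 2 <= 2 (n + 1), the terms are dominated by the telescoping 2 M (1 / (n + 1) - 1 / (n +
    2)). The explicit bound 2 M on the sum matters: [mellin_derive] applies it to remainders. *)
Lemma Csum_dominated (a : nat -> C) M : 0 <= M ->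
  (forall n, Cmod (a n) <= M * / INR n.+1 ^ 2) ->
  exists l, Csum a l /\ Cmod l <= 2 * M.
Proof.
move=> M0 Ha.
pose b n := 2 * M * (/ INR n.+1 - / INR n.+2).
have P n : 0 < INR n.+1 by apply: lt_0_INR; lia.
have Pi n : 0 < / INR n.+1 by apply: Rinv_0_lt_compat.
have Hb n : Cmod (a n) <= b n.
  apply: (Rle_trans _ _ _ (Ha n)); rewrite /b [2 * M]Rmult_comm Rmult_assoc.
  apply: Rmult_le_compat_l => //.
  have -> : 2 * (/ INR n.+1 - / INR n.+2) = 2 / (INR n.+1 * INR n.+2).
    by rewrite (S_INR n.+1); have := P n => p; field; lra.
  have -> : / INR n.+1 ^ 2 = 2 / (2 * INR n.+1 * INR n.+1) by have := P n => p; field; lra.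
  apply: Rmult_le_compat_l; first lra.
  apply: Rinv_le_contravar; first by apply: Rmult_lt_0_compat.
  have : 1 <= INR n.+1 by apply: (le_INR 1); lia.
  by rewrite (S_INR n.+1) => q; nra.
have Sb N : sum_n b N = 2 * M * (1 - / INR N.+2).
  elim: N => [|N IH]; first by rewrite sum_O /b /= Rinv_1.
  by rewrite sum_Sn IH /plus /b /=; ring.
have exb : ex_series b.
  exists (2 * M); change (is_lim_seq (sum_n b) (2 * M)); apply: (is_lim_seq_ext (fun N => 2 * M * (1 - / INR N.+2))).
    by move=> N; rewrite Sb.
  have L : is_lim_seq (fun N => / INR N.+2) 0.
    apply: (is_lim_seq_inv _ p_infty) => //.
    apply: (proj1 (is_lim_seq_incr_1 (fun n => INR n.+1) p_infty)).
    exact: (proj1 (is_lim_seq_incr_1 INR p_infty) is_lim_seq_INR).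
  have := is_lim_seq_scal_l _ (2 * M) _ (is_lim_seq_minus' _ _ _ _ (is_lim_seq_const 1) L).
  by rewrite /= Rminus_0_r Rmult_1_r.
have [x Hx] : ex_series (fun n => Re (a n)).
  apply: (@ex_series_le R_AbsRing R_CompleteNormedModule _ b) => // n.
  by apply: Rle_trans (Hb n); exact: re_le_Cmod.
have [y Hy] : ex_series (fun n => Im (a n)).
  apply: (@ex_series_le R_AbsRing R_CompleteNormedModule _ b) => // n.
  by apply: Rle_trans (Hb n); exact: Im_le_Cmod.
have E (L : C -> R) N : (forall u v, L (u + v)%C = L u + L v) -> L 0 = 0 ->
    L (\big[Cplus/RtoC 0]_(0 <= n < N.+1) a n) = sum_n (fun n => L (a n)) N.
  move=> LD L0; elim: N => [|N IH]; first by rewrite sum_O big_nat1.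
  by rewrite sum_Sn Csum_recr LD IH.
have Cs : Csum a (x, y).
  move=> eps e0.
  have /is_lim_seq_spec /(_ (mkposreal (eps / 2) ltac:(lra))) [N1 H1] : is_lim_seq (sum_n (fun n => Re (a n))) x by [].
  have /is_lim_seq_spec /(_ (mkposreal (eps / 2) ltac:(lra))) [N2 H2] : is_lim_seq (sum_n (fun n => Im (a n))) y by [].
  exists (maxn N1 N2).+1 => -[|n] //; rewrite ltnS geq_max => /andP [/leP /H1 /= h1 /leP /H2 /= h2].
  apply: (Rle_trans _ _ _ (Cmod_le_Re_Im _)).
  rewrite re_plus re_opp im_plus im_opp (E Re) // ?(E Im) //; try exact: re_plus; try exact: im_plus.
  by rewrite /Rminus in h1 h2; change (Re (x, y)) with x; change (Im (x, y)) with y; lra.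
exists (x, y); split => //.
apply: (Clim_le _ Cs) => -[|N].
  by rewrite big_geq // Cmod_0; lra.
apply: (Rle_trans _ (sum_n b N)).
  elim: N => [|N IH]; first by rewrite sum_O big_nat1.
  rewrite sum_Sn Csum_recr; apply: (Rle_trans _ _ _ (Cmod_triangle _ _)).
  exact: Rplus_le_compat.
by rewrite Sb; have := Pi N.+1; nra.
Qed.

End ComplexSeries.

(** * Holomorphy of Mellin transforms far to the right *)

Section Continuation.
Local Open Scope R_scope.

(* A family [f] describes the function equal to [f n t] at [u = n + 1 + t],
   [0 <= t <= 1], so [piece f w n] is its integral against [u ^ (- w)] over
   [n + 1, n + 2]. *)
Definition piece (f : nat -> R -> C) (w : C) (n : nat) : C :=
  Cint (fun t => f n t * npow (t + INR n.+1) w)%C 0 1.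

(** Made total by the value 0 where the sum diverges, so that it can be differentiated as a function
    on C. *)
Definition mellin (f : nat -> R -> C) (w : C) : C :=
  if pselect (exists l, Csum (piece f w) l) is left H then sval (cid H) else RtoC 0.

Lemma INR_succ_ge1 n : 1 <= INR n.+1.
Proof. by apply: (le_INR 1); lia. Qed.

Lemma arg_pos n t : 0 <= t <= 1 -> 0 < t + INR n.+1.
Proof. by have := INR_succ_ge1 n; lra. Qed.

Lemma arg_ge1 n t : 0 <= t <= 1 -> 1 <= t + INR n.+1.
Proof. by have := INR_succ_ge1 n; lra. Qed.

Lemma Rcont_piece f n t w : 0 <= t <= 1 -> Rcont (f n) t ->
  Rcont (fun t => f n t * npow (t + INR n.+1) w)%C t.
Proof. by move=> Ht Hf; apply: Rcont_mult => //; apply: Rcont_npow; exact: arg_pos. Qed.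

Lemma piece_plus f g w n : (forall t, 0 <= t <= 1 -> Rcont (f n) t) ->
  (forall t, 0 <= t <= 1 -> Rcont (g n) t) ->
  piece (fun n t => f n t + g n t)%C w n = (piece f w n + piece g w n)%C.
Proof.
move=> Hf Hg; rewrite /piece -Cint_plus; last first.
- by move=> t Ht; apply: Rcont_piece => //; exact: Hg.
- by move=> t Ht; apply: Rcont_piece => //; exact: Hf.
- by lra.
by apply: Cint_ext => [|t _]; [lra | ring].
Qed.

Lemma mellin_spec f w : (exists l, Csum (piece f w) l) -> Csum (piece f w) (mellin f w).
Proof. by rewrite /mellin; case: pselect => // H _; exact: (svalP (cid H)). Qed.

Lemma inv_pow_le n t k : 0 <= t <= 1 -> (2 <= k)%nat -> / (t + INR n.+1) ^ k <= / INR n.+1 ^ 2.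
Proof.
move=> Ht /subnK <-; set u := t + _; have u1 : 1 <= u by exact: arg_ge1.
have n1 := INR_succ_ge1 n.
apply: Rinv_le_contravar; first by apply: pow_lt; lra.
rewrite -plusE pow_add; have : 1 <= u ^ (k - 2) by exact: pow_R1_Rle.
have : INR n.+1 ^ 2 <= u ^ 2 by apply: pow_incr; rewrite /u; lra.
by have := pow_lt (INR n.+1) 2; nra.
Qed.

(** The exponent j measures growth: u ^ j * u ^ (- j - 2) <= (n + 1) ^ (- 2) on the piece. Each
    derivative in w costs a factor ln u <= u, that is, one unit of j. *)
Lemma piece_bound f M (j : nat) w n : 0 <= M -> INR j.+2 <= Re w ->
  (forall t, 0 <= t <= 1 -> Rcont (f n) t) ->
  (forall t, 0 <= t <= 1 -> Cmod (f n t) <= M * (t + INR n.+1) ^ j) ->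
  Cmod (piece f w n) <= M * / INR n.+1 ^ 2.
Proof.
move=> M0 Hw Hf HM.
rewrite -[X in _ <= X]Rmult_1_r -[X in _ <= _ * X](Rminus_0_r 1); apply: Cint_bound; first lra.
  by move=> t Ht; apply: Rcont_piece => //; exact: Hf.
move=> t Ht; rewrite Cmod_mult; set u := t + _.
have u1 : 1 <= u by exact: arg_ge1.
have uj : 0 < u ^ j by apply: pow_lt; lra.
apply: (Rle_trans _ (M * u ^ j * / u ^ j.+2)).
  by apply: Rmult_le_compat; [exact: Cmod_ge_0 | exact: Cmod_ge_0 | exact: HM | exact: Cmod_npow_le].
have -> : M * u ^ j * / u ^ j.+2 = M * / u ^ 2 by rewrite /=; field; lra.
by apply: Rmult_le_compat_l => //; exact: inv_pow_le.
Qed.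

Lemma mellin_bound f M j w : 0 <= M -> INR j.+2 <= Re w ->
  (forall n t, 0 <= t <= 1 -> Rcont (f n) t) ->
  (forall n t, 0 <= t <= 1 -> Cmod (f n t) <= M * (t + INR n.+1) ^ j) ->
  Csum (piece f w) (mellin f w).
Proof.
move=> M0 Hw Hf HM; apply: mellin_spec.
have [n|l [H _]] := @Csum_dominated (piece f w) M M0; last by exists l.
by apply: piece_bound M0 Hw _ _ => t; [exact: Hf | exact: HM].
Qed.

(** Differentiating u ^ (- w) in w brings out - ln u, so [mellin (log_family f)] is the expected
    derivative of [mellin f]. *)
Definition log_family (f : nat -> R -> C) (n : nat) (t : R) : C :=
  (- RtoC (ln (t + INR n.+1)) * f n t)%C.

Lemma ln_ge0_le u : 1 <= u -> 0 <= ln u <= u.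
Proof.
move=> u1; split; first by rewrite -ln_1; apply: ln_le; lra.
case: (Rle_lt_or_eq_dec _ _ u1) => [u2|<-]; last by rewrite ln_1; lra.
have := exp_ineq1 (ln u); rewrite exp_ln; last lra.
by move=> H; have : 0 < ln u by [rewrite -ln_1; apply: ln_increasing; lra]; move=> p; have := H ltac:(lra); lra.
Qed.

Lemma Rcont_log_family f n t : 0 <= t <= 1 -> Rcont (f n) t -> Rcont (log_family f n) t.
Proof.
move=> Ht Hf; apply: Rcont_mult => //.
apply: (Rcont_ext (f := fun t => RtoC (- ln (t + INR n.+1)))) => [x|]; first by rewrite RtoC_opp.
apply: Rcont_real; apply: (continuous_opp (V := R_NormedModule)).
apply: continuous_comp.
  by apply: (continuous_plus (V := R_NormedModule)); [exact: continuous_id | exact: continuous_const].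
apply: (ex_derive_continuous (V := R_NormedModule)); eexists; apply: is_derive_ln.
exact: arg_pos.
Qed.

Lemma log_family_bound f M j n t : 0 <= t <= 1 -> Cmod (f n t) <= M * (t + INR n.+1) ^ j ->
  Cmod (log_family f n t) <= M * (t + INR n.+1) ^ j.+1.
Proof.
move=> Ht H; rewrite /log_family Cmod_mult Cmod_opp Cmod_R.
have [l0 l1] := ln_ge0_le (arg_ge1 n Ht); rewrite Rabs_pos_eq //.
rewrite /= -Rmult_assoc [M * _]Rmult_comm Rmult_assoc.
by apply: Rmult_le_compat => //; exact: Cmod_ge_0.
Qed.

(** The factor u ^ (- w) comes out, leaving the remainder of exp at z = - h ln u. Since |z| <= |h|
    u, and exp |z| <= u because |h| <= 1, it is at most |h|^2 u^3; with |u ^ (- w)| <= u ^ (- 7)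
    this gives u ^ (- 4). *)
Lemma npow_remainder (u : R) (w h : C) : 1 <= u -> Cmod h <= 1 -> 7 <= Re w ->
  Cmod (npow u (w + h) - npow u w - h * (- RtoC (ln u) * npow u w))%C <=
    Cmod h * Cmod h * / u ^ 4.
Proof.
move=> u1 h1 Hw; have [l0 l1] := ln_ge0_le u1.
set z := (- (h * RtoC (ln u)))%C.
have -> : (npow u (w + h) - npow u w - h * (- RtoC (ln u) * npow u w) =
    npow u w * (Cexp z - 1 - z))%C by rewrite npow_add {2}/npow -/z /z; ring.
have Mz : Cmod z = Cmod h * ln u by rewrite /z Cmod_opp Cmod_mult Cmod_R Rabs_pos_eq.
have h0 := Cmod_ge_0 h.
have E : exp (Cmod z) <= u.
  rewrite -[u in _ <= u]exp_ln; last lra.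
  have : Cmod z <= ln u by rewrite Mz; nra.
  by case=> [/exp_increasing|->]; lra.
have A : Cmod (npow u w) <= / u ^ 7 by apply: Cmod_npow_le => //=; lra.
have B := Cexp_bound2 z.
have e0 := exp_pos (Cmod z).
have D : Cmod z * Cmod z * exp (Cmod z) <= (Cmod h * u) * (Cmod h * u) * u.
  rewrite Mz in E e0 *.
  have q0 : 0 <= Cmod h * ln u <= Cmod h * u by split; nra.
  apply: Rmult_le_compat; [by nra | lra | | exact: E].
  by apply: Rmult_le_compat; lra.
rewrite Cmod_mult; apply: (Rle_trans _ (/ u ^ 7 * ((Cmod h * u) * (Cmod h * u) * u))).
  by apply: Rmult_le_compat; [exact: Cmod_ge_0 | exact: Cmod_ge_0 | exact: A | lra].
by apply: Req_le; field; lra.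
Qed.

(** With f of linear growth, [npow_remainder] bounds the remainder of each piece by M |h|^2 u ^ (-
    3), hence by M |h|^2 (n + 1) ^ (- 2). The sum is at most 2 M |h|^2, whence the radius eps / (2
    M). *)
Lemma mellin_derive f M w : 0 < M -> 7 <= Re w ->
  (forall n t, 0 <= t <= 1 -> Rcont (f n) t) ->
  (forall n t, 0 <= t <= 1 -> Cmod (f n t) <= M * (t + INR n.+1) ^ 1) ->
  is_Cderive (mellin f) w (mellin (log_family f) w).
Proof.
move=> M0 Hw Hf HM; apply/is_CderiveE => eps e0.
exists (Rmin 1 (eps / (2 * M))); split.
  by apply: Rmin_pos; [lra | apply: Rdiv_lt_0_compat; lra].
move=> h Hh; have h0 := Cmod_ge_0 h.
have h1 := Rlt_le_trans _ _ _ Hh (Rmin_l _ _).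
have h2 := Rlt_le_trans _ _ _ Hh (Rmin_r _ _).
have Hl n t : 0 <= t <= 1 -> Rcont (log_family f n) t by move=> Ht; apply: Rcont_log_family => //; exact: Hf.
have I3 : INR 3 = 3 by rewrite /=; ring.
have I4 : INR 4 = 4 by rewrite /=; ring.
have wh : 6 <= Re (w + h)%C by rewrite re_plus; have /Rabs_le_between := re_le_Cmod h; lra.
have S1 : Csum (piece f (w + h)) (mellin f (w + h)).
  by apply: (mellin_bound (j := 1) (Rlt_le _ _ M0)) => //; rewrite I3; lra.
have S2 : Csum (piece f w) (mellin f w).
  by apply: (mellin_bound (j := 1) (Rlt_le _ _ M0)) => //; rewrite I3; lra.
have S3 : Csum (piece (log_family f) w) (mellin (log_family f) w).
  apply: (mellin_bound (j := 2) (Rlt_le _ _ M0)) => //; first by rewrite I4; lra.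
  by move=> n t Ht; apply: (log_family_bound (j := 1)) => //; exact: HM.
have S := Csum_plus S1 (Csum_plus (Csum_scal (-1) S2) (Csum_scal (- h)%C S3)).
have q0 : 0 <= 1 by lra.
have c1 v n t : 0 <= t <= 1 -> Rcont (fun t => f n t * npow (t + INR n.+1) v)%C t.
  by move=> Ht; apply: Rcont_piece => //; exact: Hf.
have c2 (c : C) n t : 0 <= t <= 1 -> Rcont (fun t => c * (f n t * npow (t + INR n.+1) w))%C t.
  by move=> Ht; apply: (Rcont_mult (Rcont_const _ _)); exact: c1.
have c3 n t : 0 <= t <= 1 -> Rcont (fun t => log_family f n t * npow (t + INR n.+1) w)%C t.
  by move=> Ht; apply: Rcont_piece => //; exact: Hl.
have c4 (c : C) n t : 0 <= t <= 1 -> Rcont (fun t => c * (log_family f n t * npow (t + INR n.+1) w))%C t.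
  by move=> Ht; apply: (Rcont_mult (Rcont_const _ _)); exact: c3.
have Bd n : Cmod (piece f (w + h) n + (-1 * piece f w n + - h * piece (log_family f) w n))%C <=
    M * (Cmod h * Cmod h) * / INR n.+1 ^ 2.
  rewrite /piece -(Cint_scal _ q0 (@c1 w n)) -(Cint_scal _ q0 (@c3 n)).
  rewrite -(Cint_plus q0 (@c2 _ n) (@c4 _ n)).
  have c5 t : 0 <= t <= 1 -> Rcont (fun t => -1 * (f n t * npow (t + INR n.+1) w) +
      - h * (log_family f n t * npow (t + INR n.+1) w))%C t.
    by move=> Ht; apply: Rcont_plus; [exact: c2 | exact: c4].
  rewrite -(Cint_plus q0 (@c1 _ n) c5).
  rewrite -[X in _ <= X]Rmult_1_r -[X in _ <= _ * X](Rminus_0_r 1); apply: Cint_bound => //.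
    by move=> t Ht; apply: Rcont_plus; [exact: c1 | exact: c5].
  move=> t Ht; set u := t + _.
  have u1 : 1 <= u by exact: arg_ge1.
  have -> : (f n t * npow u (w + h) + (-1 * (f n t * npow u w) + - h * (log_family f n t * npow u w)) =
     f n t * (npow u (w + h) - npow u w - h * (- RtoC (ln u) * npow u w)))%C.
    by rewrite /log_family -/u; ring.
  rewrite Cmod_mult; apply: (Rle_trans _ (M * u ^ 1 * (Cmod h * Cmod h * / u ^ 4))).
    apply: Rmult_le_compat; [exact: Cmod_ge_0 | exact: Cmod_ge_0 | exact: HM |].
    by apply: npow_remainder => //; lra.
  have -> : M * u ^ 1 * (Cmod h * Cmod h * / u ^ 4) = M * (Cmod h * Cmod h) * / u ^ 3 by field; lra.
  by apply: Rmult_le_compat_l; [nra | exact: inv_pow_le].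
have [|l [Sl Bl]] := Csum_dominated _ Bd; first by nra.
have E := Clim_unique S Sl.
have -> : (mellin f (w + h) - mellin f w - h * mellin (log_family f) w = l)%C by rewrite -E; ring.
apply: (Rle_trans _ _ _ Bl).
have K : eps = eps / (2 * M) * (2 * M) by field; lra.
set q := eps / (2 * M) in K h2; rewrite K.
have : 0 <= Cmod h * (2 * M) * (q - Cmod h) by apply: Rmult_le_pos; nra.
by lra.
Qed.

(** The derivative is again a Mellin transform, of a family of linear growth, so it is itself
    differentiable and therefore continuous. The bound 8 leaves room for a unit ball inside Re w >=
    7. *)
Lemma mellin_C1at f M w : 0 < M -> 8 <= Re w ->
  (forall n t, 0 <= t <= 1 -> Rcont (f n) t) ->
  (forall n t, 0 <= t <= 1 -> Cmod (f n t) <= M) -> C1at (mellin f) w.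
Proof.
move=> M0 Hw Hf HM.
have HM0 n t : 0 <= t <= 1 -> Cmod (f n t) <= M * (t + INR n.+1) ^ 0.
  by move=> Ht; rewrite /= Rmult_1_r; exact: HM.
exists (mellin (log_family f)), 1; split; first lra.
- move=> h h1; apply: (mellin_derive (M := M)) => //.
    by rewrite re_plus; have /Rabs_le_between := re_le_Cmod h; lra.
  move=> n t Ht; rewrite pow_1; apply: (Rle_trans _ _ _ (HM n t Ht)).
  by have := arg_ge1 n Ht; nra.
- apply: Cderive_cont; apply: (mellin_derive (M := M)) => //; first lra.
  + by move=> n t Ht; apply: Rcont_log_family => //; exact: Hf.
  + by move=> n t Ht; apply: log_family_bound => //; exact: HM0.
Qed.

End Continuation.

(** * Periodic families and their primitives *)

Section PeriodicPrimitive.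
Local Open Scope R_scope.

(** [f n 1] and [f n.+1 0] may differ: step functions and sawtooth functions are instances, as used
    for Dirichlet series. *)
Definition periodic_family (l : nat) (f : nat -> R -> C) : Prop :=
  [/\ (0 < l)%nat, forall n t, Rcont (f n) t & forall n t, f (n + l)%nat t = f n t].

Definition mean_zero (l : nat) (f : nat -> R -> C) : Prop :=
  \big[Cplus/RtoC 0]_(0 <= n < l) Cint (f n) 0 1 = 0.

Definition prim0 (f : nat -> R -> C) (n : nat) (t : R) : C :=
  (\big[Cplus/RtoC 0]_(0 <= k < n) Cint (f k) 0 1 + Cint (f n) 0 t)%C.

Definition prim (l : nat) (f : nat -> R -> C) (n : nat) (t : R) : C :=
  (prim0 f n t + - (/ INR l * \big[Cplus/RtoC 0]_(0 <= m < l) Cint (prim0 f m) 0 1))%C.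

Lemma big_Cconst (l : nat) (c : C) : \big[Cplus/RtoC 0]_(0 <= n < l) c = (INR l * c)%C.
Proof.
elim: l => [|l IH]; first by rewrite big_geq //= Cmult_0_l.
by rewrite Csum_recr IH S_INR RtoC_plus; ring.
Qed.

Lemma INR_neq0 (l : nat) : (0 < l)%nat -> RtoC (INR l) <> 0.
Proof. by move=> l0 H; have := RtoC_inj _ _ H; apply: not_0_INR => E; rewrite E in l0. Qed.

Lemma Rder_prim0 f n t : (forall n t, Rcont (f n) t) -> Rder (prim0 f n) t (f n t).
Proof.
move=> Hf; apply: (Rder_eq (Rder_plus (Rder_const _ t) (Rder_Cint 0 t (Hf n)))).
by ring.
Qed.

Lemma Rder_prim l f n t : (forall n t, Rcont (f n) t) -> Rder (prim l f n) t (f n t).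
Proof.
move=> Hf; apply: (Rder_eq (Rder_plus (Rder_prim0 n t Hf) (Rder_const _ t))).
by ring.
Qed.

(** The primitive is continuous across the integers even where f jumps, so boundary terms of
    neighbouring pieces cancel. *)
Lemma prim_glue l f n : prim l f n.+1 0 = prim l f n 1.
Proof. by rewrite /prim /prim0 big_nat_recr //= Cint_point Cplus_0_r. Qed.

(** The integral of f accumulated over one full period vanishes: this is where mean zero enters. *)
Lemma prim_periodic l f : periodic_family l f -> mean_zero l f -> periodic_family l (prim l f).
Proof.
move=> [l0 Hf Pf] Mf; split => //.
  by move=> n t; exact: Rder_cont (Rder_prim l n t Hf).
move=> n t; rewrite /prim; congr Cplus; rewrite /prim0; congr Cplus; last first.
  by congr pair; apply: RInt_ext => x _; rewrite Pf.
rewrite (big_cat_nat (n := l)) ?leq_addl //= Mf Cplus_0_l.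
rewrite -{1}[l]add0n big_addn addnK; apply: eq_bigr => i _.
by congr pair; apply: RInt_ext => x _; rewrite Pf.
Qed.

Lemma prim_mean_zero l f : periodic_family l f -> mean_zero l (prim l f).
Proof.
move=> [l0 Hf Pf]; rewrite /mean_zero /prim.
set m := (\big[Cplus/RtoC 0]_(0 <= m < l) Cint (prim0 f m) 0 1)%C.
have E n : Cint (fun t => prim0 f n t + - (/ INR l * m))%C 0 1 = (Cint (prim0 f n) 0 1 + - (/ INR l * m))%C.
  rewrite Cint_plus; last first.
  - by move=> t _; exact: Rcont_const.
  - by move=> t _; exact: Rder_cont (Rder_prim0 n t Hf).
  - by lra.
  congr Cplus; rewrite (@Cint_derive (fun t : R => t * - (/ INR l * m))%C) ?Cmult_1_l.
  - by ring.
  - by lra.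
  - move=> t _; apply: (Rder_eq (Rder_mult (Rder_real (is_derive_id t)) (Rder_const _ t))).
    by rewrite /one /=; ring.
  - by move=> t _; exact: Rcont_const.
rewrite (eq_bigr _ (fun n _ => E n)) big_split /= -/m big_Cconst.
by field; exact: INR_neq0.
Qed.

Lemma periodic_family_mod l f n t : periodic_family l f -> f n t = f (n %% l)%nat t.
Proof.
move=> [_ _ P]; rewrite {1}(divn_eq n l) addnC.
by elim: (n %/ l)%nat => [|k IH]; rewrite ?mul0n ?addn0 // mulSn [(l + _)%nat]addnC addnA P.
Qed.

Lemma periodic_family_bounded l f : periodic_family l f ->
  exists M, 0 < M /\ forall n t, 0 <= t <= 1 -> Cmod (f n t) <= M.
Proof.
move=> Pf; have [l0 Hf _] := Pf.
suff [M [M0 HM]] : exists M, 0 < M /\ forall n t, (n < l)%nat -> 0 <= t <= 1 -> Cmod (f n t) <= M.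
  exists M; split => // n t Ht; rewrite (periodic_family_mod _ _ Pf).
  by apply: HM => //; rewrite ltn_mod.
elim: l {l0 Pf} => [|l [M [M0 HM]]]; first by exists 1; split => //; lra.
have [M' [M'0 HM']] := @Rcont_bounded (f l) 0 1 (fun t _ => Hf l t).
exists (Rmax M M'); split; first exact: (Rlt_le_trans _ _ _ M0 (Rmax_l _ _)).
move=> n t; rewrite ltnS leq_eqVlt => /orP [/eqP -> /HM' h|/HM h /h {}h].
- exact: (Rle_trans _ _ _ h (Rmax_r _ _)).
- exact: (Rle_trans _ _ _ h (Rmax_l _ _)).
Qed.

End PeriodicPrimitive.

(** * Integration by parts over the pieces *)

Section EntireContinuation.
Local Open Scope R_scope.

Lemma npow_1 w : npow 1 w = 1.
Proof. by rewrite /npow ln_1 Cmult_0_r Copp_0 Cexp_0. Qed.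

Lemma piece_by_parts l f w n : (forall n t, Rcont (f n) t) ->
  piece f w n = ((prim l f n.+1 0 * npow (INR n.+2) w - prim l f n 0 * npow (INR n.+1) w)
    + w * piece (prim l f) (w + 1) n)%C.
Proof.
move=> Hf; have q0 : 0 <= 1 by lra.
have Hp n' t : Rcont (prim l f n') t by exact: Rder_cont (Rder_prim l n' t Hf).
have c1 t : 0 <= t <= 1 -> Rcont (fun t => f n t * npow (t + INR n.+1) w)%C t.
  by move=> Ht; exact: Rcont_piece.
have c2 t : 0 <= t <= 1 -> Rcont (fun t => prim l f n t * npow (t + INR n.+1) (w + 1))%C t.
  by move=> Ht; exact: Rcont_piece.
have c3 t : 0 <= t <= 1 -> Rcont (fun t => - w * (prim l f n t * npow (t + INR n.+1) (w + 1)))%C t.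
  by move=> Ht; apply: (Rcont_mult (Rcont_const _ _)); exact: c2.
have := @Cint_derive (fun t => prim l f n t * npow (t + INR n.+1) w)%C
  (fun t => f n t * npow (t + INR n.+1) w + - w * (prim l f n t * npow (t + INR n.+1) (w + 1)))%C 0 1 q0.
rewrite Cint_plus // Cint_scal // -/(piece f w n) -/(piece (prim l f) (w + 1)%C n).
rewrite prim_glue Rplus_0_l (_ : 1 + INR n.+1 = INR n.+2); last by rewrite (S_INR n.+1); ring.
move=> H; rewrite -H; first by ring.
- move=> t Ht; apply: (Rder_eq (Rder_mult (Rder_prim l n t Hf) (Rder_npow w (arg_pos n Ht)))).
  by ring.
- by move=> t Ht; apply: Rcont_plus; [exact: c1 | exact: c3].
Qed.

(** The boundary terms telescope. At the lower end u = 1 and u ^ (- w) = 1, which leaves the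
    constant that appears in [chain]. *)
Lemma piece_sum_by_parts l f w N : (forall n t, Rcont (f n) t) ->
  \big[Cplus/RtoC 0]_(0 <= n < N) piece f w n =
  ((prim l f N 0 * npow (INR N.+1) w + - prim l f 0%nat 0)
    + w * \big[Cplus/RtoC 0]_(0 <= n < N) piece (prim l f) (w + 1) n)%C.
Proof.
move=> Hf; elim: N => [|N IH].
  by rewrite !big_geq // (_ : INR 1 = 1) // npow_1; ring.
by rewrite !Csum_recr IH (piece_by_parts l _ _ Hf); ring.
Qed.

Lemma npow_INR_lim0 w : 0 < Re w -> Clim (fun N => npow (INR N.+1) w) 0.
Proof.
move=> w0 eps e0.
(* The threshold is eps ^ (- 1 / Re w), written with exp and ln. *)
have [N HN] := INR_unbounded (exp (- ln eps / Re w)).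
exists N => n /leP /le_INR Hn; have n1 := INR_succ_ge1 n.
have -> : (npow (INR n.+1) w - 0 = npow (INR n.+1) w)%C by ring.
rewrite Cmod_npow; last lra.
rewrite -[eps in _ <= eps]exp_ln //; apply: Rlt_le; apply: exp_increasing.
have : - ln eps / Re w < ln (INR n.+1).
  rewrite -[_ / _]ln_exp; apply: ln_increasing; first exact: exp_pos.
  by rewrite S_INR; lra.
move=> /(Rmult_lt_compat_l _ _ _ w0).
have -> : Re w * (- ln eps / Re w) = - ln eps by field; lra.
by lra.
Qed.

End EntireContinuation.

(** * Continuation to the whole plane *)

Section Chain.
Local Open Scope R_scope.

(* Continuation of [mellin f] to [Re w > 8 - k], by [k] integrations by parts. *)
Fixpoint chain (l k : nat) (f : nat -> R -> C) (w : C) : C :=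
  if k is k'.+1 then (- prim l f 0%nat 0 + w * chain l k' (prim l f) (w + 1))%C
  else mellin f w.

Lemma Clim_bounded_mult u v M : (forall n, Cmod (u n) <= M) -> Clim v 0 ->
  Clim (fun n => u n * v n)%C 0.
Proof.
move=> Hu Hv eps e0; have M0 : 0 <= M by apply: Rle_trans (Hu 0%nat); exact: Cmod_ge_0.
have [|N HN] := Hv (eps / (1 + M)); first by apply: Rdiv_lt_0_compat; lra.
exists N => n /HN; have -> : (v n - 0 = v n)%C by ring.
have -> : (u n * v n - 0 = u n * v n)%C by ring.
move=> h; rewrite Cmod_mult.
have E : (1 + M) * (eps / (1 + M)) = eps by field; lra.
rewrite -[X in _ <= X]E; have := Hu n => h'.
by apply: Rmult_le_compat; [exact: Cmod_ge_0 | exact: Cmod_ge_0 | lra | lra].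
Qed.

(** One integration by parts changes the partial sums by a bounded sequence times (N + 1) ^ (- w),
    which tends to 0, and by a constant. Convergence for Re w > 1 is thus brought back from the
    region Re w >= 3, where the pieces are dominated. *)
Lemma chain_Csum l k f w : periodic_family l f -> mean_zero l f -> 1 < Re w ->
  3 <= Re w + INR k -> Csum (piece f w) (chain l k f w).
Proof.
elim: k f w => [|k IH] f w Pf Mf w1 Hk; have [l0 Hf _] := Pf.
  have [M [M0 HM]] := periodic_family_bounded Pf.
  apply: (@mellin_bound f M 0 w) => //; first lra.
  - by rewrite /= in Hk *; lra.
  - by move=> n t Ht; rewrite /= Rmult_1_r; exact: HM.
have Pp := prim_periodic Pf Mf.
have [M [M0 HM]] := periodic_family_bounded Pp.
have Rw : Re (w + 1)%C = Re w + 1 by rewrite re_plus re_RtoC.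
have {}IH : Csum (piece (prim l f) (w + 1)) (chain l k (prim l f) (w + 1)).
  by apply: IH => //; [exact: prim_mean_zero | lra | rewrite Rw; rewrite S_INR in Hk; lra].
rewrite /= -[(- _)%C]Cplus_0_l.
apply: (Clim_ext (fun N => esym (piece_sum_by_parts l w N Hf))).
apply: Clim_plus; last exact: Clim_scal.
apply: Clim_plus; last exact: Clim_const.
apply: (Clim_bounded_mult (M := M)) => [n|]; first by apply: HM; lra.
by apply: npow_INR_lim0; lra.
Qed.

(** Both sides unfold in parallel, w moving to w + 1 and f to its primitive, until the real part is
    at least 3; there both are the sum of the same convergent series. The agreement thus reaches
    points where the sum for f itself may diverge. *)
Lemma chain_succ l k f w : periodic_family l f -> mean_zero l f ->
  3 <= Re w + INR k -> chain l k.+1 f w = chain l k f w.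
Proof.
elim: k f w => [|k IH] f w Pf Mf Hk.
  rewrite /= in Hk; apply: (@Clim_unique (fun N => \big[Cplus/RtoC 0]_(0 <= n < N) piece f w n)).
  - by apply: (@chain_Csum l 1 f w Pf Mf) => /=; lra.
  - by apply: (@chain_Csum l 0 f w Pf Mf) => /=; lra.
have -> : chain l k.+2 f w = (- prim l f 0%nat 0 + w * chain l k.+1 (prim l f) (w + 1))%C by [].
rewrite IH //.
- exact: prim_periodic.
- exact: prim_mean_zero.
- by rewrite re_plus re_RtoC; rewrite S_INR in Hk; lra.
Qed.

Lemma chain_eq l j k f w : periodic_family l f -> mean_zero l f ->
  3 <= Re w + INR j -> 3 <= Re w + INR k -> chain l j f w = chain l k f w.
Proof.
move=> Pf Mf.
wlog jk : j k / (j <= k)%nat => [H Hj Hk|].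
  by case: (leqP j k) => [/H|/ltnW /H H']; [apply | apply: esym; apply: H'].
move=> Hj _; rewrite -(subnK jk) addnC; elim: (k - j)%nat => [|i IH]; first by rewrite addn0.
rewrite addnS chain_succ // -plusE plus_INR; have := pos_INR i; lra.
Qed.

Lemma chain_C1at l k f w : periodic_family l f -> mean_zero l f ->
  8 <= Re w + INR k -> C1at (chain l k f) w.
Proof.
elim: k f w => [|k IH] f w Pf Mf Hk; have [l0 Hf _] := Pf.
  have [M [M0 HM]] := periodic_family_bounded Pf.
  by apply: (mellin_C1at M0) => //; rewrite /= in Hk; lra.
apply: C1at_plus; first exact: C1at_const.
apply: C1at_mult; first exact: C1at_id.
apply: C1at_shift; apply: IH.
- exact: prim_periodic.
- exact: prim_mean_zero.
- by rewrite re_plus re_RtoC; rewrite S_INR in Hk; lra.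
Qed.

Theorem mean_zero_continuation l f : periodic_family l f -> mean_zero l f ->
  exists E : C -> C, (forall w, C1at E w) /\
    forall w, 1 < Re w -> Csum (piece f w) (E w).
Proof.
move=> Pf Mf.
have ex (x : R) (w : C) : exists k : nat, x <= Re w + INR k.
  by have [k Hk] := INR_unbounded (x - Re w); exists k; lra.
have /choice [K HK] := ex 3.
(* The depth [K w] varies arbitrarily with w; near a given w, [chain_eq] replaces it by a fixed
   depth, large enough for [chain_C1at]. *)
exists (fun w => chain l (K w) f w); split => w; last by move=> w1; exact: chain_Csum.
have [k Hk] := ex 8 w.
apply: (C1at_ext_loc (r := 1) (f := chain l k f)); first lra.
- move=> h h1; apply: chain_eq => //.
  by rewrite re_plus; have /Rabs_le_between := re_le_Cmod h; lra.
- exact: chain_C1at.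
Qed.

Lemma Re_gt1_neq (w : C) : 1 < Re w -> (w - 1)%C <> 0.
Proof.
move=> w1 E; have : Re (w - 1)%C = 0 by rewrite E.
by rewrite re_plus re_opp re_RtoC; lra.
Qed.

(** The integral of c u ^ (- w) over [1, oo[, by telescoping an explicit primitive. All poles come
    from here. *)
Lemma piece_const_sum (c w : C) : 1 < Re w -> Csum (piece (fun _ _ => c) w) (c / (w - 1))%C.
Proof.
move=> w1; have wn := Re_gt1_neq w1; have q0 : 0 <= 1 by lra.
pose g N := (c / (w - 1) * npow (INR N.+1) (w - 1))%C.
have E n : piece (fun _ _ => c) w n = (g n - g n.+1)%C.
  have := @Cint_derive (fun t => - (c / (w - 1)) * npow (t + INR n.+1) (w - 1))%C
    (fun t => c * npow (t + INR n.+1) w)%C 0 1 q0.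
  rewrite Rplus_0_l (_ : 1 + INR n.+1 = INR n.+2); last by rewrite (S_INR n.+1); ring.
  rewrite /piece => ->; first by rewrite /g; ring.
  - move=> t Ht; apply: (Rder_eq (Rder_mult (Rder_const _ t) (Rder_npow (w - 1)%C (arg_pos n Ht)))).
    have -> : (w - 1 + 1 = w)%C by ring.
    by field.
  - by move=> t Ht; apply: Rcont_piece => //; exact: Rcont_const.
have T N : (\big[Cplus/RtoC 0]_(0 <= n < N) piece (fun _ _ => c) w n = g 0%nat + -1 * g N)%C.
  elim: N => [|N IH]; first by rewrite big_geq //; ring.
  by rewrite Csum_recr IH E; ring.
apply: (Clim_ext (fun N => esym (T N))).
have -> : (c / (w - 1) = g 0%nat + -1 * (c / (w - 1) * 0))%C by rewrite /g npow_1 /Cdiv; ring.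
apply: Clim_plus; first exact: Clim_const.
do 2 apply: Clim_scal; apply: npow_INR_lim0.
by rewrite re_plus re_opp re_RtoC; lra.
Qed.

Theorem periodic_continuation l f (mu : C) : periodic_family l f ->
  (\big[Cplus/RtoC 0]_(0 <= n < l) Cint (f n) 0 1 = INR l * mu)%C ->
  exists E : C -> C, (forall w, C1at E w) /\
    forall w, 1 < Re w -> Csum (piece f w) (mu / (w - 1) + E w)%C.
Proof.
move=> Pf Hmu; have [l0 Hf Pn] := Pf; have q0 : 0 <= 1 by lra.
pose g n t := (f n t + - mu)%C.
have Pg : periodic_family l g.
  split => // n t; first by apply: Rcont_plus => //; exact: Rcont_const.
  by rewrite /g Pn.
have Mg : mean_zero l g.
  have E n : Cint (g n) 0 1 = (Cint (f n) 0 1 + - mu)%C.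
    rewrite Cint_plus //; last by move=> t _; exact: Rcont_const.
    congr Cplus; rewrite (@Cint_derive (fun t : R => t * - mu)%C) ?Cmult_1_l //.
    - by ring.
    - move=> t _; apply: (Rder_eq (Rder_mult (Rder_real (is_derive_id t)) (Rder_const _ t))).
      by rewrite /one /=; ring.
    - by move=> t _; exact: Rcont_const.
  by rewrite /mean_zero (eq_bigr _ (fun n _ => E n)) big_split /= Hmu big_Cconst; ring.
have [E [E1 E2]] := mean_zero_continuation Pg Mg.
exists E; split => // w w1.
apply: (Csum_ext _ (Csum_plus (piece_const_sum mu w1) (E2 w w1))) => n.
rewrite -piece_plus.
- by apply: Cint_ext => // t _; rewrite /g; ring.
- by move=> t _; exact: Rcont_const.
- by move=> t _; case: Pg.
Qed.

(* [u ^ (- w)] at [u = n] is the integral over [n <= u <= n + 1] of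
   [u ^ (- w) + w (n + 1 - u) u ^ (- w - 1)]. *)
Lemma npow_piece (c : nat -> C) w n :
  (c n * npow (INR n.+1) w = piece (fun n _ => c n) w n +
     w * piece (fun n t => RtoC (1 - t) * c n) (w + 1) n)%C.
Proof.
have q0 : 0 <= 1 by lra.
have cl t : Rcont (fun t => RtoC (1 - t) * c n)%C t.
  apply: Rcont_mult; last exact: Rcont_const.
  apply: Rcont_real; apply: (continuous_minus (V := R_NormedModule)).
  - exact: continuous_const.
  - exact: continuous_id.
have c1 t : 0 <= t <= 1 -> Rcont (fun t => c n * npow (t + INR n.+1) w)%C t.
  by move=> Ht; apply: (@Rcont_piece (fun n _ => c n)) => //; exact: Rcont_const.
have c2 t : 0 <= t <= 1 -> Rcont (fun t => RtoC (1 - t) * c n * npow (t + INR n.+1) (w + 1))%C t.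
  by move=> Ht; apply: (@Rcont_piece (fun n t => RtoC (1 - t) * c n)%C).
have c3 t : 0 <= t <= 1 -> Rcont (fun t => w * (RtoC (1 - t) * c n * npow (t + INR n.+1) (w + 1)))%C t.
  by move=> Ht; apply: (Rcont_mult (Rcont_const _ _)); exact: c2.
rewrite /piece -Cint_scal // -Cint_plus //.
rewrite (@Cint_derive (fun t => - (RtoC (1 - t) * c n) * npow (t + INR n.+1) w)%C) //.
- by rewrite Rminus_diag Rminus_0_r Rplus_0_l; ring.
- move=> t Ht.
  have D : is_derive (fun t => 1 - t) t (-1).
    have := @is_derive_minus R_AbsRing R_NormedModule (fun _ => 1) (fun t => t) t 0 1 (is_derive_const 1 t) (is_derive_id t).
    by rewrite /minus /plus /opp /= Rplus_0_l.
  have := Rder_mult (Rder_mult (Rder_const (-1) t) (Rder_mult (Rder_real D) (Rder_const (c n) t)))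
    (Rder_npow w (arg_pos n Ht)).
  move=> H; apply: (Rder_eq (Rder_ext _ H)); last by ring.
  by move=> x; ring.
- by move=> t Ht; apply: Rcont_plus; [exact: c1 | exact: c3].
Qed.

(** Of the two families in [npow_piece], the step function has mean [mu] and the sawtooth has mean
    [mu / 2]. The latter is taken at w + 1 and multiplied by w, so its polar part (mu / 2) / w
    becomes the constant mu / 2, and only the pole at w = 1 remains. *)
Theorem dirichlet_continuation l (c : nat -> C) (mu : C) : (0 < l)%nat ->
  (forall n, c (n + l)%nat = c n) ->
  (\big[Cplus/RtoC 0]_(0 <= n < l) c n = INR l * mu)%C ->
  exists E : C -> C, (forall w, C1at E w) /\
    forall w, 1 < Re w -> Csum (fun n => c n * npow (INR n.+1) w)%C (mu / (w - 1) + E w)%C.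
Proof.
move=> l0 Pc Hmu; have q0 : 0 <= 1 by lra.
have Dl t : is_derive (fun t => 1 - t) t (-1).
  have := @is_derive_minus R_AbsRing R_NormedModule (fun _ => 1) (fun t => t) t 0 1 (is_derive_const 1 t) (is_derive_id t).
  by rewrite /minus /plus /opp /= Rplus_0_l.
have cl t : Rcont (fun t => RtoC (1 - t)) t.
  by apply: Rder_cont (Rder_real (Dl t)).
have P1 : periodic_family l (fun n _ => c n) by split => // n t; exact: Rcont_const.
have P2 : periodic_family l (fun n t => RtoC (1 - t) * c n)%C.
  split => // n t; last by rewrite Pc.
  by apply: Rcont_mult => //; exact: Rcont_const.
have M1 : (\big[Cplus/RtoC 0]_(0 <= n < l) Cint (fun _ => c n) 0 1 = INR l * mu)%C.
  rewrite -Hmu; apply: eq_bigr => n _.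
  rewrite (@Cint_derive (fun t : R => t * c n)%C) ?Cmult_1_l //.
  - by ring.
  - move=> t _; apply: (Rder_eq (Rder_mult (Rder_real (is_derive_id t)) (Rder_const _ t))).
    by rewrite /one /=; ring.
  - by move=> t _; exact: Rcont_const.
have M2 : (\big[Cplus/RtoC 0]_(0 <= n < l) Cint (fun t => RtoC (1 - t) * c n) 0 1 = INR l * (/ 2 * mu))%C.
  have -> : (INR l * (/ 2 * mu) = / 2 * (INR l * mu))%C by ring.
  rewrite -Hmu big_Cmult_r; apply: eq_bigr => n _.
  rewrite (@Cint_derive (fun t : R => RtoC (1 - t) * RtoC (1 - t) * (- / 2 * c n))%C) //.
  - by rewrite Rminus_diag Rminus_0_r; ring.
  - move=> t _; apply: (Rder_eq (Rder_mult (Rder_mult (Rder_real (Dl t)) (Rder_real (Dl t))) (Rder_const _ t))).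
    have n2 : RtoC 2 <> 0 by move=> E; have := RtoC_inj _ _ E; lra.
    by field.
  - by move=> t _; apply: Rcont_mult => //; exact: Rcont_const.
have [E1 [H1 S1]] := periodic_continuation P1 M1.
have [E2 [H2 S2]] := periodic_continuation P2 M2.
exists (fun w => E1 w + (/ 2 * mu + w * E2 (w + 1)))%C; split => w.
  apply: C1at_plus => //; apply: C1at_plus; first exact: C1at_const.
  by apply: C1at_mult; [exact: C1at_id | exact: (C1at_shift (f := E2))].
move=> w1; have w2 : 1 < Re (w + 1)%C by rewrite re_plus re_RtoC; lra.
have w0 : w <> 0 by move=> E; rewrite E /= in w1; lra.
have -> : (mu / (w - 1) + (E1 w + (/ 2 * mu + w * E2 (w + 1))) =
   (mu / (w - 1) + E1 w) + w * (/ 2 * mu / (w + 1 - 1) + E2 (w + 1)))%C.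
  have wn := Re_gt1_neq w1.
  have -> : (w + 1 - 1 = w)%C by ring.
  by field; split => // E; have := RtoC_inj _ _ E; lra.
apply: (Csum_ext _ (Csum_plus (S1 w w1) (Csum_scal w (S2 _ w2)))) => n.
by rewrite -npow_piece.
Qed.

End Chain.

(** * Homomorphisms from finite abelian groups to cyclic groups *)

Section Combinatorics.

(** The bridge between Hom and [mu]: for a product of cyclic groups and m >= 1, both
    [nhom A (cyc m)] and [torsion A m] are a product of gcds, and sums of [torsion A m] over m count
    inverses of orders. *)
Definition torsion (A : finGroupType) (m : nat) : nat := #|[set a : A | (a ^+ m)%g == 1%g]|%SET.

Definition homs (A B : finGroupType) : {set {ffun A -> B}} :=
  [set f : {ffun A -> B} | [forall x, forall y, f (x * y)%g == (f x * f y)%g]]%SET.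

Lemma homsP (A B : finGroupType) (f : {ffun A -> B}) :
  reflect (forall x y, f (x * y)%g = (f x * f y)%g) (f \in homs A B).
Proof.
rewrite inE; apply: (iffP forallP) => [H x y|H x].
- by move/forallP: (H x) => /(_ y) /eqP.
- by apply/forallP => y; rewrite H.
Qed.

Lemma hom1 (A B : finGroupType) (f : {ffun A -> B}) : f \in homs A B -> f 1%g = 1%g.
Proof. by move/homsP => H; apply: (mulgI (f 1%g)); rewrite -H !mulg1. Qed.

Lemma homX (A B : finGroupType) (f : {ffun A -> B}) x k : f \in homs A B ->
  f (x ^+ k)%g = (f x ^+ k)%g.
Proof.
move=> Hf; elim: k => [|k IH]; first by rewrite !expg0 hom1.
by rewrite !expgS (homsP _ Hf) IH.
Qed.

Lemma cyc_mulC m (a b : cyc m) : (a * b = b * a)%g.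
Proof. exact: Zp_mulgC. Qed.

Lemma nhom_unit m : nhom 'I_1 (cyc m) = 1%nat.
Proof.
rewrite /nhom -/(homs _ _).
have -> : homs 'I_1 (cyc m) = [set [ffun _ => 1%g]]%SET.
  apply/setP => f; rewrite [in RHS]inE; apply/idP/eqP => [Hf|->].
  - apply/ffunP => x; rewrite ffunE (_ : x = 1%g) ?hom1 //.
    by apply/val_inj; case: x => -[].
  - by apply/homsP => x y; rewrite !ffunE mulg1.
by rewrite cards1.
Qed.

(** A homomorphism on a product is the product of its restrictions to the factors; that [F] produces
    homomorphisms rests on the commutativity of [cyc m]. *)
Lemma nhom_prod (A B : finGroupType) m :
  nhom (A * B)%type (cyc m) = (nhom A (cyc m) * nhom B (cyc m))%nat.
Proof.
rewrite /nhom -!/(homs _ _) -cardsX.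
pose F (p : {ffun A -> cyc m} * {ffun B -> cyc m}) : {ffun A * B -> cyc m} :=
  [ffun x => (p.1 x.1 * p.2 x.2)%g].
have -> : homs (A * B)%type (cyc m) = [set F p | p in finset.setX (homs A (cyc m)) (homs B (cyc m))]%SET.
  apply/setP => f; apply/idP/finset.imsetP => [/homsP Hf|[[g h] ]].
  - exists ([ffun a => f (a, 1%g)], [ffun b => f (1%g, b)]).
    + rewrite finset.in_setX; apply/andP; split; apply/homsP => x y; rewrite !ffunE -Hf; congr (f _);
        by congr pair; rewrite mulg1.
    + apply/ffunP => -[a b]; rewrite !ffunE /= -Hf; congr (f _).
      by congr pair; rewrite ?mulg1 ?mul1g.
  - rewrite finset.in_setX => /andP [/= /homsP Hg /homsP Hh] ->; apply/homsP => -[a b] [c d].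
    rewrite !ffunE /= Hg Hh -!mulgA; congr (_ * _)%g.
    by rewrite !mulgA [(h b * g c)%g]cyc_mulC.
rewrite card_in_imset // => -[g h] [g' h']; rewrite !finset.in_setX /= => /andP [Hg Hh] /andP [Hg' Hh'] E.
congr pair; apply/ffunP => x.
- by move/ffunP: E => /(_ (x, 1%g)); rewrite !ffunE /= !hom1 // !mulg1.
- by move/ffunP: E => /(_ (1%g, x)); rewrite !ffunE /= !hom1 // !mul1g.
Qed.

Lemma cyc_expg m (c : cyc m) k : (c ^+ k)%g = inZp (c * k) :> 'I_m.-1.+1.
Proof.
elim: k => [|k IH]; first by apply/val_inj; rewrite expg0 /= muln0 mod0n.
by apply/val_inj; rewrite expgS IH /= modnDmr mulnS.
Qed.

(** A homomorphism on a cyclic group is given by the image of its generator, which can be any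
    element killed by n. *)
Lemma nhom_cyc_torsion n m : (0 < n)%nat -> nhom (cyc n) (cyc m) = torsion (cyc m) n.
Proof.
case: n => // n _; rewrite /nhom -/(homs _ _) /torsion.
pose g : cyc n.+1 := inZp 1.
have gX (x : cyc n.+1) : (g ^+ x)%g = x.
  rewrite cyc_expg; apply/val_inj; rewrite /= modnMml mul1n modn_small //.
have gn : (g ^+ n.+1)%g = 1%g by rewrite cyc_expg; apply/val_inj; rewrite /= modnMl.
pose F (c : cyc m) : {ffun cyc n.+1 -> cyc m} := [ffun x : cyc n.+1 => (c ^+ (x : 'I_n.+1))%g].
have -> : homs (cyc n.+1) (cyc m) = [set F c | c in [set c : cyc m | (c ^+ n.+1)%g == 1%g]]%SET.
  apply/setP => f; apply/idP/finset.imsetP => [Hf|[c]].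
  - exists (f g); first by rewrite inE -homX // gn hom1.
    by apply/ffunP => x; rewrite ffunE -homX // gX.
  - rewrite inE => /eqP Hc ->; apply/homsP => x y; rewrite !ffunE -expgD.
    (* The sum in [cyc n.+1] is a remainder; the inserted factor 1 is c ^+ n.+1 raised to the
       quotient, which restores the exponent x + y. *)
    by rewrite /= -[LHS]mul1g -(expg1n _ ((x + y) %/ n.+1)) -Hc -expgM -expgD mulnC -divn_eq.
rewrite card_in_imset // => c d; rewrite !inE => /eqP Hc /eqP Hd /ffunP /(_ g).
(* In the trivial group [g] is 0 and evaluation at [g] loses c; there c ^+ 1 = 1 already determines
   c. *)
rewrite !ffunE /=; case: (n) Hc Hd => [|n']; first by rewrite !expg1 => -> ->.
by rewrite modn_small // !expg1.
Qed.

(** With g the gcd, c n is 0 modulo m iff m / g divides c, because m / g and n / g are coprime. The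
    solutions are the multiples i * (m / g) with i < g. *)
Lemma torsion_cyc n m : (0 < m)%nat -> (0 < n)%nat -> torsion (cyc m) n = gcdn n m.
Proof.
case: m => // m _ n0; rewrite /torsion.
set g := gcdn n m.+1; have g0 : (0 < g)%nat by rewrite gcdn_gt0 n0.
have gm : (g %| m.+1)%nat by exact: dvdn_gcdr.
have gn : (g %| n)%nat by exact: dvdn_gcdl.
set m1 := (m.+1 %/ g)%nat; have Em : m.+1 = (m1 * g)%nat by rewrite divnK.
have En : n = (n %/ g * g)%nat by rewrite divnK.
have m10 : (0 < m1)%nat by rewrite divn_gt0 // dvdn_leq.
have cop : coprime m1 (n %/ g).
  rewrite /coprime -(eqn_pmul2r g0) muln_gcdl -Em -En mul1n gcdnC.
  by rewrite eqxx.
have lt (i : 'I_g) : (i * m1 < m.+1)%nat by rewrite Em [(m1 * g)%nat]mulnC ltn_pmul2r.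
pose F (i : 'I_g) : cyc m.+1 := Ordinal (lt i).
have -> : [set c : cyc m.+1 | (c ^+ n)%g == 1%g]%SET = [set F i | i in [set: 'I_g]]%SET.
  apply/setP => c; rewrite inE cyc_expg -val_eqE /=.
  have -> : ((c * n) %% m.+1 == 0)%nat = (m1 %| c)%nat.
    rewrite -/(dvdn _ _) {1}Em {1}En mulnA dvdn_pmul2r // Gauss_dvdl //.
  apply/idP/finset.imsetP => [/dvdnP [k Hk]|[i _ ->]]; last by rewrite /= dvdn_mull.
  have kg : (k < g)%nat.
    by have := ltn_ord c; rewrite Hk {1}Em [(m1 * g)%nat]mulnC ltn_pmul2r.
  exists (Ordinal kg); first by rewrite inE.
  by apply: (@ord_inj m.+1); rewrite /= Hk.
rewrite card_imset ?cardsT ?card_ord // => i j [] /eqP.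
by rewrite eqn_pmul2r // => /eqP /ord_inj.
Qed.

Lemma nhom_cyc_prod ns m : all (leq 1) ns -> (0 < m)%nat ->
  nhom (cyc_prod ns) (cyc m) = \prod_(k <- ns) gcdn m k.
Proof.
move=> + m0; elim: ns => [|n ns IH] /=; first by rewrite big_nil nhom_unit.
move=> /andP [n0 Hns]; rewrite nhom_prod big_cons IH // nhom_cyc_torsion // torsion_cyc //.
by rewrite gcdnC.
Qed.

Lemma torsion_prod (A B : finGroupType) m :
  torsion (A * B)%type m = (torsion A m * torsion B m)%nat.
Proof.
have X (a : A) (b : B) k : ((a, b) ^+ k)%g = (a ^+ k, b ^+ k)%g :> (A * B)%type.
  by elim: k => [|k IH]; rewrite ?expg0 // !expgS IH.
rewrite /torsion -cardsX; congr #|pred_of_set _|.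
by apply/setP => -[a b]; rewrite finset.in_setX !inE X.
Qed.

Lemma torsion_cyc_prod ns m : all (leq 1) ns -> (0 < m)%nat ->
  torsion (cyc_prod ns) m = \prod_(k <- ns) gcdn m k.
Proof.
move=> + m0; elim: ns => [|n ns IH] /=.
  rewrite big_nil /torsion => _.
  have -> : [set a : 'I_1 | (a ^+ m)%g == 1%g]%SET = [set 1%g]%SET; last by rewrite cards1.
  apply/setP => x; rewrite !inE (_ : x = 1%g) ?expg1n ?eqxx //.
  by apply: ord_inj; case: x => -[].
by move=> /andP [n0 Hns]; rewrite torsion_prod big_cons IH // torsion_cyc.
Qed.

Lemma cyc_prod_expg ns L (a : cyc_prod ns) : all (leq 1) ns ->
  (forall n, n \in ns -> n %| L)%nat -> (a ^+ L)%g = 1%g.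
Proof.
elim: ns a => [|n ns IH] /=.
  by move=> a _ _; apply/val_inj; case: (a ^+ L)%g => -[].
move=> [a b] /andP [n0 Hns] HL.
have X k : ((a, b) ^+ k)%g = (a ^+ k, b ^+ k)%g :> (cyc n * cyc_prod ns)%type.
  by elim: k => [|k IHk]; rewrite ?expg0 // !expgS IHk.
rewrite X IH //; last by move=> k Hk; apply: HL; rewrite inE Hk orbT.
congr pair; rewrite cyc_expg; apply/val_inj => /=.
apply/eqP; rewrite -/(dvdn _ _); apply: dvdn_mull.
by rewrite prednK //; apply: HL; rewrite inE eqxx.
Qed.

(** Double counting of the pairs (m, a) such that the order of a divides m: each a has L / |a| such
    m in [1, L]. *)
Lemma sum_torsion (A : finGroupType) L : (forall a : A, (a ^+ L)%g = 1%g) ->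
  \sum_(1 <= m < L.+1) torsion A m = \sum_(a : A) (L %/ #[a]%g)%nat.
Proof.
move=> HL; under [RHS]eq_bigr do rewrite divn_count_dvd.
rewrite exchange_big /=; apply: eq_bigr => m _.
rewrite /torsion -sum1_card big_mkcond /=; apply: eq_bigr => a _.
by rewrite inE order_dvdn; case: (_ == _).
Qed.

End Combinatorics.

HB.instance Definition _ := Monoid.isComLaw.Build R (IZR 0) Rplus
  (fun x y z => esym (Rplus_assoc x y z)) Rplus_comm Rplus_0_l.

(** * The invariant mu as a mean of torsion counts *)

Section Mu.
Local Open Scope R_scope.

Lemma INR_sum (I : Type) (r : seq I) (P : pred I) (f : I -> nat) :
  INR (\sum_(i <- r | P i) f i) = \big[Rplus/IZR 0]_(i <- r | P i) INR (f i).
Proof. by apply: (big_morph INR) => // x y; rewrite -plusE plus_INR. Qed.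

(** [L] is left free: the lcm gives the gcd formula, and the exponent of the group gives the Fourier
    coefficient at 0. *)
Lemma mu_torsion (A : finGroupType) L : (0 < L)%nat -> (forall a : A, (a ^+ L)%g = 1%g) ->
  mu A = / INR L * INR (\sum_(1 <= m < L.+1) torsion A m).
Proof.
move=> L0 HL; have Lp : 0 < INR L by apply: lt_0_INR; exact/ltP.
rewrite (sum_torsion HL) INR_sum /mu.
have D (x : R) (f : A -> R) : x * \big[Rplus/IZR 0]_(a : A) f a = \big[Rplus/IZR 0]_(a : A) (x * f a).
  by apply: (big_morph (Rmult x)) => [u v|]; ring.
rewrite D; apply: eq_bigr => a _.
have da : (#[a]%g %| L)%nat by rewrite order_dvdn HL.
have op : 0 < INR #[a]%g by apply: lt_0_INR; apply/ltP; exact: order_gt0.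
rewrite -{1}(divnK da) -multE mult_INR.
have dp : INR (L %/ #[a]%g) <> 0.
  by apply: not_0_INR => E; have := divnK da; rewrite E mul0n => E2; rewrite -E2 in L0.
by field; split => //; lra.
Qed.

Lemma mu_gcdE ns : all (leq 1) ns -> mu (cyc_prod ns) = mu_gcd ns.
Proof.
move=> Hns; rewrite /mu_gcd; set L := \big[_/_]_(_ <- _) _.
have L0 : (0 < L)%nat.
  rewrite /L; elim: ns Hns {L} => [|n ns IH]; first by rewrite big_nil.
  by move=> /= /andP [n0 /IH H]; rewrite big_cons lcmn_gt0 n0.
rewrite (mu_torsion L0) => [|a].
  congr (_ * INR _); rewrite big_nat_cond [RHS]big_nat_cond; apply: eq_bigr => m.
  by rewrite andbT => /andP [m0 _]; exact: torsion_cyc_prod.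
apply: cyc_prod_expg => // n Hn; rewrite /L.
elim: ns Hn {Hns L L0 a} => // k ns IH; rewrite inE big_cons => /orP [/eqP ->|/IH H].
- exact: dvdn_lcml.
- exact: dvdn_trans H (dvdn_lcmr _ _).
Qed.

End Mu.

(** * The trigonometric interpolation *)

Section Fourier.
Local Open Scope R_scope.

Definition om (x : R) : C := Cexp (Ci * RtoC (2 * PI * x))%C.

Lemma om_add x y : om (x + y) = (om x * om y)%C.
Proof. by rewrite /om -Cexp_add; congr Cexp; rewrite Rmult_plus_distr_l RtoC_plus; ring. Qed.

Lemma omE x : om x = (cos (2 * PI * x), sin (2 * PI * x)).
Proof.
rewrite /om /Cexp re_mult im_mult re_RtoC im_RtoC /Ci /=.
rewrite (_ : 0 * _ - 1 * 0 = 0); last ring.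
rewrite (_ : 0 * 0 + 1 * _ = 2 * PI * x); last ring.
by rewrite exp_0 !Rmult_1_l.
Qed.

Lemma om_0 : om 0 = 1.
Proof. by rewrite omE Rmult_0_r cos_0 sin_0. Qed.

Lemma om_half (k : Z) : om (IZR k / 2) = RtoC (cos (PI * IZR k)).
Proof.
rewrite omE (_ : 2 * PI * (IZR k / 2) = IZR k * PI); last by field.
by rewrite (sin_eq_0_1 (IZR k * PI)); [rewrite Rmult_comm | exists k].
Qed.

Lemma om_int (k : Z) : om (IZR k) = 1.
Proof.
rewrite omE (_ : 2 * PI * IZR k = 2 * (IZR k * PI)); last ring.
have S : sin (IZR k * PI) = 0 by apply: sin_eq_0_1; exists k.
by rewrite cos_2a_sin sin_2a S; congr pair; ring.
Qed.

Lemma om_nat (n : nat) : om (INR n) = 1.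
Proof. by rewrite INR_IZR_INZ om_int. Qed.

Lemma om_neq1 x : 0 < Rabs x < 1 -> om x <> 1.
Proof.
move=> Hx E.
have Ec : cos (2 * PI * x) = 1.
  by have := omE x; rewrite E => -[<-].
have S0 : sin (PI * x) = 0.
  have := cos_2a_sin (PI * x); rewrite -Rmult_assoc Ec; nra.
have P := PI_RGT_0.
case: (Rcase_abs x) => Sx.
- rewrite Rabs_left // in Hx.
  have : 0 < sin (- (PI * x)) by apply: sin_gt_0; nra.
  by rewrite sin_neg S0; lra.
- rewrite Rabs_right // in Hx.
  have : 0 < sin (PI * x) by apply: sin_gt_0; nra.
  by rewrite S0; lra.
Qed.

(** A geometric sum, multiplied by its denominator [om x - 1]. *)
Lemma om_sum0 (l : nat) x : om x <> 1 -> om (INR l * x) = 1 ->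
  \big[Cplus/RtoC 0]_(0 <= i < l) om (INR i * x) = 0.
Proof.
move=> n1 Hl.
have T : ((om x - 1) * \big[Cplus/RtoC 0]_(0 <= i < l) om (INR i * x) = om (INR l * x) - 1)%C.
  elim: l {Hl} => [|l IH]; first by rewrite big_geq // Rmult_0_l om_0; ring.
  rewrite Csum_recr Cmult_plus_distr_l IH S_INR Rmult_plus_distr_r Rmult_1_l om_add; ring.
rewrite Hl in T.
have n0 : (om x - 1)%C <> 0.
  move=> E; apply: n1; have -> : om x = ((om x - 1) + 1)%C by ring.
  by rewrite E; ring.
set s := \big[_/_]_(_ <= _ < _) _ in T *.
have -> : s = (/ (om x - 1) * ((om x - 1) * s))%C by field.
by rewrite T; ring.
Qed.

Lemma sum_period (l a : nat) (f : nat -> C) : (forall i, f (i + l)%nat = f i) ->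
  \big[Cplus/RtoC 0]_(a <= i < a + l) f i = \big[Cplus/RtoC 0]_(0 <= i < l) f i.
Proof.
move=> Pf; elim: a => [|a IH]; first by rewrite add0n.
case: l Pf IH => [|l] Pf IH; first by rewrite addn0 !big_geq.
rewrite -IH [RHS]big_ltn ?leq_addr //; last by rewrite addnS ltnS leq_addr.
rewrite addSn big_nat_recr /=; last by rewrite addnS ltnS leq_addr.
by rewrite Pf Cplus_comm.
Qed.

Section Trig.
Variable A : finGroupType.
Let l := exponent [set: A]%g.
Let lpos : (0 < l)%nat := exponent_gt0 [set: A]%g.

Lemma INR_exponent_pos : 0 < INR l.
Proof. by apply: lt_0_INR; apply/ltP. Qed.

Lemma fourier_coefE k : fourier_coef A k =
  (/ INR l * \big[Cplus/RtoC 0]_(1 <= m < l.+1) (INR (nhom A (cyc m)) * om (- (IZR k * INR m / INR l))))%C.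
Proof.
rewrite /fourier_coef -/l; congr Cmult; apply: eq_bigr => m _; congr Cmult; rewrite /om.
congr Cexp; have lp := INR_exponent_pos.
rewrite !(RtoC_mult, RtoC_opp, RtoC_div); try lra.
rewrite /Cdiv; ring.
Qed.

Lemma trig_termE k (z : R) : Cexp (2 * PI * Ci * IZR k * z / INR l)%C = om (IZR k * z / INR l).
Proof.
rewrite /om; congr Cexp; have lp := INR_exponent_pos.
rewrite !(RtoC_mult, RtoC_opp, RtoC_div); try lra.
rewrite /Cdiv; ring.
Qed.

Lemma fourier_coef_period k : fourier_coef A (k + Z.of_nat l)%Z = fourier_coef A k.
Proof.
rewrite !fourier_coefE; congr Cmult; apply: eq_bigr => m _; congr Cmult.
have lp := INR_exponent_pos.
rewrite plus_IZR -INR_IZR_INZ.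
have -> : - ((IZR k + INR l) * INR m / INR l) = - (IZR k * INR m / INR l) + IZR (- Z.of_nat m).
  by rewrite opp_IZR -INR_IZR_INZ; field; lra.
by rewrite om_add om_int Cmult_1_r.
Qed.

Definition freq (i : nat) : Z := (Z.of_nat i - Z.of_nat l)%Z.

Definition small_freq (i : nat) : bool := Z.ltb (2 * Z.abs (freq i)) (Z.of_nat l).

Lemma trig_extE (z : R) : trig_ext A z =
  (\big[Cplus/RtoC 0]_(0 <= i < l.*2.+1 | small_freq i)
      (fourier_coef A (freq i) * om (IZR (freq i) * z / INR l))
  + (if odd l then RtoC 0 else fourier_coef A (Z.of_nat l./2) * cos (PI * z)))%C.
Proof.
rewrite /trig_ext -/l big_mkord; congr Cplus; apply: eq_big => // i _.
by rewrite trig_termE.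
Qed.

Lemma small_freqE i : small_freq i = (l < i.*2 < 3 * l)%nat.
Proof.
rewrite /small_freq /freq -muln2 -!multE; apply/idP/andP.
- by move=> /Z.ltb_lt H; split; apply/ltP; lia.
- by move=> [/ltP H1 /ltP H2]; apply/Z.ltb_lt; lia.
Qed.

(** At an integer N the term of frequency k depends only on k modulo l, so any complete residue
    system may be used. The frequencies |k| < l / 2 form one when l is odd; when l is even, k = l /
    2 is missing, and its exponential at N equals cos (PI N). *)
Lemma trig_ext_nat_sum (N : nat) : trig_ext A (INR N) =
  \big[Cplus/RtoC 0]_(0 <= i < l) (fourier_coef A (Z.of_nat i) * om (INR i * INR N / INR l))%C.
Proof.
have lp := INR_exponent_pos.
pose phi (k : Z) := (fourier_coef A k * om (IZR k * INR N / INR l))%C.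
have Pphi k : phi (k + Z.of_nat l)%Z = phi k.
  rewrite /phi fourier_coef_period; congr Cmult; rewrite plus_IZR -INR_IZR_INZ.
  have -> : (IZR k + INR l) * INR N / INR l = IZR k * INR N / INR l + INR N by field; lra.
  by rewrite om_add om_nat Cmult_1_r.
have -> : \big[Cplus/RtoC 0]_(0 <= i < l) (fourier_coef A (Z.of_nat i) * om (INR i * INR N / INR l))%C
   = \big[Cplus/RtoC 0]_(0 <= i < l) phi (freq i).
  apply: eq_bigr => i _; rewrite -(Pphi (freq i)) /phi INR_IZR_INZ.
  by rewrite /freq Z.sub_add.
have Pf i : phi (freq (i + l)) = phi (freq i).
  by rewrite -(Pphi (freq i)); congr phi; rewrite /freq -plusE; lia.
(* The window l./2 < i <= l./2 + l corresponds to the frequencies from l./2 + 1 - l to l./2, with l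
   / 2 last when l is even. *)
rewrite -(sum_period l./2.+1 Pf) trig_extE.
have lE := odd_double_half l; set h := l./2 in lE *.
have ev : ~~ odd l -> (l = h + h)%nat by move=> o; rewrite -[LHS]lE (negbTE o) addnn.
have od : odd l -> (l = (h + h).+1)%nat by move=> o; rewrite -[LHS]lE o addnn.
rewrite (big_cat_nat (n := h.+1)) //=; last by rewrite ltnS; lia.
rewrite [X in (X + _ + _)%C]big_nat_cond big1 => [|i]; last first.
  rewrite andbC => /andP [+ /andP [_ ih]]; rewrite small_freqE => /andP [li _].
  by case: (boolP (odd l)) => [/od|/ev] e; lia.
rewrite Cplus_0_l (big_cat_nat (n := (h.+1 + l)%nat)) /=; last first.
- by case: (boolP (odd l)) => [/od|/ev] e; lia.
- by rewrite leq_addr.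
rewrite [X in (_ + X + _)%C]big_nat_cond [X in (_ + X + _)%C]big1 => [|i]; last first.
  rewrite andbC => /andP [+ /andP [ih _]]; rewrite small_freqE => /andP [_ li].
  by case: (boolP (odd l)) => [/od|/ev] e; lia.
rewrite Cplus_0_r; case: (boolP (odd l)) => [/[dup] o /od e|/[dup] o /ev e].
- rewrite Cplus_0_r big_nat_cond [RHS]big_nat_cond; apply: eq_bigl => i.
  rewrite andbT; case: (boolP (_ <= i < _)%nat) => //= /andP [/leP h1 /ltP h2].
  by rewrite small_freqE; lia.
- have hp : (0 < h)%nat by have := lpos; lia.
  rewrite addSn big_mkcond big_nat_recr /=; last by rewrite -[h.+1]addn1 leq_add2l.
  rewrite [RHS]big_nat_recr /=; last by rewrite -[h.+1]addn1 leq_add2l.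
  have -> : small_freq (h + l) = false.
    by rewrite small_freqE; lia.
  rewrite Cplus_0_r; congr Cplus.
  + rewrite big_nat_cond [RHS]big_nat_cond; apply: eq_bigr => i.
    rewrite andbT => /andP [/leP h1 /ltP h2].
    have -> // : small_freq i.
    by rewrite small_freqE; lia.
  + have -> : freq (h + l) = Z.of_nat h by rewrite /freq -plusE; lia.
    rewrite /phi; congr Cmult.
    have -> : IZR (Z.of_nat h) * INR N / INR l = IZR (Z.of_nat N) / 2.
      rewrite -!INR_IZR_INZ; have El : INR l = 2 * INR h by rewrite {1}e -plusE plus_INR; ring.
      by have h0 : 0 < INR h; [lra | rewrite El; field; lra].
    by rewrite om_half INR_IZR_INZ.
Qed.

Lemma big_Cmult_l (I : Type) (r : seq I) (P : pred I) (c : C) (f : I -> C) :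
  (\big[Cplus/RtoC 0]_(i <- r | P i) f i * c)%C = \big[Cplus/RtoC 0]_(i <- r | P i) (f i * c)%C.
Proof. by rewrite Cmult_comm big_Cmult_r; apply: eq_bigr => i _; rewrite Cmult_comm. Qed.

Lemma trig_ext_period z : trig_ext A (z + INR l) = trig_ext A z.
Proof.
have lp := INR_exponent_pos.
rewrite !trig_extE; congr Cplus.
  apply: eq_bigr => i _; congr Cmult.
  have -> : IZR (freq i) * (z + INR l) / INR l = IZR (freq i) * z / INR l + IZR (freq i) by field; lra.
  by rewrite om_add om_int Cmult_1_r.
case: (boolP (odd l)) => // o; congr (_ * RtoC _)%C.
have := odd_double_half l; rewrite (negbTE o) add0n => e.
rewrite -{1}e -addnn -plusE plus_INR.
have -> : PI * (z + (INR l./2 + INR l./2)) = PI * z + 2 * INR l./2 * PI by ring.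
exact: cos_period.
Qed.

Hypothesis nhom_period : forall m, (0 < m)%nat -> nhom A (cyc (m + l)) = nhom A (cyc m).

(** Fourier inversion on Z/lZ: orthogonality singles out m = N among 1 <= m <= l, and larger N are
    reduced by periodicity. N = 0 is excluded because [cyc 0] is the trivial group, while the
    interpolation at 0 takes the value at l. *)
Theorem trig_ext_nat (N : nat) : (0 < N)%nat -> trig_ext A (INR N) = RtoC (INR (nhom A (cyc N))).
Proof.
have lp := INR_exponent_pos.
have [k Hk] := ubnP N; elim: k N Hk => // k IH N Nk N0.
case: (leqP N l) => [Nl|lN]; last first.
  have d0 : (0 < N - l)%nat by rewrite subn_gt0.
  rewrite -(subnK (ltnW lN)) nhom_period // -plusE plus_INR trig_ext_period IH //.
  by have := lpos; lia.
rewrite trig_ext_nat_sum.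
have E i : (fourier_coef A (Z.of_nat i) * om (INR i * INR N / INR l) =
    \big[Cplus/RtoC 0]_(1 <= m < l.+1) (/ INR l * (INR (nhom A (cyc m)) * om (INR i * ((INR N - INR m) / INR l)))))%C.
  rewrite fourier_coefE big_Cmult_r big_Cmult_l; apply: eq_bigr => m _.
  rewrite -!Cmult_assoc; congr Cmult; congr Cmult; rewrite -om_add -INR_IZR_INZ.
  by congr om; field; lra.
rewrite (eq_bigr _ (fun i _ => E i)) exchange_big /=.
have ln : RtoC (INR l) <> 0 by move=> e; have := RtoC_inj _ _ e; lra.
rewrite (eq_big_nat _ _ (F2 := fun m => if m == N then RtoC (INR (nhom A (cyc N))) else RtoC 0)).
  rewrite -big_mkcond big_nat1_eq /=.
  by rewrite N0 ltnS Nl.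
move=> m /andP [m0 ml]; rewrite -!big_Cmult_r.
case: eqP => [->|mN].
  rewrite (eq_bigr (fun _ => RtoC 1)); last first.
    by move=> i _; rewrite Rminus_diag /Rdiv Rmult_0_l Rmult_0_r om_0.
  by rewrite big_Cconst; field.
rewrite om_sum0; first by ring.
- apply: om_neq1; rewrite Rabs_div; last lra.
  rewrite [Rabs (INR l)]Rabs_pos_eq; last lra.
  have B : 0 < Rabs (INR N - INR m) < INR l.
    split; first by apply: Rabs_pos_lt => e; apply: mN; apply: INR_eq; lra.
    have := lt_0_INR _ (elimT ltP N0); have := lt_0_INR _ (elimT ltP m0).
    have := le_INR _ _ (elimT leP Nl); have := le_INR _ _ (elimT leP ml).
    by rewrite ltnS in ml; have := le_INR _ _ (elimT leP ml); move=> *; apply: Rabs_def1; lra.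
  split; first by apply: Rdiv_lt_0_compat; lra.
  by apply: (Rmult_lt_reg_r (INR l)) => //; rewrite /Rdiv Rmult_assoc Rinv_l; lra.
- have -> : INR l * ((INR N - INR m) / INR l) = IZR (Z.of_nat N - Z.of_nat m).
    by rewrite minus_IZR -!INR_IZR_INZ; field; lra.
  exact: om_int.
Qed.

Theorem trig_ext_nat_mean :
  (\big[Cplus/RtoC 0]_(0 <= n < l) trig_ext A (INR n) = INR l * fourier_coef A 0)%C.
Proof.
have lp := INR_exponent_pos.
have ln : RtoC (INR l) <> 0 by move=> e; have := RtoC_inj _ _ e; lra.
(* The range 0 <= n < l is moved to 1 <= n <= l, where the interpolation counts homomorphisms. *)
rewrite -(@sum_period l 1) => [|i]; last by rewrite -plusE plus_INR trig_ext_period.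
rewrite add1n fourier_coefE Cmult_assoc Cinv_r // Cmult_1_l.
apply: eq_big_nat => n /andP [n0 _]; rewrite trig_ext_nat //.
by rewrite Rmult_0_l /Rdiv Rmult_0_l Ropp_0 om_0 Cmult_1_r.
Qed.

End Trig.
End Fourier.

(** * The mean of the interpolation over real arguments *)

Section TrigIntegral.
Local Open Scope R_scope.
Variable A : finGroupType.
Let l := exponent [set: A]%g.
Let lpos : (0 < l)%nat := exponent_gt0 [set: A]%g.

Lemma Rder_om (a z : R) : Rder (fun z => om (a * z)) z (Ci * RtoC (2 * PI * a) * om (a * z))%C.
Proof.
have D : Rder (fun z => Ci * RtoC (2 * PI * a) * z)%C z (Ci * RtoC (2 * PI * a))%C.
  apply: (Rder_eq (Rder_mult (Rder_const _ z) (Rder_real (is_derive_id z)))).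
  by rewrite /one /=; ring.
have E x : (Ci * RtoC (2 * PI * a) * RtoC x)%C = (Ci * RtoC (2 * PI * (a * x)))%C.
  by rewrite -Cmult_assoc -RtoC_mult !Rmult_assoc.
apply: (Rder_ext (f := fun z => Cexp (Ci * RtoC (2 * PI * a) * z)%C)) => [x|].
  by rewrite E.
by rewrite /om -E; exact: Rder_Cexp.
Qed.

Lemma Rcont_om (a z : R) : Rcont (fun z => om (a * z)) z.
Proof. exact: Rder_cont (Rder_om a z). Qed.

Let freq_arg i z : IZR (freq A i) * z / INR l = IZR (freq A i) / INR l * z.
Proof. by rewrite /Rdiv; ring. Qed.

Lemma Rcont_trig_ext z : Rcont (trig_ext A) z.
Proof.
apply: (Rcont_ext (fun x => esym (trig_extE A x))).
apply: Rcont_plus.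
  apply: Rcont_sum => i; apply: Rcont_mult; first exact: Rcont_const.
  by apply: (Rcont_ext _ (Rcont_om (IZR (freq A i) / INR l) z)) => x; rewrite freq_arg.
case: (odd _); first exact: Rcont_const.
apply: Rcont_mult; first exact: Rcont_const.
apply: Rcont_real; apply: continuous_comp; last exact: continuous_cos.
by apply: (continuous_scal_r (V := R_NormedModule)); exact: continuous_id.
Qed.

(** The index [i = l] is the frequency 0, whose primitive is linear. The other primitives have
    period l and contribute nothing over a period. *)
Let primitive (i : nat) (z : R) : C :=
  if i == l then (fourier_coef A 0 * z)%C else
  (fourier_coef A (freq A i) / (Ci * RtoC (2 * PI * (IZR (freq A i) / INR l))) *
    om (IZR (freq A i) / INR l * z))%C.

Let Rder_primitive i z : Rder (primitive i) z (fourier_coef A (freq A i) * om (IZR (freq A i) * z / INR l))%C.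
Proof.
have lp : 0 < INR l := INR_exponent_pos A.
rewrite /primitive; case: eqP => [->|il].
  have -> : freq A l = 0%Z by rewrite /freq -/l; lia.
  rewrite Rmult_0_l /Rdiv Rmult_0_l om_0.
  apply: (Rder_eq (Rder_mult (Rder_const _ z) (Rder_real (is_derive_id z)))).
  by rewrite /one /=; ring.
rewrite freq_arg; apply: (Rder_eq (Rder_mult (Rder_const _ z) (Rder_om _ z))).
have k0 : IZR (freq A i) / INR l <> 0.
  apply: Rmult_integral_contrapositive; split; last by apply: Rinv_neq_0_compat; lra.
  by apply: not_0_IZR; rewrite /freq -/l; lia.
have p0 := PI_RGT_0.
have n1 : RtoC (2 * PI * (IZR (freq A i) / INR l)) <> 0.
  move=> e; have := RtoC_inj _ _ e; apply: Rmult_integral_contrapositive; split => //; lra.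
have n2 : Ci <> 0 by move=> [] e; lra.
by field.
Qed.

Theorem trig_ext_integral_mean :
  (\big[Cplus/RtoC 0]_(0 <= n < l) Cint (fun t => trig_ext A (t + INR n)) 0 1 =
   INR l * fourier_coef A 0)%C.
Proof.
have lp : 0 < INR l := INR_exponent_pos A; have p0 := PI_RGT_0.
pose tail z := if odd l then RtoC 0 else (fourier_coef A (Z.of_nat l./2) * (/ PI * sin (PI * z))%R)%C.
pose P z := (\big[Cplus/RtoC 0]_(0 <= i < l.*2.+1 | small_freq A i) primitive i z + tail z)%C.
have DP z : Rder P z (trig_ext A z).
  rewrite trig_extE -/l; apply: Rder_plus.
    elim: (index_iota _ _) => [|i r IH].
      rewrite big_nil; apply: (Rder_ext (f := fun _ => RtoC 0)) => [x|]; first by rewrite big_nil.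
      exact: Rder_const.
    rewrite big_cons; case: (boolP (small_freq A i)) => si.
    - by apply: (Rder_ext _ (Rder_plus (Rder_primitive i z) IH)) => x; rewrite big_cons si.
    - by apply: (Rder_ext _ IH) => x; rewrite big_cons (negbTE si).
  rewrite /tail; case: (odd l); first exact: Rder_const.
  have D : is_derive (fun z => / PI * sin (PI * z)) z (cos (PI * z)).
    have := is_derive_scal _ z (/ PI) _ (@is_derive_comp R_AbsRing R_NormedModule sin (fun z => PI * z) z _ _
      (is_derive_sin (PI * z)) (is_derive_scal (fun z => z) z PI 1 (is_derive_id z))).
    by rewrite /scal /= /mult /= Rmult_1_r -Rmult_assoc Rinv_l ?Rmult_1_l //; lra.
  apply: (Rder_eq (Rder_mult (Rder_const _ z) (Rder_real D))).
  by ring.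
have E n : Cint (fun t => trig_ext A (t + INR n)) 0 1 = (P (INR n.+1) - P (INR n))%C.
  rewrite (@Cint_derive (fun t => P (t + INR n))); first by rewrite Rplus_0_l S_INR Rplus_comm.
  - by lra.
  - move=> t _; have Dt : is_derive (fun t => t + INR n) t 1.
      have := @is_derive_plus R_AbsRing R_NormedModule (fun t => t) (fun _ => INR n) t 1 0 (is_derive_id t) (is_derive_const _ t).
      by rewrite /plus /= Rplus_0_r.
    by apply: (Rder_eq (Rder_comp (DP _) Dt)); rewrite Cmult_1_l.
  - move=> t _; apply: (Rcont_comp (Rcont_trig_ext _)).
    by apply: (continuous_plus (V := R_NormedModule)); [exact: continuous_id | exact: continuous_const].
rewrite (eq_bigr _ (fun n _ => E n)).
have T N : \big[Cplus/RtoC 0]_(0 <= n < N) (P (INR n.+1) - P (INR n))%C = (P (INR N) - P 0)%C.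
  elim: N => [|N IH]; first by rewrite big_geq // (_ : INR 0 = 0) //; ring.
  by rewrite Csum_recr IH; ring.
rewrite T /P.
(* The cosine term has integral 0 over a period, since sin (PI l) = 0. *)
have -> : tail (INR l) = tail 0.
  rewrite /tail; case: (boolP (odd l)) => // _; congr (_ * RtoC (_ * _))%C.
  by rewrite Rmult_0_r sin_0; apply: sin_eq_0_1; exists (Z.of_nat l); rewrite -INR_IZR_INZ Rmult_comm.
have -> : \big[Cplus/RtoC 0]_(0 <= i < l.*2.+1 | small_freq A i) primitive i (INR l) =
  (\big[Cplus/RtoC 0]_(0 <= i < l.*2.+1 | small_freq A i) primitive i 0%R + INR l * fourier_coef A 0)%C.
  rewrite -big_filter -[in RHS]big_filter.
  set r := [seq i <- index_iota 0 l.*2.+1 | small_freq A i].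
  have lr : l \in r.
    by rewrite mem_filter mem_index_iota small_freqE -/l; have := lpos; lia.
  have ur : uniq r by rewrite filter_uniq // iota_uniq.
  rewrite (bigD1_seq l) //= [in RHS](bigD1_seq l) //=.
  have -> : primitive l (INR l) = (primitive l 0 + INR l * fourier_coef A 0)%C.
    by rewrite /primitive eqxx; ring.
  have -> : \big[Cplus/RtoC 0]_(i <- r | i != l) primitive i (INR l) =
     \big[Cplus/RtoC 0]_(i <- r | i != l) primitive i 0.
    apply: eq_bigr => i /negbTE il; rewrite /primitive il; congr Cmult.
    by rewrite Rmult_0_r om_0 /Rdiv Rmult_assoc Rinv_l ?Rmult_1_r ?om_int //; lra.
  by ring.
by ring.
Qed.

End TrigIntegral.

(** * Points of a Noetherian F_1-scheme *)

Section Scheme.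

Lemma mul0_unit (M : monoid0) (x y : M) : unit0 (mul0 x y) <-> unit0 x /\ unit0 y.
Proof.
split=> [[z Hz]|[[x' Hx] [y' Hy]]].
- split; first by exists (mul0 y z); rewrite mul0A.
  by exists (mul0 x z); rewrite mul0A [mul0 y x]mul0C.
- exists (mul0 x' y'); rewrite mul0A -[mul0 (mul0 x y) x']mul0A [mul0 y x']mul0C mul0A Hx.
  by rewrite mul01.
Qed.

Lemma zero0_nonunit (M : monoid0) : (one0 : M) <> zero0 -> ~ unit0 (zero0 : M).
Proof. by move=> H [y]; rewrite mul00 => E; apply: H. Qed.

Lemma prime_big (M : monoid0) (P : set M) (I : Type) (g : I -> M) (t : seq I) :
  prime_ideal0 P -> P (\big[@mul0 M/one0]_(i <- t) g i) <-> exists i, List.In i t /\ P (g i).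
Proof.
move=> [P0 P1 PM PP]; elim: t => [|i t IH].
  by rewrite big_nil; split => [/P1|[i [] []]].
rewrite big_cons; split.
- by move=> /PP [Hi|/IH [j [Hj Pj]]]; [exists i; split => //; left | exists j; split => //; right].
- move=> [j [[<-|Hj] Pj]]; first by rewrite mul0C; exact: PM.
  by apply: PM; apply/IH; exists j.
Qed.

(** By [prime_big] a prime ideal is determined by the generators that it contains, so a chart on j
    generators has at most 2 ^ j points. *)
Lemma noetherian_finite (X : monoidal_space) : noetherian_F1_scheme X ->
  finite_set [set: X]%classic.
Proof.
move=> [k [U [cov ch]]].
have -> : [set: X]%classic = (\bigcup_(i in [set: 'I_k]) U i)%classic.
  by apply/seteqP; split => p _ //; have [i Hi] := cov p; exists i.
apply: bigcup_finite => [|i _]; first exact: finite_finset.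
have [M [phi [e [[j [g Hg]] C]]]] := ch i.
pose f (p : X) : {ffun 'I_j -> bool} := [ffun i => `[< e p (g i) >]].
have inj : {in U i &, injective f}.
  move=> p q /set_mem Up /set_mem Uq E; apply: (chart_inj C Up Uq).
  apply/seteqP; split => x; have [t ->] := Hg x; move=> /(prime_big _ _ _).
  - move=> /(_ (chart_prime C Up)) [a [Ha Pa]]; apply/(prime_big _ _ (chart_prime C Uq)).
    exists a; split => //; move/ffunP: E => /(_ a); rewrite !ffunE => E.
    by apply/asboolP; rewrite -E; apply/asboolP.
  - move=> /(_ (chart_prime C Uq)) [a [Ha Pa]]; apply/(prime_big _ _ (chart_prime C Up)).
    exists a; split => //; move/ffunP: E => /(_ a); rewrite !ffunE => E.
    by apply/asboolP; rewrite E; apply/asboolP.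
by rewrite -(eq_finite_set (inj_card_eq inj)); exact: finite_finset.
Qed.

Lemma pow0_prime (M : monoid0) (P : set M) (x : M) k : prime_ideal0 P -> P (pow0 x k) -> P x.
Proof.
move=> [_ P1 _ PP]; elim: k => [|k IH] //=.
by rewrite /pow0 /= => /PP [].
Qed.

(** If 1 = 0 in the stalk, then 1 = 0 already on some D(f) containing p, so a power of f is 0 in M
    and f lies in the prime ideal of p, a contradiction. Hence 0 is not a unit, as extension of
    morphisms by zero demands. *)
Lemma stalk_nontrivial (X : monoidal_space) (p : X) (S : stalk p) :
  noetherian_F1_scheme X -> (one0 : S) <> zero0.
Proof.
move=> [k [U [cov ch]]] E.
have [i Ui] := cov p; have [M [phi [e [_ C]]]] := ch i.
have oU := chart_open C.
have [g1 g0 _] := germ_hom S oU Ui.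
have [V [oV Vp VU rE]] : exists V, [/\ topology_structure.open V, V p, (V `<=` U i)%classic &
   res V (one0 : sec (U i)) = res V (zero0 : sec (U i))].
  by apply: (@germ_eq X p S (U i) one0 zero0 oU Ui); rewrite g1 g0.
have [f [_ fp] fV] := (chart_top C VU).1 oV p Vp.
have oD : topology_structure.open (chart_basic (U i) e f).
  apply/(chart_top C) => [q [] //|q Dq]; exists f => //.
have fU : (chart_basic (U i) e f `<=` U i)%classic by move=> q [].
have [p1 p0 _] := chart_hom C.
have : res (chart_basic (U i) e f) (phi one0) = res (chart_basic (U i) e f) (phi zero0).
  by rewrite p1 p0 -(res_comp one0 oU oV oD VU fV) rE res_comp.
move=> /(chart_eq C) [j].
rewrite mul0C mul01 [mul0 _ zero0]mul0C mul00 => pz.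
apply: fp; have [P0 _ _ _] := chart_prime C Ui.
by apply: (pow0_prime (chart_prime C Ui) (k := j)); rewrite pz.
Qed.

End Scheme.

(** * Local morphisms from a stalk to F_{1^m} *)

Section LocalHoms.
Variables (M : monoid0) (n : nat) (ms : seq nat) (m : nat).
Hypothesis M10 : (one0 : M) <> zero0.
Hypothesis hM : units_decomp M n ms.
Import GRing.Theory.
Local Open Scope ring_scope.

Definition local_hom (f : M -> F1m m) : Prop := is_hom0 f /\ forall a, unit0 (f a) -> unit0 a.

Lemma F1m_unit (x : F1m m) : unit0 x <-> exists c, x = Some c.
Proof.
split=> [[y]|[c ->]]; first by case: x => [c|] // _; exists c.
by exists (Some (c^-1)%g : F1m m); rewrite /= mulgV.
Qed.

Let Zm : zmodType := 'I_m.-1.+1.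

Definition chom (c : {ffun 'I_n -> cyc m}) (u : 'rV[int]_n) : cyc m :=
  \sum_j (c j : Zm) *~ (u 0 j).

Lemma chomD c u v : chom c (u + v) = (chom c u * chom c v)%g.
Proof.
rewrite /chom -[RHS]/((_ : Zm) + (_ : Zm)) -big_split; apply: eq_bigr => j _.
by rewrite mxE mulrzDr.
Qed.

Lemma chom0 c : chom c 0 = 1%g.
Proof. by rewrite /chom big1 // => j _; rewrite mxE mulr0z. Qed.

Lemma chom_delta c j : chom c (delta_mx 0 j) = c j.
Proof.
rewrite /chom (bigD1 j) //= mxE !eqxx mulr1z big1 ?addr0 // => i ij.
by rewrite mxE eqxx (negbTE ij) mulr0z.
Qed.

Lemma chomE (F : 'rV[int]_n -> cyc m) : (forall u v, F (u + v) = (F u * F v)%g) ->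
  forall u, F u = chom [ffun j => F (delta_mx 0 j)] u.
Proof.
move=> FD u; pose G : 'rV[int]_n -> Zm := F.
have GD a b : G (a + b) = G a + G b by exact: FD.
have G0 : G 0 = 0 by apply: (addrI (G 0)); rewrite -GD !addr0.
have GN a : G (- a) = - G a by apply: (addrI (G a)); rewrite -GD !subrr.
have GMn a k : G (a *+ k) = G a *+ k.
  by elim: k => [|k IH]; rewrite ?mulr0n // !mulrS GD IH.
have GMz a (z : int) : G (a *~ z) = G a *~ z.
  by case: z => k; rewrite /intmul ?GN GMn.
rewrite -[LHS]/(G u) {1}[u]row_sum_delta (big_morph G GD G0); apply: eq_bigr => j _.
by rewrite -{1}[u 0 j]intz scaler_int GMz ffunE.
Qed.

(** A local morphism sends nonunits to [None], the only nonunit of F_{1^m}, and restricts to a group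
    homomorphism on units. Conversely, such a homomorphism extends by [None]; this is multiplicative
    because a product is a unit only if both factors are. *)
Lemma local_homs_param :
  exists phi : {ffun 'I_n -> cyc m} * {f : {ffun cyc_prod ms -> cyc m} | f \in homs _ _} -> M -> F1m m,
    injective phi /\ forall f, local_hom f <-> exists x, phi x = f.
Proof.
have [_ [theta [thM thI thU]]] := hM.
have thunit u g : unit0 (theta u g) by apply/thU; exists u, g.
(* The image of the neutral pair is an idempotent unit. *)
have th1 : theta 0 1%g = one0.
  have [y Hy] := thunit 0 1%g.
  have E : mul0 (theta 0 1%g) (theta 0 1%g) = theta 0 1%g by rewrite -thM addr0 mulg1.
  by rewrite -Hy -{2}E -mul0A Hy mul0C mul01.
(* The preimage under [theta] is picked by choice; injectivity of [theta] makes it unique, which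
   gives [phiS]. *)
pose phi (x : {ffun 'I_n -> cyc m} * {f : {ffun cyc_prod ms -> cyc m} | f \in homs _ _}) (a : M) : F1m m :=
  if pselect (exists ug, theta ug.1 ug.2 = a) is left H then
    let ug := sval (cid H) in Some (chom x.1 ug.1 * (val x.2) ug.2)%g
  else None.
have phiS x u g : phi x (theta u g) = Some (chom x.1 u * (val x.2) g)%g.
  rewrite /phi; case: pselect => [H|]; last by case; exists (u, g).
  by case: (cid H) => -[u' g'] /= /thI [-> ->].
have phiN x a : ~ unit0 a -> phi x a = None.
  move=> na; rewrite /phi; case: pselect => // H; exfalso.
  by apply: na; apply/thU; case: H => -[u g] /= <-; exists u, g.
exists phi; split.
  move=> [c h] [c' h'] E; congr pair.
  - apply/ffunP => j; have := congr1 (fun f => f (theta (delta_mx 0 j) 1%g)) E.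
    by rewrite /= !phiS /= !chom_delta (hom1 (svalP h)) (hom1 (svalP h')) !mulg1 => -[].
  - apply/val_inj/ffunP => g; have := congr1 (fun f => f (theta 0 g)) E.
    by rewrite /= !phiS /= !chom0 !mul1g => -[].
move=> f; split.
- move=> [[f1 f0 fM] floc].
  (* The default is never taken: [theta u g] is a unit, so its image is a unit and differs from
     [None]. *)
  pose H u g : cyc m := odflt 1%g (f (theta u g)).
  have fS u g : f (theta u g) = Some (H u g).
    rewrite /H; have [y Hy] := thunit u g.
    have : mul0 (f (theta u g)) (f y) = one0 by rewrite -fM Hy.
    by case: (f (theta u g)).
  have HM u v g h : H (u + v) (g * h)%g = (H u g * H v h)%g.
    by have := fS (u + v) (g * h)%g; rewrite thM fM !fS => -[].
  pose h : {ffun cyc_prod ms -> cyc m} := [ffun g => H 0 g].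
  have hh : h \in homs _ _ by apply/homsP => x y; rewrite !ffunE -HM addr0.
  pose c : {ffun 'I_n -> cyc m} := [ffun j => H (delta_mx 0 j) 1%g].
  exists (c, exist _ h hh); apply: funext => a.
  case: (pselect (unit0 a)) => [ua|na].
  + have /thU [u [g <-]] := ua; rewrite phiS fS; congr Some.
    rewrite /= ffunE /c -(chomE (F := fun u => H u 1%g)); last by move=> v w; rewrite -HM mulg1.
    by rewrite -HM addr0 mul1g.
  + rewrite phiN //; case E: (f a) => [d|] //; exfalso; apply: na; apply: floc.
    by apply/F1m_unit; exists d.
- move=> [x <-]; have hx := homsP _ (svalP x.2); have hx' := svalP x.2.
  split; last first.
    move=> a /F1m_unit [d Hd]; case: (pselect (unit0 a)) => // na.
    by rewrite phiN in Hd.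
  split.
  + by rewrite -th1 phiS chom0 (hom1 hx') mulg1.
  + by rewrite phiN //; exact: zero0_nonunit.
  + move=> a b; case: (pselect (unit0 a)) => [ua|na]; last first.
      rewrite (phiN _ a) // phiN //; by move=> /mul0_unit [].
    case: (pselect (unit0 b)) => [ub|nb]; last first.
      by rewrite (phiN _ b) // phiN; [case: (phi x a) | move=> /mul0_unit []].
    have /thU [u [g <-]] := ua; have /thU [v [h <-]] := ub.
    rewrite -thM !phiS chomD hx /=; congr Some.
    by rewrite -!mulgA; congr (_ * _)%g; rewrite !mulgA [(chom _ v * _)%g]cyc_mulC.
Qed.

End LocalHoms.

(** * The number of F_{1^m}-points *)

Section Counting.
Variables (X : monoidal_space) (hX : noetherian_F1_scheme X).
Variables (O : forall p : X, stalk p) (n : X -> nat) (ms : X -> seq nat).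
Hypothesis hO : forall p : X, units_decomp (O p) (n p) (ms p).

Lemma mem_points (p : X) : p \in points X.
Proof. by rewrite /points in_fset_set ?inE //; exact: noetherian_finite. Qed.

Lemma ncard_eq (T : Type) (A : set T) k : (A #= `I_k)%card -> ncard A = k.
Proof.
move=> Ak; rewrite /ncard; apply: xget_unique => // j Aj.
by apply/card_eq_II; apply: card_eq_trans Ak; rewrite card_eq_sym.
Qed.

(** The points above p are parametrized by [local_homs_param]; the factor m ^ n(p) counts the images
    of a basis of Z^n(p). *)
Theorem num_pointsE m : (0 < m)%nat ->
  num_points O m = \sum_(p <- points X) expn m (n p) * nhom (cyc_prod (ms p)) (cyc m).
Proof.
move=> m0.
pose T_ (p : X) : finType := ({ffun 'I_(n p) -> cyc m} *
  {f : {ffun cyc_prod (ms p) -> cyc m} | f \in homs _ _})%type.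
have par p := local_homs_param m (@stalk_nontrivial X p (O p) hX) (hO p).
pose phi p : T_ p -> O p -> F1m m := sval (cid (par p)).
have phi_inj p : injective (@phi p) by case: (svalP (cid (par p))).
have phiP p f : local_hom f <-> exists x, @phi p x = f by case: (svalP (cid (par p))) => _.
pose psi (t : {p : points X & T_ (val p)}) : {p : X & O p -> F1m m} :=
  existT (fun p => O p -> F1m m) (val (tag t)) (@phi (val (tag t)) (tagged t)).
have psi_inj : injective psi.
  move=> [p x] [q y] E; have pq : p = q by apply/val_inj; exact: (congr1 (@projT1 _ _) E).
  subst q; congr existT; apply: phi_inj.
  by have := projT2_eq E; rewrite (Prop_irrelevance (projT1_eq E) erefl).
have im : F1m_points O m = [set psi x | x in [set: {p : points X & T_ (val p)}]]%classic.
  apply/seteqP; split.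
  - move=> [p f] /= /phiP [x xf].
    by exists (existT (fun p : points X => T_ (val p)) [` mem_points p]%fset x) => //; rewrite /psi /= xf.
  - move=> _ [[p x] _ <-]; rewrite /F1m_points /psi /=.
    by apply/phiP; exists x.
rewrite /num_points (@ncard_eq _ _ #|{: {p : points X & T_ (val p)}}|).
  rewrite card_tagged sumnE big_map big_enum /= big_seq_fsetE /=; apply: eq_bigr => p _.
  rewrite card_prod card_ffun !card_ord card_sig prednK //.
rewrite im; apply: (card_eq_trans (inj_card_eq _)); first by move=> x y _ _; exact: psi_inj.
have er : {in [set: {p : points X & T_ (val p)}]%classic &, injective enum_rank}.
  by move=> x y _ _; exact: enum_rank_inj.
rewrite card_eq_sym; apply: (card_eq_trans card_II).
have -> : [set: 'I_#|{: {p : points X & T_ (val p)}}|]%classic =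
    [set enum_rank x | x in [set: {p : points X & T_ (val p)}]]%classic.
  by apply/seteqP; split => // i _; exists (enum_val i) => //; exact: enum_valK.
exact: inj_card_eq.
Qed.

End Counting.

(** * Logarithmic derivatives of the zeta functions *)

Section Assembly.
Local Open Scope R_scope.

Lemma torsion_period (A : finGroupType) m : torsion A (m + exponent [set: A]%g)%nat = torsion A m.
Proof.
congr #|pred_of_set _|; apply/setP => a; rewrite !inE expgD.
by rewrite (@expg_exponent _ a [set: A]%g) ?inE // mulg1.
Qed.

Lemma nhom_cyc_prod_period ns m : all (leq 1) ns -> (0 < m)%nat ->
  nhom (cyc_prod ns) (cyc (m + exponent [set: cyc_prod ns]%g)) = nhom (cyc_prod ns) (cyc m).
Proof.
move=> Hns m0; have m1 : (0 < m + exponent [set: cyc_prod ns]%g)%nat by rewrite addn_gt0 m0.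
by rewrite !nhom_cyc_prod // -!torsion_cyc_prod // torsion_period.
Qed.

(** At frequency 0 all exponentials are 1, so the coefficient is the mean of the torsion counts over
    m = 1, ..., l. *)
Lemma fourier_coef0 ns : all (leq 1) ns -> fourier_coef (cyc_prod ns) 0 = RtoC (mu (cyc_prod ns)).
Proof.
move=> Hns; have l0 := exponent_gt0 [set: cyc_prod ns]%g.
have lp := INR_exponent_pos (cyc_prod ns).
rewrite fourier_coefE (mu_torsion l0); last first.
  by move=> a; rewrite (@expg_exponent _ a [set: cyc_prod ns]%g) ?inE.
rewrite RtoC_mult RtoC_inv; last by apply: Rgt_not_eq; exact: lp.
congr Cmult; rewrite INR_sum (big_morph RtoC RtoC_plus erefl).
rewrite big_nat_cond [RHS]big_nat_cond; apply: eq_bigr => m; rewrite andbT => /andP [m0 _].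
by rewrite nhom_cyc_prod // torsion_cyc_prod // Rmult_0_l /Rdiv Rmult_0_l Ropp_0 om_0 Cmult_1_r.
Qed.

(** Piece n covers n + 1 <= u <= n + 2, where u - 1 = t + n. *)
Definition trig_family (ns : seq nat) (n : nat) (t : R) : C :=
  trig_ext (cyc_prod ns) (t + INR n).

Lemma Rcont_trig_family ns n t : Rcont (trig_family ns n) t.
Proof.
apply: (@Rcont_comp (trig_ext (cyc_prod ns)) (fun t => t + INR n) t (Rcont_trig_ext _ _)).
by apply: (continuous_plus (V := R_NormedModule)); [exact: continuous_id | exact: continuous_const].
Qed.

Lemma trig_continuation ns : all (leq 1) ns ->
  exists EI ED : C -> C, [/\ forall w, C1at EI w, forall w, C1at ED w,
    forall w, 1 < Re w -> Csum (piece (trig_family ns) w) (mu (cyc_prod ns) / (w - 1) + EI w)%C &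
    forall w, 1 < Re w -> Csum (fun n => trig_ext (cyc_prod ns) (INR n) * npow (INR n.+1) w)%C
      (mu (cyc_prod ns) / (w - 1) + ED w)%C].
Proof.
move=> Hns; set l := exponent [set: cyc_prod ns]%g.
have l0 : (0 < l)%nat := exponent_gt0 [set: cyc_prod ns]%g.
have Np m : (0 < m)%nat -> _ := @nhom_cyc_prod_period ns m Hns.
have Pf : periodic_family l (trig_family ns).
  split => // [n t|n t]; first exact: Rcont_trig_family.
  by rewrite /trig_family -plusE plus_INR -Rplus_assoc trig_ext_period.
have [EI [I1 I2]] := periodic_continuation Pf (trig_ext_integral_mean (cyc_prod ns)).
have Pc n : trig_ext (cyc_prod ns) (INR (n + l)%nat) = trig_ext (cyc_prod ns) (INR n).
  by rewrite -plusE plus_INR trig_ext_period.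
have [ED [D1 D2]] := @dirichlet_continuation l (fun n => trig_ext (cyc_prod ns) (INR n)) _ l0 Pc
  (trig_ext_nat_mean Np).
by exists EI, ED; rewrite -fourier_coef0.
Qed.

Definition binom_coef (k j : nat) : R := INR 'C(k, j) * (-1) ^ (k - j).

Lemma pow_sub1 k (u : R) :
  (u - 1) ^ k = \big[Rplus/IZR 0]_(0 <= j < k.+1) (binom_coef k j * u ^ j).
Proof.
elim: k => [|k IH]; first by rewrite big_nat1 /binom_coef bin0 /=; ring.
(* This zero term makes both sums in Pascal's rule run over the same range. *)
have Z : binom_coef k k.+1 = 0 by rewrite /binom_coef bin_small //= Rmult_0_l.
have B0 : binom_coef k.+1 0 = - binom_coef k 0.
  by rewrite /binom_coef !bin0 !subn0 /=; ring.
have BS j : (j <= k)%nat -> binom_coef k.+1 j.+1 = - binom_coef k j.+1 + binom_coef k j.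
  rewrite /binom_coef binS -plusE plus_INR subSS leq_eqVlt => /orP [/eqP ->|jk].
    by rewrite bin_small //= subnn /=; ring.
  by rewrite -(subnSK jk) /=; ring.
rewrite big_nat_recl // B0.
have -> : \big[Rplus/IZR 0]_(0 <= j < k.+1) (binom_coef k.+1 j.+1 * u ^ j.+1) =
   \big[Rplus/IZR 0]_(0 <= j < k.+1) (- (binom_coef k j.+1 * u ^ j.+1)) +
   \big[Rplus/IZR 0]_(0 <= j < k.+1) (u * (binom_coef k j * u ^ j)).
  rewrite -big_split /=; apply: eq_big_nat => j /andP [_ jk].
  by rewrite BS //=; ring.
have M (c : R) (f : nat -> R) m : \big[Rplus/IZR 0]_(0 <= j < m) (c * f j) =
    c * \big[Rplus/IZR 0]_(0 <= j < m) f j.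
  by apply: esym; apply: (big_morph (Rmult c)) => [x y|]; ring.
have -> : \big[Rplus/IZR 0]_(0 <= j < k.+1) (- (binom_coef k j.+1 * u ^ j.+1)) =
   -1 * \big[Rplus/IZR 0]_(0 <= j < k.+1) (binom_coef k j.+1 * u ^ j.+1).
  by rewrite -M; apply: eq_bigr => j _; ring.
rewrite M -IH.
have E : (u - 1) ^ k = binom_coef k 0 * u ^ 0 + \big[Rplus/IZR 0]_(0 <= j < k.+1) (binom_coef k j.+1 * u ^ j.+1).
  have := big_nat_recl k.+1 0 (fun j => binom_coef k j * u ^ j) (leq0n _) => /= <-.
  by rewrite big_nat_recr //= Z -IH Rmult_0_l Rplus_0_r.
by rewrite /= in E *; rewrite E; lra.
Qed.

Lemma zeta_exponentE k j : zeta_exponent k j = - binom_coef k j.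
Proof. by []. Qed.

Lemma pow_npow k (u : R) (s : C) : 0 < u ->
  (((u - 1) ^ k)%R * npow u (s + 1))%C =
    \big[Cplus/RtoC 0]_(j < k.+1) (binom_coef k j * npow u (s - INR j + 1))%C.
Proof.
move=> u0; rewrite pow_sub1 (big_morph RtoC RtoC_plus erefl).
rewrite -(big_mkord xpredT (fun j => binom_coef k j * npow u (s - INR j + 1))%C).
rewrite Cmult_comm big_Cmult_r; apply: eq_bigr => j _.
have -> : npow u (s + 1) = (npow u (s - INR j + 1) * npow u (INR j))%C.
  by rewrite -npow_add; congr npow; ring.
rewrite RtoC_mult npow_INR // RtoC_inv; last by have := pow_lt u j u0; lra.
field => E; have := RtoC_inj _ _ E; have := pow_lt u j u0; lra.
Qed.

(** Letting the upper bound run through integers only turns the improper integral into a sum of unit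
    pieces. *)
Lemma Csum_is_RInt_gen (f : R -> C) (v : C) : (forall u, 1 <= u -> Rcont f u) ->
  @is_RInt_gen C_R_NormedModule f (at_point (IZR 1)) (Rbar_locally p_infty) v ->
  Csum (fun n => Cint (fun t => f (t + INR n.+1)) 0 1) v.
Proof.
move=> Hf H.
have S N : \big[Cplus/RtoC 0]_(0 <= n < N) Cint (fun t => f (t + INR n.+1)) 0 1 = Cint f 1 (INR N.+1).
  elim: N => [|N IH]; first by rewrite big_geq // Cint_point.
  have n1 := INR_succ_ge1 N.
  rewrite Csum_recr IH.
  have -> : Cint (fun t => f (t + INR N.+1)) 0 1 = Cint f (INR N.+1) (INR N.+2).
    have := @Cint_shift f (INR N.+1) (INR N.+2) (INR N.+1).
    have -> : INR N.+1 - INR N.+1 = 0 by ring.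
    have -> : INR N.+2 - INR N.+1 = 1 by rewrite (S_INR N.+1); ring.
    by apply => [|t Ht]; [rewrite (S_INR N.+1); lra | apply: Hf; lra].
  by apply: Cint_Chasles => // [|t Ht]; [rewrite (S_INR N.+1); lra | apply: Hf; lra].
move=> eps e0.
have e2 : 0 < eps / 2 by lra.
have [Q P HQ [M HM] HI] := H _ (locally_ball v (mkposreal _ e2)).
have [N HN] := INR_unbounded M.
exists N => n /leP /le_INR Hn; rewrite S.
have [|I [isI [B1 B2]]] := HI 1 (INR n.+1) HQ.
  by apply: HM; rewrite S_INR; lra.
have -> : Cint f 1 (INR n.+1) = I.
  apply: C_ext; apply: is_RInt_unique.
  - exact: (is_RInt_fct_extend_fst (U := R_NormedModule) (V := R_NormedModule) f 1 (INR n.+1) I isI).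
  - exact: (is_RInt_fct_extend_snd (U := R_NormedModule) (V := R_NormedModule) f 1 (INR n.+1) I isI).
apply: (Rle_trans _ _ _ (Cmod_le_Re_Im _)).
have b1 : Rabs (Re I - Re v) < eps / 2 := B1.
have b2 : Rabs (Im I - Im v) < eps / 2 := B2.
by rewrite re_plus re_opp im_plus im_opp; rewrite /Rminus in b1 b2; lra.
Qed.

Lemma Cderive_inv (f : C -> C) (z df : C) : is_Cderive f z df -> f z <> 0 ->
  is_Cderive (fun x => / f x)%C z (- df / (f z * f z))%C.
Proof.
move=> Hf; have D0 (a : C) : a <> 0 -> is_Cderive Cinv a (- / (a * a))%C.
  move=> a0; have M0 := Cmod_pos a0; apply/is_CderiveE => eps e0.
  have q0 : 0 < eps * Cmod a ^ 3 / 2.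
    by apply: Rdiv_lt_0_compat; [apply: Rmult_lt_0_compat => //; exact: pow_lt | lra].
  exists (Rmin (Cmod a / 2) (eps * Cmod a ^ 3 / 2)); split; first by apply: Rmin_pos; lra.
  move=> h Hh; have h0 := Cmod_ge_0 h.
  have h1 := Rlt_le_trans _ _ _ Hh (Rmin_l _ _).
  have h2 := Rlt_le_trans _ _ _ Hh (Rmin_r _ _).
  have ah : Cmod a / 2 <= Cmod (a + h)%C.
    have := Cmod_triangle (a + h)%C (- h)%C; rewrite Cmod_opp.
    have -> : (a + h + - h = a)%C by ring.
    by lra.
  have n1 : (a + h)%C <> 0 by move=> E; rewrite E Cmod_0 in ah; lra.
  have -> : (/ (a + h) - / a - h * - / (a * a) = h * h * / (a * a * (a + h)))%C by field.
  rewrite !Cmod_mult Cmod_inv; last by do ![apply: Cmult_neq_0 => //].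
  rewrite !Cmod_mult Rmult_assoc [X in _ <= X]Rmult_comm; apply: Rmult_le_compat_l => //.
  have P : 0 < Cmod a * Cmod a * Cmod (a + h)%C.
    by do ![apply: Rmult_lt_0_compat => //]; lra.
  apply: (Rmult_le_reg_r _ _ _ P); rewrite Rmult_assoc Rinv_l; last lra.
  rewrite Rmult_1_r; apply: (Rle_trans _ (eps * (Cmod a * Cmod a * (Cmod a / 2)))).
    have -> : eps * (Cmod a * Cmod a * (Cmod a / 2)) = eps * Cmod a ^ 3 / 2 by field.
    by lra.
  by apply: Rmult_le_compat_l; [lra | apply: Rmult_le_compat_l; nra].
move=> f0; apply: (Cderive_eq (Cderive_comp (D0 _ f0) Hf)).
by field.
Qed.

(** f / g * exp (- H) has derivative 0, hence is constant along segments of the half-plane. The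
    constant is nonzero, so [Clog] moves it into the exponent. *)
Lemma log_deriv_unique (x0 : R) (f g H : C -> C) (qf qg : C -> C) :
  (forall s, x0 < Re s -> f s <> 0 /\ is_Cderive f s (f s * qf s)%C) ->
  (forall s, x0 < Re s -> g s <> 0 /\ is_Cderive g s (g s * qg s)%C) ->
  (forall s, x0 < Re s -> is_Cderive H s (qf s - qg s)%C) ->
  exists c, forall s, x0 < Re s -> f s = (Cexp (H s + c) * g s)%C.
Proof.
move=> Hf Hg HH.
pose F s := (f s * / g s * Cexp (- H s))%C.
have D s : x0 < Re s -> is_Cderive F s 0.
  move=> Hs; have [f0 Df] := Hf s Hs; have [g0 Dg] := Hg s Hs.
  have De := @Cderive_comp Cexp (fun s => - H s)%C s _ _ (Cderive_Cexp _) (Cderive_opp (HH s Hs)).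
  apply: (Cderive_eq (Cderive_mult (Cderive_mult Df (Cderive_inv Dg g0)) De)).
  by field.
pose s0 : C := RtoC (x0 + 1).
have Hs0 : x0 < Re s0 by rewrite re_RtoC; lra.
have K s : x0 < Re s -> F s = F s0.
  move=> Hs; apply: Cderive0_segment => t Ht; apply: D.
  rewrite re_plus re_scal_l re_plus re_opp.
  have [->|t1] : t = 1 \/ t < 1 by lra.
    by lra.
  have : 0 < (1 - t) * (Re s0 - x0) by apply: Rmult_lt_0_compat; lra.
  have : 0 <= t * (Re s - x0) by apply: Rmult_le_pos; lra.
  by lra.
have F0 : F s0 <> 0.
  have [f0 _] := Hf _ Hs0; have [g0 _] := Hg _ Hs0.
  apply: Cmult_neq_0; last exact: Cexp_neq0.
  apply: Cmult_neq_0 => // E; have := Cinv_r _ g0; rewrite E Cmult_0_r => E1.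
  by have := RtoC_inj _ _ E1; lra.
exists (Clog (F s0)) => s Hs; have [g0 _] := Hg _ Hs.
rewrite Cexp_add Cexp_Clog // -(K s Hs) /F Cexp_opp.
by field; split => //; exact: Cexp_neq0.
Qed.

Lemma Cderive_prod (I : Type) (r : seq I) (f : I -> C -> C) (q : I -> C) (s : C) :
  (forall i, is_Cderive (f i) s (f i s * q i)%C) ->
  is_Cderive (fun s => \big[Cmult/RtoC 1]_(i <- r) f i s) s
    (\big[Cmult/RtoC 1]_(i <- r) f i s * \big[Cplus/RtoC 0]_(i <- r) q i)%C.
Proof.
move=> H; elim: r => [|i r IH].
  rewrite !big_nil Cmult_0_r; apply: (Cderive_ext (f := fun _ => RtoC 1)) => [x|].
    by rewrite big_nil.
  exact: Cderive_const.
rewrite !big_cons; apply: (Cderive_ext (f := fun s => f i s * \big[Cmult/RtoC 1]_(i <- r) f i s)%C) => [x|].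
  by rewrite big_cons.
by apply: (Cderive_eq (Cderive_mult (H i) IH)); ring.
Qed.

Lemma Cprod_neq0 (I : Type) (r : seq I) (f : I -> C) :
  (forall i, f i <> 0) -> \big[Cmult/RtoC 1]_(i <- r) f i <> 0.
Proof.
move=> H; elim: r => [|i r IH].
  by rewrite big_nil => E; have := RtoC_inj _ _ E; lra.
by rewrite big_cons; exact: Cmult_neq_0.
Qed.

End Assembly.

(** * The logarithmic derivatives as sums over points and poles *)

Section ZetaSums.
Local Open Scope R_scope.
Variables (X : monoidal_space) (n : X -> nat) (ms : X -> seq nat).

Definition double_sum (f : X -> nat -> C) : C :=
  \big[Cplus/RtoC 0]_(p <- points X) \big[Cplus/RtoC 0]_(j < (n p).+1) f p j.

Lemma double_sum_ext f g : (forall p j, f p j = g p j) -> double_sum f = double_sum g.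
Proof. by move=> E; apply: eq_bigr => p _; apply: eq_bigr => j _. Qed.

Lemma double_sum_plus f g :
  double_sum (fun p j => f p j + g p j)%C = (double_sum f + double_sum g)%C.
Proof. by rewrite /double_sum -big_split /=; apply: eq_bigr => p _; rewrite big_split. Qed.

Lemma double_sum_scal (c : C) f :
  double_sum (fun p j => c * f p j)%C = (c * double_sum f)%C.
Proof. by rewrite /double_sum big_Cmult_r; apply: eq_bigr => p _; rewrite big_Cmult_r. Qed.

Lemma C1at_double_sum (f : X -> nat -> C -> C) z : (forall p j, C1at (f p j) z) ->
  C1at (fun z => double_sum (fun p j => f p j z)) z.
Proof. by move=> H; apply: C1at_sum => p _; apply: C1at_sum => j _. Qed.

Lemma Csum_double_sum (a : X -> nat -> nat -> C) (l : X -> nat -> C) :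
  (forall p j, (j <= n p)%nat -> Csum (a p j) (l p j)) ->
  Csum (fun i => double_sum (fun p j => a p j i)) (double_sum l).
Proof.
by move=> H; apply: Csum_sum => p; apply: Csum_sum => j; apply: H; rewrite -ltnS.
Qed.

Lemma Cint_sum (I : Type) (r : seq I) (f : I -> R -> C) (a b : R) : a <= b ->
  (forall i t, a <= t <= b -> Rcont (f i) t) ->
  Cint (fun t => \big[Cplus/RtoC 0]_(i <- r) f i t) a b = \big[Cplus/RtoC 0]_(i <- r) Cint (f i) a b.
Proof.
move=> ab H; elim: r => [|i r IH].
  rewrite big_nil (@Cint_ext _ (fun _ => RtoC 0)) // => [|t _]; last by rewrite big_nil.
  rewrite (@Cint_derive (fun _ => RtoC 0)) //; first by ring.
  - by move=> t _; exact: Rder_const.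
  - by move=> t _; exact: Rcont_const.
rewrite big_cons -IH -Cint_plus //.
- by apply: Cint_ext => // t _; rewrite big_cons.
- by move=> t Ht; exact: H.
- by move=> t Ht; apply: Rcont_sum => k; exact: H.
Qed.

Lemma Cint_double_sum (f : X -> nat -> R -> C) a b : a <= b ->
  (forall p j t, a <= t <= b -> Rcont (f p j) t) ->
  Cint (fun t => double_sum (fun p j => f p j t)) a b = double_sum (fun p j => Cint (f p j) a b).
Proof.
move=> ab H; rewrite Cint_sum // => [|p t Ht]; last by apply: Rcont_sum => j; exact: H.
by apply: eq_bigr => p _; rewrite Cint_sum // => j t Ht; exact: H.
Qed.

Lemma count_ext_npow (u : R) (s : C) : 0 < u ->
  (count_ext n ms u * npow u (s + 1))%C = double_sum (fun p j =>
    binom_coef (n p) j * (trig_ext (cyc_prod (ms p)) (u - 1) * npow u (s - INR j + 1)))%C.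
Proof.
move=> u0; rewrite /count_ext big_Cmult_l; apply: eq_bigr => p _.
have -> : (((u - 1) ^ n p)%R * trig_ext (cyc_prod (ms p)) (u - 1) * npow u (s + 1) =
  trig_ext (cyc_prod (ms p)) (u - 1) * (((u - 1) ^ n p)%R * npow u (s + 1)))%C by ring.
by rewrite pow_npow // big_Cmult_r; apply: eq_bigr => j _; ring.
Qed.

Lemma Rcont_count_ext u : Rcont (count_ext n ms) u.
Proof.
apply: Rcont_sum => p.
have c1 : continuous (fun u => u - 1) u.
  by apply: (continuous_minus (V := R_NormedModule)); [exact: continuous_id | exact: continuous_const].
apply: Rcont_mult; last exact: (@Rcont_comp (trig_ext (cyc_prod (ms p))) (fun u => u - 1) u (Rcont_trig_ext _ _) c1).
apply: Rcont_real; elim: (n p) => [|k IH]; first exact: continuous_const.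
exact: (continuous_mult (K := R_AbsRing)).
Qed.

Section Values.
Variables (hX : noetherian_F1_scheme X) (O : forall p : X, stalk p).
Hypothesis hO : forall p : X, units_decomp (O p) (n p) (ms p).

(** For k = 1 both sides are the Euler characteristic; for k >= 2 the interpolation is evaluated at
    k - 1 >= 1, where it counts homomorphisms. *)
Lemma count_int_ext i : count_int O n ms i.+1 = count_ext n ms (INR i.+1).
Proof.
rewrite /count_int; case: i => [|i] //=.
rewrite (num_pointsE hX hO) //= INR_sum (big_morph RtoC RtoC_plus erefl).
apply: eq_bigr => p _; rewrite -/(INR i.+2).
have -> : INR i.+2 - 1 = INR i.+1 by rewrite (S_INR i.+1); ring.
have [Hns _] := hO p.
rewrite (trig_ext_nat (fun m => @nhom_cyc_prod_period (ms p) m Hns)) //.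
rewrite -multE mult_INR RtoC_mult; congr (RtoC _ * _)%C.
by elim: (n p) => [|k IH] //; rewrite expnS -multE mult_INR IH.
Qed.

Lemma half_plane_gt1 s p j : half_plane n s -> (j <= n p)%nat -> 1 < Re (s - INR j + 1)%C.
Proof.
rewrite /half_plane => Hs jn.
have jm : (j <= \max_(p <- points X) n p)%nat.
  by apply: (leq_trans jn); apply: leq_bigmax_seq => //; exact: mem_points.
have := le_INR _ _ (elimT leP jm).
by rewrite !re_plus re_opp !re_RtoC; lra.
Qed.

(** The integral is known to converge to v, and the continued pieces sum to the double sum;
    uniqueness of limits equates the two. *)
Lemma integral_value (EI : X -> C -> C) (s v : C) : half_plane n s ->
  (forall p w, 1 < Re w ->
     Csum (piece (trig_family (ms p)) w) (mu (cyc_prod (ms p)) / (w - 1) + EI p w)%C) ->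
  @is_RInt_gen C_R_NormedModule (fun u : R => count_ext n ms u * Cpower u (- s - 1))%C
    (at_point (IZR 1)) (Rbar_locally p_infty) v ->
  v = double_sum (fun p j => binom_coef (n p) j *
        (mu (cyc_prod (ms p)) / (s - INR j) + EI p (s - INR j + 1)))%C.
Proof.
move=> Hs HI Hv; have q0 : 0 <= 1 by lra.
have cf u : 1 <= u -> Rcont (fun u : R => count_ext n ms u * npow u (s + 1))%C u.
  move=> u1; apply: Rcont_mult; first exact: Rcont_count_ext.
  apply: (Rcont_ext (f := fun u => npow (u + 0) (s + 1))) => [x|]; first by rewrite Rplus_0_r.
  by apply: Rcont_npow; lra.
have {}Hv : @is_RInt_gen C_R_NormedModule (fun u : R => count_ext n ms u * npow u (s + 1))%C
    (at_point (IZR 1)) (Rbar_locally p_infty) v.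
  apply: is_RInt_gen_ext Hv.
  exists (fun x => x = 1) (fun y => 1 < y) => //; first by exists 1.
  move=> x y -> y1 u /=; rewrite Rmin_left; last lra.
  by move=> [u1 _]; rewrite Cpower_npow //; lra.
have S := Csum_is_RInt_gen cf Hv.
apply: (Clim_unique S).
have T := @Csum_double_sum (fun p j i => binom_coef (n p) j * piece (trig_family (ms p)) (s - INR j + 1) i)%C
  (fun p j => binom_coef (n p) j * (mu (cyc_prod (ms p)) / (s - INR j) + EI p (s - INR j + 1)))%C _.
apply: (Csum_ext _ (T _)) => [i|p j jn]; last first.
  apply: Csum_scal; have := HI p _ (half_plane_gt1 Hs jn).
  by have -> : (s - INR j + 1 - 1 = s - INR j)%C by ring.
rewrite (@Cint_ext _ (fun t => double_sum (fun p j =>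
    binom_coef (n p) j * (trig_family (ms p) i t * npow (t + INR i.+1) (s - INR j + 1))))%C) //.
  rewrite Cint_double_sum //.
    apply: double_sum_ext => p j; rewrite Cint_scal // => t Ht.
    by apply: Rcont_piece => //; exact: Rcont_trig_family.
  move=> p j t Ht; apply: (Rcont_mult (Rcont_const _ _)).
  by apply: Rcont_piece => //; exact: Rcont_trig_family.
move=> t Ht; rewrite count_ext_npow; last exact: arg_pos.
apply: double_sum_ext => p j; congr (_ * (_ * _))%C.
by rewrite /trig_family; congr trig_ext; rewrite S_INR; ring.
Qed.

Lemma series_value (ED : X -> C -> C) (s v : C) : half_plane n s ->
  (forall p w, 1 < Re w ->
     Csum (fun i => trig_ext (cyc_prod (ms p)) (INR i) * npow (INR i.+1) w)%C
       (mu (cyc_prod (ms p)) / (w - 1) + ED p w)%C) ->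
  @is_series C_AbsRing C_NormedModule
    (fun i : nat => count_int O n ms i.+1 * Cpower (INR i.+1) (- s - 1))%C v ->
  v = double_sum (fun p j => binom_coef (n p) j *
        (mu (cyc_prod (ms p)) / (s - INR j) + ED p (s - INR j + 1)))%C.
Proof.
move=> Hs HD /Csum_is_series S.
apply: (Clim_unique S).
have T := @Csum_double_sum (fun p j i => binom_coef (n p) j *
    (trig_ext (cyc_prod (ms p)) (INR i) * npow (INR i.+1) (s - INR j + 1)))%C
  (fun p j => binom_coef (n p) j * (mu (cyc_prod (ms p)) / (s - INR j) + ED p (s - INR j + 1)))%C _.
apply: (Csum_ext _ (T _)) => [i|p j jn]; last first.
  apply: Csum_scal; have := HD p _ (half_plane_gt1 Hs jn).
  by have -> : (s - INR j + 1 - 1 = s - INR j)%C by ring.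
have i1 := INR_succ_ge1 i.
rewrite count_int_ext Cpower_npow; last lra.
rewrite count_ext_npow; last lra.
apply: double_sum_ext => p j; congr (_ * (trig_ext _ _ * _))%C.
by rewrite S_INR; ring.
Qed.

Lemma zeta_product_derive s : half_plane n s ->
  zeta_product n ms s <> 0 /\
  is_Cderive (zeta_product n ms) s (zeta_product n ms s *
    - double_sum (fun p j => binom_coef (n p) j * (mu (cyc_prod (ms p)) / (s - INR j))))%C.
Proof.
move=> Hs; split.
  by do 2 apply: Cprod_neq0 => ?; exact: Cexp_neq0.
have -> : (- double_sum (fun p j => binom_coef (n p) j * (mu (cyc_prod (ms p)) / (s - INR j))) =
  double_sum (fun p j => RtoC (zeta_exponent (n p) j * mu (cyc_prod (ms p))) / (s - INR j)))%C.
  have -> : forall z : C, (- z = -1 * z)%C by move=> z; ring.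
  rewrite -double_sum_scal; apply: double_sum_ext => p j.
  by rewrite zeta_exponentE RtoC_mult RtoC_opp /Cdiv; ring.
apply: Cderive_prod => p; apply: Cderive_prod => j.
apply: (Cderive_eq (Cderive_Cpower_shift _ _)); last by ring.
have := half_plane_gt1 Hs (ltnSE (ltn_ord j)).
by rewrite re_plus re_RtoC; lra.
Qed.

End Values.
End ZetaSums.

(** * Comparison of the zeta functions and the product *)

Theorem theorem0p4 (X : monoidal_space) (hX : noetherian_F1_scheme X)
    (O : forall p : X, stalk p)
    (n : X -> nat) (ms : X -> seq nat)
    (hO : forall p : X, units_decomp (O p) (n p) (ms p))
    (zeta zeta_disc : C -> C)
    (hzeta : is_soule_zeta n ms zeta)
    (hdisc : is_disc_zeta O n ms zeta_disc) :
  (exists h1 h2 : C -> C,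
     [/\ entire h1, entire h2 &
         forall s : C, half_plane n s ->
           zeta s = (Cexp (h1 s) * zeta_disc s)%C /\
           (Cexp (h1 s) * zeta_disc s)%C
             = (Cexp (h2 s) * zeta_product n ms s)%C])
  /\ (forall ns : seq nat, all (leq 1) ns ->
        mu (cyc_prod ns) = mu_gcd ns).
Proof.
split; last exact: mu_gcdE.
have cont p := trig_continuation (proj1 (hO p)).
have /choice [EI /choice [ED HE]] := cont.
pose sum_of (E : X -> C -> C) (s : C) :=
  double_sum n (fun p j => binom_coef (n p) j * E p (s - INR j + 1))%C.
pose polar (s : C) := double_sum n (fun p j =>
  binom_coef (n p) j * (mu (cyc_prod (ms p)) / (s - INR j)))%C.
have prim E : (forall p w, C1at (E p) w) -> exists F, forall z, is_Cderive F z (sum_of E z).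
  move=> HC; apply: C1_primitive => z; apply: C1at_double_sum => p j.
  apply: C1at_mult; first exact: C1at_const.
  apply: (C1at_ext (f := fun z => E p (z + (- INR j + 1))%C)) => [x|].
    by congr (E p _); ring.
  exact: C1at_shift.
have [HI DI] : exists F, forall z, is_Cderive F z (sum_of EI z).
  by apply: prim => p; case: (HE p).
have [HD DD] : exists F, forall z, is_Cderive F z (sum_of ED z).
  by apply: prim => p; case: (HE p).
have split_sum E s : double_sum n (fun p j => binom_coef (n p) j *
    (mu (cyc_prod (ms p)) / (s - INR j) + E p (s - INR j + 1)))%C = (polar s + sum_of E s)%C.
  by rewrite -double_sum_plus; apply: double_sum_ext => p j; ring.
have Dz s : half_plane n s -> zeta s <> RtoC 0 /\
    is_Cderive zeta s (zeta s * - (polar s + sum_of EI s))%C.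
  move=> Hs; have [z0 [d [v [Dv Iv E]]]] := hzeta s Hs; split => //.
  have Ev : v = (polar s + sum_of EI s)%C.
    rewrite -split_sum; apply: (integral_value hX Hs _ Iv) => p w w1.
    by case: (HE p) => _ _ /(_ w w1).
  by apply: (Cderive_eq Dv); rewrite -Ev -E; field.
have Dd s : half_plane n s -> zeta_disc s <> RtoC 0 /\
    is_Cderive zeta_disc s (zeta_disc s * - (polar s + sum_of ED s))%C.
  move=> Hs; have [z0 [d [v [Dv Iv E]]]] := hdisc s Hs; split => //.
  have Ev : v = (polar s + sum_of ED s)%C.
    rewrite -split_sum; apply: (series_value hX hO Hs _ Iv) => p w w1.
    by case: (HE p) => _ _ _ /(_ w w1).
  by apply: (Cderive_eq Dv); rewrite -Ev -E; field.
have Dp s : half_plane n s -> zeta_product n ms s <> RtoC 0 /\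
    is_Cderive (zeta_product n ms) s (zeta_product n ms s * - polar s)%C.
  exact: zeta_product_derive.
(* The logarithmic derivatives are - (polar + EI) and - (polar + ED), so their difference is ED -
   EI, with primitive HD - HI. *)
have [c1 H1] : exists c, forall s, half_plane n s -> zeta s = (Cexp (HD s + - HI s + c) * zeta_disc s)%C.
  apply: (@log_deriv_unique _ zeta zeta_disc (fun s => HD s + - HI s)%C _ _ Dz Dd) => s _.
  by apply: (Cderive_eq (Cderive_plus (DD s) (Cderive_opp (DI s)))); ring.
(* The product has logarithmic derivative exactly - polar, so - EI remains. *)
have [c2 H2] : exists c, forall s, half_plane n s -> zeta s = (Cexp (- HI s + c) * zeta_product n ms s)%C.
  apply: (@log_deriv_unique _ zeta (zeta_product n ms) (fun s => - HI s)%C _ _ Dz Dp) => s _.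
  by apply: (Cderive_eq (Cderive_opp (DI s))); ring.
exists (fun s => HD s + - HI s + c1)%C, (fun s => - HI s + c2)%C; split.
- move=> z; eexists; apply: Cderive_plus; last exact: Cderive_const.
  exact: Cderive_plus (DD z) (Cderive_opp (DI z)).
- move=> z; eexists; apply: Cderive_plus; last exact: Cderive_const.
  exact: Cderive_opp (DI z).
- by move=> s Hs; rewrite -H1 // -H2.
Qed.
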